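(* Let $\Sigma=((\Phi^{(i)})_{i\in I},(\mathbf{p}_i)_{i\in I},\mathbb{P})$ be a non-trivial Bernoulli model satisfying the strong separation condition. Then there exists a non-trivial $S$-ergodic distribution $Q$ on $\mathcal{M}^{\square}$ such that for $\mathbb{P}$-a.e. $\omega$ the measure $\eta^{(\omega)}$ generates $Q$.
   Context: Model: Let $I$ be a finite set and for each $i\in I$ let $\Phi^{(i)}=(f^{(i)}_1,\dots,f^{(i)}_{k_i})$ be a homogeneous IFS: there is $r_i\in(-1,0)\cup(0,1)$ with $f^{(i)}_j(x)=r_i x+t^{(i)}_j$, $t^{(i)}_j\in\mathbb{R}$ ($k_i=1$ is allowed). Let $\Omega=I^{\mathbb{N}}$ with left shift $\sigma$. For $\omega\in\Omega$ let $X^{(\omega)}_\infty=\prod_{j\ge1}\{1,\dots,k_{\omega_j}\}$, and define $\Pi_\omega(u)=\sum_{n\ge1}\big(\prod_{j=1}^{n-1}r_{\omega_j}\big)t^{(\omega_n)}_{u_n}$ for $u\in X^{(\omega)}_\infty$, with image $Y^{(\omega)}$. Then $Y^{(\omega)}=\bigcup_{u=1}^{k_{\omega_1}} f^{(\omega_1)}_u(Y^{(\sigma\omega)})$; the strong separation condition means this union is disjoint for every $\omega\in\Omega$ (a single set counts as disjoint). For each $i$ let $\mathbf{p}_i$ be a strictly positive probability vector on $\{1,\dots,k_i\}$; $\bar\eta^{(\omega)}=\prod_n\mathbf{p}_{\omega_n}$ and $\eta^{(\omega)}=\Pi_\omega\bar\eta^{(\omega)}$. $\mathbb{P}$ is a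 $\sigma$-invariant probability on $\Omega$; the model is Bernoulli if $\mathbb{P}$ is a Bernoulli measure, non-trivial if $\eta^{(\omega)}$ is non-atomic for $\mathbb{P}$-a.e. $\omega$. Scenery flow: $\mathcal{M}^{\square}=\{\mu\in\mathcal{P}([-1,1]):0\in\operatorname{supp}\mu\}$. For $\mu\in\mathcal{P}(\mathbb{R})$ and $x\in\operatorname{supp}\mu$, $\mu_x(E)=\mu(E+x)/\mu([x-1,x+1])$ for Borel $E\subset[-1,1]$. For $\nu\in\mathcal{M}^{\square}$ and $t\ge0$, $S_t\nu(E)=\nu(e^{-t}E)/\nu([-e^{-t},e^{-t}])$ for Borel $E\subset[-1,1]$; $S=(S_t)_{t\ge0}$ is the scaling flow. A measure $\mu$ generates a distribution $P\in\mathcal{P}(\mathcal{P}([-1,1]))$ at $x$ if $\frac1T\int_0^T f(S_t\mu_x)\,dt\to\int f\,dP$ for all $f\in C(\mathcal{P}([-1,1]))$ (weak topology), and generates $P$ if this holds for $\mu$-a.e. $x$. A distribution is trivial if it is the point mass at $\delta_0\in\mathcal{M}^{\square}$; it is $S$-ergodic if it is $S$-invariant and ergodic for the flow $S$. *)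

(* Defs.v *)
From HB Require Import structures.
From mathcomp Require Import all_boot all_order all_algebra.
From mathcomp Require Import all_classical all_reals all_analysis.
From mathcomp Require Import measurable_realfun.
Set Implicit Arguments. Unset Strict Implicit. Unset Printing Implicit Defensive.
Import Order.TTheory GRing.Theory Num.Theory.
Import numFieldNormedType.Exports.
Local Open Scope classical_set_scope.
Local Open Scope ring_scope.

(* Index convention: sequences are indexed from 0 (omega 0 = omega_1). *)

Definition seqsp (T : Type) (t0 : T) := nat -> T.
HB.instance Definition _ (T : Type) (t0 : T) :=
  gen_eqMixin (seqsp t0).
HB.instance Definition _ (T : Type) (t0 : T) :=
  gen_choiceMixin (seqsp t0).
HB.instance Definition _ (T : Type) (t0 : T) :=
  isPointed.Build (seqsp t0) (fun _ => t0).

Definition cyl (T : Type) (t0 : T) (w : seq T) : set (seqsp t0) :=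
  [set u | [seq u n | n <- iota 0 (size w)] = w].

Definition cylinders (T : Type) (t0 : T) : set (set (seqsp t0)) :=
  [set @cyl T t0 w | w in [set: seq T]].

Definition SeqSp (T : Type) (t0 : T) := g_sigma_algebraType (@cylinders T t0).

Definition shift (T : Type) (w : nat -> T) : nat -> T := fun n => w n.+1.

(*   I : finite index set, k i = number of maps of Phi^(i) (digits are *)
(*   0 .. k i - 1), r i = contraction ratio, t i a = translations.     *)
Section Model.
Context {R : realType} {I : finType}.
Variables (k : I -> nat) (r : I -> R) (t : I -> nat -> R).

Definition ifs_map (i : I) (a : nat) (x : R) : R := r i * x + t i a.

Definition Xinf (om : nat -> I) : set (nat -> nat) :=
  [set u | forall n, (u n < k (om n))%N].

Definition Pi (om : nat -> I) (u : nat -> nat) : R :=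
  limn (series (fun n => (\prod_(j < n) r (om j)) * t (om n) (u n))).

Definition Yset (om : nat -> I) : set R := Pi om @` Xinf om.

Definition SSC : Prop :=
  forall (om : nat -> I) (a b : nat), (a < k (om 0%N))%N -> (b < k (om 0%N))%N ->
    a <> b ->
    (ifs_map (om 0%N) a @` Yset (shift om)) `&` (ifs_map (om 0%N) b @` Yset (shift om))
      = set0.

End Model.

Definition PMT (R : realType) := {measure set R -> \bar R}.
HB.instance Definition _ (R : realType) := gen_eqMixin (PMT R).
HB.instance Definition _ (R : realType) := gen_choiceMixin (PMT R).
HB.instance Definition _ (R : realType) :=
  isPointed.Build (PMT R) (mzero : {measure set R -> \bar R}).

Section Scenery.
Context {R : realType}.
Local Open Scope ereal_scope.

(* nu is (the extension to R of) a probability measure on [-1,1] *)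
Definition Pm11 (nu : PMT R) : Prop :=
  nu setT = 1 /\ nu (~` (`[(-1)%R, 1%R]%classic : set R)) = 0.

Definition wint (g : R -> R) (nu : PMT R) : R :=
  fine (\int[nu]_(y in `[(-1)%R, 1%R]) (g y)%:E).

Definition wnbhd (nu : PMT R) (m : nat) (g : 'I_m -> R -> R) (del : R)
  : set (PMT R) :=
  [set nu' | Pm11 nu' /\ forall i, (`|wint (g i) nu' - wint (g i) nu| < del)%R].

Definition cont11 (g : R -> R) : Prop := {within `[(-1)%R, 1%R], continuous g}.

Definition weak_open (U : set (PMT R)) : Prop :=
  U `<=` Pm11 /\
  forall nu, U nu -> exists (m : nat) (g : 'I_m -> R -> R) (del : R),
      (0 < del)%R /\ (forall i, cont11 (g i)) /\ wnbhd nu g del `<=` U.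

Definition weak_continuous (f : PMT R -> R) : Prop :=
  forall nu, Pm11 nu -> forall eps : R, (0 < eps)%R ->
    exists (m : nat) (g : 'I_m -> R -> R) (del : R),
      (0 < del)%R /\ (forall i, cont11 (g i)) /\
      forall nu', wnbhd nu g del nu' -> (`|f nu' - f nu| < eps)%R.

End Scenery.

(* the measurable space P([-1,1]) (inside all measures on R) with the *)
(* Borel sigma-algebra of the weak topology                           *)
Definition PM (R : realType) := g_sigma_algebraType (@weak_open R).

Section Zoom.
Context {R : realType}.
Local Open Scope ereal_scope.

Definition aff (x s : R) (y : R) : R := ((y - x) / s)%R.

Lemma measurable_aff x s : measurable_fun [set: R] (aff x s).
Proof.
apply: measurable_funM; last exact: measurable_cst.
apply: measurable_funB; [exact: measurable_id | exact: measurable_cst].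
Qed.

Definition pf (nu : {measure set R -> \bar R}) (x s : R) : set R -> \bar R :=
  pushforward nu (aff x s).

Let pf0 nu x s : pf nu x s set0 = 0.
Proof. by rewrite /pf /pushforward preimage_set0 measure0. Qed.

Let pf_ge0 nu x s A : 0 <= pf nu x s A.
Proof. rewrite /pf /pushforward; exact: measure_ge0. Qed.

Let pf_sigma_additive nu x s : semi_sigma_additive (pf nu x s).
Proof.
move=> F mF tF mUF; rewrite /pf /pushforward preimage_bigcup.
have mf := measurable_aff x s.
apply: measure_semi_sigma_additive.
- by move=> n; rewrite -[X in measurable X]setTI; exact: mf.
- apply/trivIsetP => /= i j _ _ ij; rewrite -preimage_setI.
  by move/trivIsetP : tF => /(_ _ _ _ _ ij) ->//; rewrite preimage_set0.
- by rewrite -preimage_bigcup -[X in measurable X]setTI; exact: mf.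
Qed.

HB.instance Definition _ nu x s := isMeasure.Build _ _ _
  (pf nu x s) (pf0 nu x s) (pf_ge0 nu x s) (@pf_sigma_additive nu x s).

Lemma measurable_m11 : measurable (`[(-1)%R, 1%R] : set R).
Proof. exact: measurable_itv. Qed.

Lemma normc_ge0 (c : \bar R) : (0 <= `|fine c|^-1)%R.
Proof. by rewrite invr_ge0 normr_ge0. Qed.

(* 1 / c  (c is a nonnegative finite measure value here) *)
Definition normc (c : \bar R) : {nonneg R} := NngNum (normc_ge0 c).

(* zoom nu x s (E) = nu(s E + x) / nu([x-s, x+s])  for E in [-1,1] *)
Definition zoom (nu : PMT R) (x s : R) : PMT R :=
  mscale (normc (nu `[(x - s)%R, (x + s)%R]%classic))
    (mrestr (pf nu x s) measurable_m11).

Definition loc (mu : PMT R) (x : R) : PMT R := zoom mu x 1.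
Definition Sflow (tt : R) (nu : PMT R) : PMT R := zoom nu 0 (expR (- tt)).

End Zoom.

Section Distributions.
Context {R : realType}.
Local Open Scope ereal_scope.

Definition Msq : set (PM R) :=
  [set nu | Pm11 nu /\ forall e : R, (0 < e)%R -> 0 < nu `](- e)%R, e[%classic].

Definition delta0 : PM R := (\d_(0%R : R) : {measure set R -> \bar R}).

Definition trivial_distr (Q : probability (PM R) R) : Prop :=
  forall E : set (PM R), measurable E -> Q E = \d_delta0 E.

Definition S_invariant (Q : probability (PM R) R) : Prop :=
  forall tt : R, (0 <= tt)%R -> forall E : set (PM R), measurable E ->
    Q ((Sflow tt) @^-1` E `&` Msq) = Q E.

Definition S_ergodic (Q : probability (PM R) R) : Prop :=
  Q Msq = 1 /\ S_invariant Q /\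
  forall E : set (PM R), measurable E ->
    (forall tt : R, (0 <= tt)%R -> (Sflow tt) @^-1` E `&` Msq = E `&` Msq) ->
    Q E = 0 \/ Q E = 1.

Definition generates_at (mu : PMT R) (x : R) (Q : probability (PM R) R) : Prop :=
  forall f : PM R -> R, weak_continuous f ->
    (fun T : R => (T^-1 * Rintegral lebesgue_measure `[0%R, T]%classic
                     (fun tt : R => f (Sflow tt (loc mu x))))%R)
      @ +oo%R --> Rintegral Q (Pm11 : set (PM R)) f.

Definition generates (mu : PMT R) (Q : probability (PM R) R) : Prop :=
  {ae mu, forall x, generates_at mu x Q}.

End Distributions.

(* Submission.v *)
(* A point of a fibre is coded by its sequence z of pairs (letter, digit), which
   is i.i.d. when omega is P-random and the point is eta^(omega)-random.  By
   strong separation, below a fixed scale the scenery of eta^(omega) at the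
   point coded by z, zoomed in by |r_(z_0)|, is the scenery at the point coded
   by the shifted sequence, reflected when r_(z_0) < 0.  Hence the sceneries
   follow a suspension flow with roof -ln |r_(z_0)| over the skew product of a
   Bernoulli shift with Z/2, the second coordinate recording the orientation.
   Q is the image of the invariant measure of this suspension; its ergodicity
   is that of the skew product.  For almost every code, all words occur with
   the right frequency jointly with the orientation, and where eta^(omega) is
   non-atomic the scenery depends continuously on the code and the scale; so
   time averages of continuous functions along the orbit converge to their
   Q-integrals. *)

Require Import Defs.
From HB Require Import structures.
From mathcomp Require Import all_boot all_order all_algebra.
From mathcomp Require Import all_classical all_reals all_analysis.
From mathcomp Require Import measurable_realfun.
From mathcomp Require Import ring lra zify.
Set Implicit Arguments. Unset Strict Implicit. Unset Printing Implicit Defensive.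
Import Order.TTheory GRing.Theory Num.Theory.
Import numFieldNormedType.Exports.
Import Defs.
Local Open Scope classical_set_scope.
Local Open Scope ring_scope.

(** * Sequence spaces *)

(** No ergodic theorem is used. Only continuous observables occur in [generates], so it suffices
    that words have the right frequencies jointly with the orientation, and these follow from second
    moments. The key is that counts weighted by the orientation sign have means bounded in [n]:
    prefixing a letter multiplies the mean by [1 - 2 * rho], where [rho] is the probability of a
    reflecting letter, and this factor differs from 1 unless [rho] is zero. If [rho] is zero, only
    the side [false], where orbits start, carries mass. Two compactness arguments supply uniformity.
    Strong separation is given fibre by fibre; a limit of pairs of codes yields one gap [d] for all
    fibres. Sceneries renormalise under the shift only at scales below [d], hence the region under
    the roof starts at height [C = |ln d| + 1] instead of zero. Test functions are only assumed
    weakly continuous; they are bounded because the probability measures on [-1,1] form a compact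
    space, which is seen through pointwise limits of quantile functions. *)

Section SequenceSpace.
Context {T : choiceType} {t0 : T}.
Implicit Types (w v : seq T) (u : nat -> T).

Lemma cylE w u : cyl (t0 := t0) w u = (mkseq u (size w) = w).
Proof. by []. Qed.

Lemma cylP w u :
  cyl (t0 := t0) w u <-> forall n, (n < size w)%N -> u n = nth t0 w n.
Proof.
rewrite cylE; split => [{2}<- n nw|H]; first by rewrite nth_mkseq.
by apply: (@eq_from_nth _ t0) => [|i]; rewrite size_mkseq // => iw;
  rewrite nth_mkseq // H.
Qed.

Lemma cyl_mkseq m u : cyl (t0 := t0) (mkseq u m) u.
Proof. by rewrite cylE size_mkseq. Qed.

Lemma measurable_cyl w : measurable (cyl (t0 := t0) w : set (SeqSp t0)).
Proof. by apply: sub_sigma_algebra; exists w. Qed.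

Lemma cyl_nil : cyl (t0 := t0) [::] = setT.
Proof. by apply/seteqP; split. Qed.

Lemma cylI_le w v : (size w <= size v)%N ->
  cyl (t0 := t0) w `&` cyl (t0 := t0) v =
  if take (size w) v == w then cyl (t0 := t0) v else set0.
Proof.
move=> wv; case: eqP => e; apply/seteqP; split => u //=.
- by case.
- move=> uv; split=> //; rewrite cylE -[RHS]e -[in RHS]uv /mkseq -map_take.
  by rewrite take_iota (minn_idPl wv).
- case=> uw uv; case: e; rewrite -[LHS]/(take (size w) v) -[in LHS]uv -map_take.
  by rewrite take_iota (minn_idPl wv).
Qed.

(** The empty set is added because two cylinders are nested or disjoint; with it the family is
    closed under intersection, as Dynkin's theorem requires. *)
Definition cylinders0 : set (set (SeqSp t0)) :=
  [set A | A = set0 \/ cylinders (t0 := t0) A].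

Lemma cylinders0_gen : @measurable _ (SeqSp t0) = <<s cylinders0 >>.
Proof.
apply/seteqP; split.
- apply: smallest_sub; first exact: smallest_sigma_algebra.
  by move=> A ?; apply: sub_sigma_algebra; right.
- apply: smallest_sub; first exact: smallest_sigma_algebra.
  move=> A [->|]; last exact: sub_sigma_algebra.
  exact: (@measurable0 _ (SeqSp t0)).
Qed.

Lemma cylinders0I : setI_closed cylinders0.
Proof.
move=> A B [->|[w _ <-]]; first by rewrite set0I; left.
move=> [->|[v _ <-]]; first by rewrite setI0; left.
have [le|/ltnW le] := leqP (size w) (size v).
  by rewrite cylI_le //; case: ifP => _; [right; exists v|left].
by rewrite setIC cylI_le //; case: ifP => _; [right; exists w|left].
Qed.

Lemma seqsp_induction (P : set_system (SeqSp t0)) :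
  (forall w, P (cyl w)) ->
  (forall S, measurable S -> P S -> P (~` S)) ->
  (forall F : (set (SeqSp t0))^nat, (forall n, measurable (F n)) ->
    trivIset [set: nat] F -> (forall n, P (F n)) -> P (\bigcup_k F k)) ->
  forall S, measurable S -> P S.
Proof.
move=> Pc PC PU S; rewrite cylinders0_gen.
have PT : P setT by rewrite -cyl_nil; exact: Pc.
have GP : cylinders0 `<=` P.
  by move=> A [->|[w _ <-] //]; rewrite -setCT; exact: PC.
exact: (dynkin_induction cylinders0_gen cylinders0I PT GP PC PU).
Qed.

Lemma seqsp_measure_unique (R : realType) (m1 m2 : {measure set (SeqSp t0) -> \bar R}) :
  (forall w, m1 (cyl w) = m2 (cyl w)) -> (m1 setT < +oo)%E ->
  forall S, measurable S -> m1 S = m2 S.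
Proof.
move=> e fin; apply: (measure_unique cylinders0 (fun=> setT)).
- exact: cylinders0_gen.
- exact: cylinders0I.
- by move=> i; right; exists [::] => //; exact: cyl_nil.
- by apply/seteqP; split => // x _; exists 0%N.
- by move=> A [->|[w _ <-] //]; rewrite !measure0.
- by [].
Qed.

Lemma measurable_fun_seqsp d (X : measurableType d) (f : X -> SeqSp t0) :
  (forall w, measurable (f @^-1` cyl w)) -> measurable_fun setT f.
Proof.
move=> H; pose C := @cylinders T t0 : set (set (SeqSp t0)).
have e : @measurable _ (SeqSp t0) = <<s C >> by [].
apply: (measurability C e) => _ [_ [w _ <-] <-].
by rewrite setTI; exact: H.
Qed.

Lemma mkseqD u m n : mkseq u (m + n) = mkseq u m ++ mkseq (fun i => u (m + i)%N) n.
Proof.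
by rewrite /mkseq iotaD map_cat add0n -[in X in _ ++ X](addn0 m) iotaDl -map_comp.
Qed.

Lemma cyl_cat w v u : cyl (t0 := t0) (w ++ v) u <->
  cyl (t0 := t0) w u /\ cyl (t0 := t0) v (fun i => u (size w + i)%N).
Proof.
rewrite !cylE size_cat mkseqD; split => [/eqP|[-> ->] //].
by rewrite eqseq_cat ?size_mkseq // => /andP[/eqP -> /eqP ->].
Qed.

End SequenceSpace.

Section CountableLetters.
Context {T : countType} {t0 : T}.

(** There are countably many words over a countable alphabet, so any condition on a prefix cuts out
    a countable union of cylinders. *)
Lemma measurable_prefix n (B : set (seq T)) :
  measurable [set u : SeqSp t0 | B (mkseq u n)].
Proof.
rewrite (_ : mkset _ =
  \bigcup_w (cyl w `&` [set _ : SeqSp t0 | size w = n /\ B w])); last first.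
  apply/seteqP; split => u /=.
    by exists (mkseq u n) => //; split; [exact: cyl_mkseq|rewrite size_mkseq].
  by move=> [w _ [uw [<- Bw]]]; rewrite (uw : mkseq u _ = w).
apply: countable_bigcupT_measurable => [|w]; first exact: countableP.
have [?|?] := pselect (size w = n /\ B w).
  rewrite (_ : [set _ | _] = setT) ?setIT; first exact: measurable_cyl.
  by apply/seteqP; split.
by rewrite (_ : [set _ | _] = set0) ?setI0 //; apply/seteqP; split.
Qed.

Lemma measurable_coord n (B : set T) : measurable [set u : SeqSp t0 | B (u n)].
Proof.
have := measurable_prefix n.+1 [set w | B (nth t0 w n)].
by congr (measurable _); apply/seteqP; split => u /=; rewrite nth_mkseq.
Qed.

Lemma measurable_shiftn m : measurable_fun setT
  (fun u : SeqSp t0 => (fun n => u (m + n)%N) : SeqSp t0).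
Proof.
apply: measurable_fun_seqsp => w.
have := measurable_prefix (m + size w) [set v | drop m v = w].
by congr (measurable _); apply/seteqP; split => u /=;
  rewrite mkseqD drop_size_cat ?size_mkseq.
Qed.

Lemma measurable_shift : measurable_fun setT (@shift T : SeqSp t0 -> SeqSp t0).
Proof. exact: (measurable_shiftn 1). Qed.

Lemma measurable_fun_prefix (R : realType) n (g : seq T -> R) :
  measurable_fun setT (fun u : SeqSp t0 => g (mkseq u n)).
Proof.
by move=> _ Y mY; rewrite setTI; exact: (measurable_prefix n (g @^-1` Y)).
Qed.

End CountableLetters.

(** * Integration and weakly continuous functions *)

Section Push.
Local Open Scope ereal_scope.
Context d1 d2 (T1 : measurableType d1) (T2 : measurableType d2) (R : realType).

(** The measurability proof is an argument, so that the structure of a measure can be attached to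
    the term itself. *)
Definition push (m : {measure set T1 -> \bar R}) (f : T1 -> T2)
  (mf : measurable_fun setT f) : set T2 -> \bar R := pushforward m f.

Variables (m : {measure set T1 -> \bar R}) (f : T1 -> T2).
Variable mf : measurable_fun setT f.

Let push0 : push m mf set0 = 0.
Proof. by rewrite /push /pushforward preimage_set0 measure0. Qed.

Let push_ge0 A : 0 <= push m mf A.
Proof. exact: measure_ge0. Qed.

Let push_sigma_additive : semi_sigma_additive (push m mf).
Proof.
move=> F mF tF mUF; rewrite /push /pushforward preimage_bigcup.
apply: measure_semi_sigma_additive.
- by move=> n; rewrite -[X in measurable X]setTI; exact: mf.
- apply/trivIsetP => /= i j _ _ ij; rewrite -preimage_setI.
  by move/trivIsetP : tF => /(_ _ _ _ _ ij) ->//; rewrite preimage_set0.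
- by rewrite -preimage_bigcup -[X in measurable X]setTI; exact: mf.
Qed.

HB.instance Definition _ := isMeasure.Build _ _ _
  (push m mf) push0 push_ge0 push_sigma_additive.

Lemma integral_push (g : T2 -> \bar R) : measurable_fun setT g ->
  m.-integrable setT (g \o f) -> \int[push m mf]_y g y = \int[m]_x g (f x).
Proof.
move=> mg ig; have := @integral_pushforward _ _ _ _ _ _ mf m setT g mg.
by rewrite preimage_setT => /(_ ig measurableT).
Qed.

End Push.

Lemma le_bounded_integrable d (T : measurableType d) (R : realType)
    (m : {measure set T -> \bar R}) (A : set T) (f : T -> R) (B : R) :
  measurable A -> (m A < +oo)%E -> measurable_fun A f ->
  (forall x, A x -> `|f x| <= B) -> m.-integrable A (EFin \o f).
Proof.
move=> mA fin mf fB; apply: measurable_bounded_integrable => //.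
exists B; split; first exact: num_real.
by move=> x Bx y Ay /=; rewrite (le_trans (fB _ Ay)) // ltW.
Qed.

Lemma measure1_setC d (T : measurableType d) (R : realType)
    (m : {measure set T -> \bar R}) (A : set T) :
  measurable A -> m setT = 1%E -> m (~` A) = (1 - m A)%E.
Proof.
move=> mA mT; have mT' : (m setT < +oo)%E by rewrite mT ltry.
by rewrite -setTD measureD // setTI; congr (_ - _)%E.
Qed.

Section MeasureRestriction.
Context d (T : measurableType d) (R : realType).
Variables (m : {measure set T -> \bar R}) (D : set T) (mD : measurable D).

Lemma integral_mrestr (f : T -> \bar R) : (mrestr m mD).-integrable setT f ->
  (\int[mrestr m mD]_x f x = \int[m]_(x in D) f x)%E.
Proof.
move=> fi; rewrite [LHS](negligible_integral (N := ~` D)) //=.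
- rewrite setTD setCK; apply: eq_measure_integral => A mA AD.
  by rewrite /= /mrestr (setIidl AD).
- exact: measurableC.
- by rewrite /mrestr setICl measure0.
Qed.

End MeasureRestriction.

(** * Compactness of the probability measures on [-1,1] via quantile functions *)

Section Compactness.
Context {R : realType}.
Implicit Types (g : R -> R) (q : R -> R) (nu : PMT R).
Local Notation leb := (@lebesgue_measure R).
Local Notation I01 := (`]0%R, 1%R[%classic : set R).
Local Notation J := (`[(-1)%R, 1%R]%classic : set R).

(** The error is affine in [|x - y|] rather than an epsilon-delta modulus because it will be
    integrated against [|q t - q' t|], of which only the mean is small. If every [C = n] failed,
    boundedness of [g] would force the offending pairs together, and continuity at a cluster point
    excludes this. *)
Lemma cont11_modulus g (e : R) : cont11 g -> 0 < e ->
  exists2 C : R, 0 <= C & forall x y : R, J x -> J y ->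
    `|g x - g y| <= e + C * `|x - y|.
Proof.
move=> cg e0; apply: contrapT => H.
have {}H n : {xy : R * R | [/\ J xy.1, J xy.2 &
    e + n%:R * `|xy.1 - xy.2| < `|g xy.1 - g xy.2|]}.
  apply: cid; apply: contrapT => K; apply: H; exists n%:R => // x y Jx Jy.
  by rewrite leNgt; apply/negP => L; apply: K; exists (x, y).
pose x n := (projT1 (H n)).1; pose y n := (projT1 (H n)).2.
have xP n : J (x n) by rewrite /x; case: (H n) => ? [].
have yP n : J (y n) by rewrite /y; case: (H n) => ? [].
have gP n : e + n%:R * `|x n - y n| < `|g (x n) - g (y n)|.
  by rewrite /x /y; case: (H n) => ? [].
have [B B0 gB] : exists2 B : R, 0 < B & forall z, J z -> `|g z| <= B.
  have cpt : compact (g @` J).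
    by apply: continuous_compact => //; exact: segment_compact.
  have /compact_bounded[M [_ MP]] := cpt.
  exists (`|M| + 1); first by rewrite ltr_wpDl.
  have MM : M < `|M| + 1 by rewrite (le_lt_trans (ler_norm M)) // ltrDl.
  by move=> z Jz; apply: (MP _ MM); exists z.
have [l [Jl lc]] : (J `&` cluster (x @ \oo)) !=set0.
  have cJ : compact J by exact: segment_compact.
  by have [l ?] := cJ _ (fmap_proper_filter x eventually_filter)
    (ex_intro2 _ _ 0%N I (fun n _ => xP n)); exists l.
have e2 : 0 < e / 2 by rewrite divr_gt0.
have [d d0 dP] : exists2 d : R, 0 < d & forall z, J z -> `|l - z| < d -> `|g l - g z| < e / 2.
  have /subspace_continuousP/(_ l Jl)/cvgrPdist_lt/(_ _ e2) := cg.
  rewrite near_withinE => /nbhs_ballP[d /= d0 dP]; exists d => // z Jz lz.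
  exact: dP.
(* A violation at index [n] gives [n |x - y| < 2 B]; beyond [4 B / d] the two points are within
   [d / 2], so both lie within [d] of the cluster point. *)
pose N := (Num.truncn (4 * B / d)).+1.
have NP : 4 * B / d < N%:R by apply: truncnS_gt.
have d2 : 0 < d / 2 by rewrite divr_gt0.
have tail : (x @ \oo) (x @` [set n | (N <= n)%N]).
  by exists N => // n /= Nn; exists n.
have [_ [[n Nn <-] ln]] := lc _ _ tail (nbhsx_ballx l (d / 2) d2).
have := gP n; rewrite ltNge => /negP; apply.
have gn : `|g (x n) - g (y n)| <= 2 * B.
  by rewrite (le_trans (ler_normB _ _)) // mulr_natl mulr2n lerD ?gB.
have N0 : 0 < n%:R :> R by rewrite ltr0n (leq_trans _ Nn).
have xy : `|x n - y n| < d / 2.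
  have : n%:R * `|x n - y n| < 2 * B.
    by rewrite (lt_le_trans _ gn) // (le_lt_trans _ (gP n)) // lerDr ltW.
  rewrite -ltr_pdivlMl // => /lt_le_trans; apply.
  rewrite ler_pdivrMl // ltW // -ltr_pdivrMr //.
  rewrite (lt_le_trans _ (_ : N%:R <= _)) ?ler_nat //.
  apply: le_lt_trans NP; rewrite le_eqVlt; apply/orP; left; apply/eqP.
  by field; rewrite gt_eqF.
have lx : `|l - x n| < d by rewrite (lt_trans ln) // ltr_pdivrMr // ltr_pMr // ltr1n.
have ly : `|l - y n| < d.
  rewrite (_ : l - y n = (l - x n) + (x n - y n)); last by ring.
  by rewrite (le_lt_trans (ler_normD _ _)) // [ltRHS]splitr ltrD.
rewrite (le_trans _ (_ : e <= _)) //; last by rewrite lerDl mulr_ge0.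
rewrite (_ : g (x n) - g (y n) = (g l - g (y n)) - (g l - g (x n))); last by ring.
by rewrite (le_trans (ler_normB _ _)) // [leRHS]splitr lerD // ltW // dP.
Qed.

Lemma cont11_bounded g : cont11 g -> exists2 B : R, 0 < B & forall z, J z -> `|g z| <= B.
Proof.
move=> cg; have [C C0 H] := cont11_modulus cg ltr01.
have J0 : J 0 by rewrite /= in_itv /= lerN10 ler01.
exists (1 + C + `|g 0|); first by rewrite ltr_pwDl // ltr_wpDr.
move=> z Jz; have z1 : `|z - 0| <= 1 by rewrite subr0 ler_norml; move: Jz; rewrite /= in_itv.
rewrite -[g z](subrK (g 0)) (le_trans (ler_normD _ _)) // lerD2r.
by rewrite (le_trans (H z 0 Jz J0)) // lerD2l ler_piMr.
Qed.

(** Law of [q] under the uniform measure on []0, 1[]. With [q] a quantile function every element of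
    P([-1,1]) has this form on Borel sets, so limits of measures reduce to limits of monotone
    functions. *)
Definition nuq q (mq : measurable_fun setT q) : PMT R :=
  push (mrestr leb (measurable_itv `]0%R, 1%R[ : measurable I01)) mq.

Lemma lebI01 : leb I01 = 1%E.
Proof. by rewrite lebesgue_measure_itv /= lte_fin ltr01 oppr0 adde0. Qed.

Lemma lebI01_lty : (leb I01 < +oo)%E.
Proof. by rewrite lebI01 ltry. Qed.

Lemma Pm11_nuq q (mq : measurable_fun setT q) : (forall t, J (q t)) -> Pm11 (nuq mq).
Proof.
move=> qJ; split; rewrite /nuq /= /push /pushforward /mrestr.
  by rewrite preimage_setT setTI lebI01.
have -> : q @^-1` (~` J) = set0 by apply/seteqP; split => t // /(_ (qJ t)).
by rewrite set0I measure0.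
Qed.

Lemma cont11_measurable g : cont11 g -> measurable_fun J g.
Proof. by move=> cg; apply: subspace_continuous_measurable_fun. Qed.

Lemma wint_nuq q (mq : measurable_fun setT q) g : (forall t, J (q t)) -> cont11 g ->
  wint g (nuq mq) = fine (\int[leb]_(t in I01) (g (q t))%:E)%E.
Proof.
move=> qJ cg; rewrite /wint; congr fine.
have [B B0 gB] := cont11_bounded cg.
rewrite integral_mkcond.
have mG : measurable_fun setT (g \_ J) by apply/measurable_restrict => //=; rewrite ?setTI; exact: cont11_measurable.
have mI : measurable I01 by exact: measurable_itv.
have gJB y : `|(g \_ J) y| <= B.
  by rewrite patchE; case: ifPn => [/set_mem/gB//|_]; rewrite normr0 ltW.
transitivity (\int[nuq mq]_(y in setT) ((g \_ J) y)%:E)%E.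
  by apply: eq_integral => y _; rewrite !patchE; case: ifP.
have mgq : measurable_fun setT ((g \_ J) \o q) by exact: measurableT_comp.
rewrite integral_push; last 2 first.
- exact/measurable_EFinP.
- apply: (le_bounded_integrable (B := B)) => //.
  by rewrite /= /mrestr setTI lebI01 ltry.
rewrite integral_mrestr; last first.
  apply: (le_bounded_integrable (B := B)) => //.
  by rewrite /= /mrestr setTI lebI01 ltry.
by apply: eq_integral => t _; rewrite /= patchE mem_set.
Qed.

Let ray (x : R) : set R := `]-oo, x]%classic.

Definition cdfm nu (x : R) : R := fine (nu (ray x)).

(** Generalised inverse of the distribution function. Adding the point 1 keeps the set nonempty, so
    that the value lies in [-1,1] for every real [t] and every [nu]. *)
Definition quant nu (t : R) : R := inf ([set 1] `|` [set x | J x /\ t <= cdfm nu x]).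

Let S nu (t : R) := [set 1] `|` [set x | J x /\ t <= cdfm nu x].

Let S1 nu t : S nu t 1. Proof. by left. Qed.

Let SJ nu t : S nu t `<=` J.
Proof. by move=> x [->|[]//]; rewrite /= in_itv /= lexx (le_trans (lerN10 _) ler01). Qed.

Let SlbJ nu t : lbound (S nu t) (-1).
Proof. by move=> x /SJ; rewrite /= in_itv /= => /andP[]. Qed.

Lemma quant_J nu t : J (quant nu t).
Proof.
rewrite /= in_itv /=; apply/andP; split.
  by apply: lb_le_inf; [exists 1; exact: S1|exact: SlbJ].
by apply: ge_inf; [exists (-1); exact: SlbJ|exact: S1].
Qed.

Lemma quant_nondecreasing nu : nondecreasing_fun (quant nu).
Proof.
move=> s t st; apply: lb_le_inf; first by exists 1; exact: S1.
move=> x Sx; apply: ge_inf; first by exists (-1); exact: (SlbJ (t := s)).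
by case: Sx => [->|[Jx tx]]; [left|right; split => //; exact: le_trans tx].
Qed.

Section Probability11.
Variables (nu : PMT R) (nuP : Pm11 nu).

Let nu_le1 A : measurable A -> (nu A <= 1)%E.
Proof. by move=> mA; rewrite -nuP.1 le_measure ?inE. Qed.

Let nu_fin A : measurable A -> nu A \is a fin_num.
Proof.
move=> mA; rewrite ge0_fin_numE ?measure_ge0 //.
by rewrite (le_lt_trans (nu_le1 mA)) // ltry.
Qed.

Let mray x : measurable (ray x). Proof. exact: measurable_itv. Qed.

Let cdfmE x : (cdfm nu x)%:E = nu (ray x).
Proof. by rewrite fineK // nu_fin. Qed.

Let cdfm_ge0 x : 0 <= cdfm nu x.
Proof. by rewrite fine_ge0. Qed.

Let cdfm_le1 x : cdfm nu x <= 1.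
Proof. by rewrite -lee_fin cdfmE nu_le1. Qed.

Let cdfm_homo x y : x <= y -> cdfm nu x <= cdfm nu y.
Proof.
move=> xy; rewrite -lee_fin !cdfmE le_measure ?inE //.
by apply: subset_itvl; rewrite bnd_simp.
Qed.

Let nuNJ A : measurable A -> A `<=` ~` J -> nu A = 0%E.
Proof.
move=> mA AJ; apply/eqP; rewrite -measure_le0 -nuP.2 le_measure ?inE //.
by apply: measurableC; exact: measurable_itv.
Qed.

Let nuC A : measurable A -> nu (~` A) = (1 - nu A)%E.
Proof.
by move=> mA; exact: measure1_setC mA nuP.1.
Qed.

Let cdfm_lt x : x < -1 -> cdfm nu x = 0.
Proof.
move=> x1; rewrite /cdfm nuNJ // => y; rewrite /ray /= !in_itv /= => yx.
by rewrite leNgt (le_lt_trans yx).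
Qed.

Let cdfm_1 : cdfm nu 1 = 1.
Proof.
have : nu (~` ray 1) = 0%E.
  rewrite nuNJ //; first exact: measurableC.
  by move=> y /negP; rewrite /ray /= !in_itv /= -ltNge => h /andP[_]; rewrite leNgt h.
by rewrite nuC // -cdfmE -EFinB => -[] /eqP; rewrite subr_eq0 => /eqP <-.
Qed.

Let cdfm_right x (t : R) : cdfm nu x < t -> exists2 y, x < y & cdfm nu y < t.
Proof.
move=> xt.
have : nu (ray (x + n.+1%:R^-1)) @[n --> \oo] --> nu (ray x).
  rewrite {2}/ray (itvNycEbigcap false); apply: nonincreasing_cvg_mu => //.
  - by rewrite (le_lt_trans (nu_le1 _)) // ltry.
  - by apply: bigcap_measurable => // *; exact: mray.
  - move=> m n mn; apply/subsetPset; apply: subset_itvl.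
    by rewrite bnd_simp lerD2l lef_pV2 ?posrE// ler_nat.
rewrite -cdfmE => /fine_cvgP[_ /cvgr_lt /(_ _ xt)] [N _ /(_ N (leqnn N)) /= H].
by exists (x + N.+1%:R^-1) => //; rewrite ltrDl invr_gt0.
Qed.

(** The Galois connection behind inverse sampling; right continuity of the distribution function is
    what lets the infimum itself satisfy the inequality. *)
Lemma quant_le (t x : R) : 0 < t -> t <= 1 -> (quant nu t <= x) = (t <= cdfm nu x).
Proof.
move=> t0 t1; apply/idP/idP => [qx|tx].
  rewrite leNgt; apply/negP => /cdfm_right[y xy yt].
  have [z Sz zy] : exists2 z, S nu t z & z < y.
    by apply: inf_lt; [exists 1; exact: S1|exact: le_lt_trans xy].
  have : t <= cdfm nu z by case: Sz => [->|[]//]; rewrite cdfm_1.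
  by rewrite leNgt (le_lt_trans (cdfm_homo (ltW zy))).
have [x1|x1] := leP 1 x.
  by rewrite (le_trans _ x1) //; have := quant_J nu t; rewrite /= in_itv => /andP[].
have [xN|xN] := ltP x (-1); first by move: tx; rewrite cdfm_lt // leNgt t0.
apply: ge_inf; first by exists (-1); exact: (SlbJ (t := t)).
by right; split => //; rewrite /= in_itv /= xN ltW.
Qed.

Lemma measurable_quant : measurable_fun setT (quant nu).
Proof. by apply: nondecreasing_measurable => //; exact: quant_nondecreasing. Qed.

Let nuq_ray x : nuq measurable_quant (ray x) = nu (ray x).
Proof.
rewrite /nuq /= /push /pushforward /mrestr -cdfmE.
have [c1|c1] := ltP (cdfm nu x) 1.
  rewrite (_ : _ `&` _ = `]0, cdfm nu x]%classic).
    by rewrite lebesgue_measure_itv /= lte_fin lt_neqAle cdfm_ge0 andbT;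
      case: eqP => [<-|] //=; rewrite oppr0 adde0.
  apply/seteqP; split => t; rewrite /ray /= !in_itv /=.
    by move=> [+ /andP[t0 t1]]; rewrite (quant_le _ t0 (ltW t1)) => ->; rewrite t0.
  move=> /andP[t0 tc]; have t1 := le_lt_trans tc c1.
  by rewrite (quant_le _ t0 (ltW t1)) tc t0 t1.
rewrite (_ : _ `&` _ = I01) ?lebI01.
  by congr EFin; apply/eqP; rewrite eq_le c1 cdfm_le1.
apply/seteqP; split => t; rewrite /ray /= !in_itv /=; first by case.
move=> /andP[t0 t1]; rewrite (quant_le _ t0 (ltW t1)) t0 t1; split => //.
exact: le_trans (ltW t1) c1.
Qed.

Lemma nuq_quant A : measurable A -> nuq measurable_quant A = nu A.
Proof.
have PQ : Pm11 (nuq measurable_quant) by apply: Pm11_nuq; exact: quant_J.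
have rayE a : `]a, +oo[%classic = ~` ray a.
  by apply/seteqP; split => y; rewrite /ray /= !in_itv /= andbT ltNge => /negP.
apply: (measure_unique (@RGenOInfty.G R) (fun n => `]- n%:R, +oo[%classic)).
- exact: RGenOInfty.measurableE.
- move=> _ _ [a ->] [b ->]; exists (Num.max a b).
  by apply/seteqP; split => y; rewrite /= !in_itv /= !andbT gt_max; [move=> [-> ->]|move=> /andP].
- by move=> n; exists (- n%:R).
- apply/seteqP; split => // y _; exists (Num.truncn `|y|).+1 => //=.
  rewrite in_itv /= andbT ltrNl (le_lt_trans _ (truncnS_gt _)) //.
  by rewrite -normrN ler_norm.
- move=> _ [a ->]; rewrite rayE nuC // -(nuq_ray a).
  by apply: measure1_setC => //; exact: PQ.1.
- move=> n; rewrite rayE; apply: (@le_lt_trans _ _ 1%E); last exact: ltry.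
  by rewrite -PQ.1 le_measure ?inE //; exact: measurableC.
Qed.

Lemma wint_quant g : cont11 g ->
  wint g nu = fine (\int[leb]_(t in I01) (g (quant nu t))%:E)%E.
Proof.
move=> cg; rewrite -(wint_nuq measurable_quant (quant_J nu) cg) /wint; congr fine.
by apply: eq_measure_integral => A mA _; rewrite nuq_quant.
Qed.

End Probability11.

(** On a grid cell monotonicity bounds [|q - q'|] by the increment of [q] plus [err]. The increments
    telescope to at most 2, the length of [-1,1]; closeness at finitely many points thus becomes
    closeness in mean. *)
Lemma monotone_grid_close q q' (K : nat) (err : R) : (0 < K)%N ->
  nondecreasing_fun q -> nondecreasing_fun q' ->
  (forall t, J (q t)) ->
  (forall i, (i <= K)%N -> `|q (i%:R / K%:R) - q' (i%:R / K%:R)| <= err) ->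
  (\int[leb]_(t in I01) `|q t - q' t|%:E <= (2 / K%:R + err)%:E)%E.
Proof.
move=> K0 ndq ndq' qJ close.
have KR : 0 < K%:R :> R by rewrite ltr0n.
have err0 : 0 <= err by exact: le_trans (close 0%N (leq0n _)).
pose h t := `|q t - q' t|%:E.
have h0 t : (0 <= h t)%E by rewrite lee_fin.
have mh D : measurable D -> measurable_fun D h.
  move=> mD; apply/measurable_EFinP/measurable_funTS/measurableT_comp => //.
  by apply: measurable_funB; exact: nondecreasing_measurable.
pose x (i : nat) : R := i%:R / K%:R.
have xS i : x i.+1 = x i + K%:R^-1 by rewrite /x -natr1 mulrDl mul1r.
have x0 i : 0 <= x i by rewrite divr_ge0.
have xle i : x i <= x i.+1 by rewrite xS lerDl invr_ge0 ltW.
have step i : (i < K)%N ->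
    (\int[leb]_(t in `]x i, x i.+1]) h t <= ((q (x i.+1) - q (x i) + err) / K%:R)%:E)%E.
  move=> iK; set c := q (x i.+1) - q (x i) + err.
  have c0 : 0 <= c by rewrite addr_ge0 // subr_ge0 ndq.
  have ci := close _ (ltnW iK); have cSi := close _ iK.
  apply: (@le_trans _ _ (\int[leb]_(t in `]x i, x i.+1]) (cst c%:E) t)%E).
    apply: ge0_le_integral => //; first exact: mh.
    move=> t; rewrite /= in_itv /= => /andP[/ltW it tSi]; rewrite lee_fin ler_norml.
    have := ndq _ _ it; have := ndq _ _ tSi; have := ndq' _ _ it; have := ndq' _ _ tSi.
    move: ci cSi; rewrite /c -!/(x _) !ler_norml => /andP[? ?] /andP[? ?] ? ? ? ?.
    by apply/andP; split; lra.
  rewrite integral_cst //= lebesgue_measure_itv /= lte_fin.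
  have -> : x i < x i.+1 by rewrite xS ltrDl invr_gt0.
  by rewrite -EFinB -EFinM lee_fin xS addrAC subrr add0r.
have upto i : (i <= K)%N ->
    (\int[leb]_(t in `]0%R, x i]) h t <= ((q (x i) - q 0 + i%:R * err) / K%:R)%:E)%E.
  elim: i => [_|i IH iK].
    by rewrite /x mul0r set_itvoc0 integral_set0 subrr mul0r addr0 mul0r.
  have -> : `]0, x i.+1]%classic = `]0, x i]%classic `|` `]x i, x i.+1]%classic.
    by rewrite -itv_bndbnd_setU // bnd_simp.
  rewrite ge0_integral_setU //; last 2 first.
  - by apply: mh; exact: measurableU.
  - rewrite disj_set2E; apply/eqP/seteqP; split => // t; rewrite /= !in_itv /=.
    by move=> [/andP[_ ti] /andP[]]; rewrite ltNge ti.
  apply: (le_trans (leeD (IH (ltnW iK)) (step _ iK))).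
  rewrite -EFinD lee_fin -mulrDl ler_pM2r ?invr_gt0 // -natr1.
  by rewrite mulrDl mul1r; lra.
apply: (@le_trans _ _ (\int[leb]_(t in `]0%R, x K]) h t)%E).
  apply: ge0_subset_integral => //; first exact: mh.
  by rewrite /x divff ?gt_eqF //; apply: subset_itvl; rewrite bnd_simp.
apply: (le_trans (upto _ (leqnn K))); rewrite lee_fin mulrDl mulrAC divff ?gt_eqF //.
rewrite mul1r lerD2r ler_pM2r ?invr_gt0 //.
have := qJ 0; have := qJ (x K); rewrite /= !in_itv /= => /andP[? ?] /andP[? ?].
by lra.
Qed.

Lemma wint_close q q' g (e C del : R) :
  measurable_fun setT q -> measurable_fun setT q' ->
  (forall t, J (q t)) -> (forall t, J (q' t)) -> cont11 g -> 0 <= C ->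
  (forall x y : R, J x -> J y -> `|g x - g y| <= e + C * `|x - y|) ->
  (\int[leb]_(t in I01) `|q t - q' t|%:E <= del%:E)%E ->
  `|fine (\int[leb]_(t in I01) (g (q t))%:E)%E -
    fine (\int[leb]_(t in I01) (g (q' t))%:E)%E| <= e + C * del.
Proof.
move=> mq mq' qJ q'J cg C0 modu close.
have [B B0 gB] := cont11_bounded cg.
have mI : measurable I01 by exact: measurable_itv.
have mgJ : measurable_fun setT (g \_ J) by apply/(measurable_restrictT _ (measurable_itv _)); exact: cont11_measurable.
have Ig p : measurable_fun setT p -> (forall t, J (p t)) ->
    leb.-integrable I01 (EFin \o (g \o p)).
  move=> mp pJ; apply: (le_bounded_integrable (B := B)) => //.
  - exact: lebI01_lty.
  - have : measurable_fun I01 ((g \_ J) \o p).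
      by apply: measurable_funTS; exact: measurableT_comp.
    by congr measurable_fun; apply/funext => t; rewrite /= patchE mem_set //; exact: pJ.
  - by move=> t _; exact: gB.
have Iq := Ig _ mq qJ; have Iq' := Ig _ mq' q'J.
have Id : leb.-integrable I01 (EFin \o (fun t => e + C * `|q t - q' t|)).
  apply: (le_bounded_integrable (B := `|e| + C * 2)) => //.
  - exact: lebI01_lty.
  - apply: measurable_funTS; apply: measurable_funD => //.
    apply: measurable_funM => //; apply: measurableT_comp => //.
    exact: measurable_funB.
  - move=> t _; rewrite (le_trans (ler_normD _ _)) // lerD2l normrM (ger0_norm C0).
    rewrite ler_wpM2l // normr_id.
    have := qJ t; have := q'J t; rewrite /= !in_itv /= => /andP[? ?] /andP[? ?].
    by rewrite ler_norml; apply/andP; split; lra.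
rewrite -[X in X - _]/(Rintegral leb I01 (g \o q)) -[X in _ - X]/(Rintegral leb I01 (g \o q')).
rewrite -RintegralB //.
have Igg : leb.-integrable I01 (EFin \o (fun t => (g \o q) t - (g \o q') t)).
  by rewrite (_ : _ \o _ = (EFin \o (g \o q)) \- (EFin \o (g \o q')))%E //; exact: integrableB.
rewrite (le_trans (le_normr_Rintegral _ _)) //.
apply: (@le_trans _ _ (Rintegral leb I01 (fun t => e + C * `|q t - q' t|))).
  apply: le_Rintegral => //; last by move=> t _; exact: modu.
  exact: (integrable_abse Igg).
have Idiff : leb.-integrable I01 (EFin \o (fun t => `|q t - q' t|)).
  apply: (le_bounded_integrable (B := 2)) => //.
  - exact: lebI01_lty.
  - by apply: measurable_funTS; apply: measurableT_comp => //; exact: measurable_funB.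
  - move=> t _; rewrite normr_id.
    have := qJ t; have := q'J t; rewrite /= !in_itv /= => /andP[? ?] /andP[? ?].
    by rewrite ler_norml; apply/andP; split; lra.
have Icst : leb.-integrable I01 (EFin \o (cst e : R -> R)).
  by apply: (le_bounded_integrable (B := `|e|)) => //; exact: lebI01_lty.
rewrite RintegralD //; last first.
  apply: (le_bounded_integrable (B := C * 2)) => //.
  - exact: lebI01_lty.
  - apply: measurable_funTS; apply: measurable_funM => //; apply: measurableT_comp => //.
    exact: measurable_funB.
  - move=> t _; rewrite normrM (ger0_norm C0) ler_wpM2l // normr_id.
    have := qJ t; have := q'J t; rewrite /= !in_itv /= => /andP[? ?] /andP[? ?].
    by rewrite ler_norml; apply/andP; split; lra.
rewrite RintegralZl // Rintegral_cst //.
have -> : fine (leb I01) = 1 by rewrite (lebI01 : _ = _).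
rewrite mulr1 lerD2l ler_wpM2l //.
rewrite -lee_fin /Rintegral fineK //.
rewrite ge0_fin_numE ?(le_lt_trans close) ?ltry //.
by apply: integral_ge0 => t _; rewrite lee_fin.
Qed.

(** Compactness of P([-1,1]) in Helly's form: if [f] were unbounded along [nu n], the quantile
    functions would converge pointwise along a free ultrafilter to a monotone [q], and weak
    continuity at the law of [q] would keep [f (nu n)] within 1 of a fixed value for some
    arbitrarily large [n]. *)
Theorem weak_continuous_bounded (f : PMT R -> R) : weak_continuous f ->
  exists B : R, forall nu, Pm11 nu -> `|f nu| <= B.
Proof.
move=> cf; apply: contrapT => unb.
have {unb} nuP n : {nu : PMT R | Pm11 nu /\ n%:R < `|f nu|}.
  apply: cid; apply: contrapT => H; apply: unb; exists n%:R => nu Pnu.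
  by rewrite leNgt; apply/negP => L; apply: H; exists nu.
pose nu n := projT1 (nuP n).
have Pnu n : Pm11 (nu n) by rewrite /nu; case: (nuP n) => ? [].
have fnu n : n%:R < `|f (nu n)| by rewrite /nu; case: (nuP n) => ? [].
pose Q n := quant (nu n).
have [G [UG subG]] := ultraFilterLemma (eventually_filter : ProperFilter \oo).
have PG : ProperFilter G by exact: ultra_proper.
have /choice[q qP] (t : R) : exists l : R, J l /\
    forall e : R, 0 < e -> G [set n | `|Q n t - l| < e].
  have cJ : compact J by exact: segment_compact.
  have GJ : ((fun n => Q n t) @ G) J.
    by apply: (@filterS _ G _ setT) filterT => n _; exact: (quant_J (nu n) t).
  have [l [Jl cl]] := cJ _ (fmap_proper_filter _ PG) GJ.
  exists l; split => // e e0.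
  have [//|nG] := in_ultra_setVsetC [set n | `|Q n t - l| < e] UG.
  have nG' : ((fun n => Q n t) @ G) [set y | ~ (`|y - l| < e)] by [].
  have [y [ye yl]] := cl _ _ nG' (nbhsx_ballx l e e0).
  by case: ye; rewrite distrC.
have qJ t : J (q t) by case: (qP t).
have qG t := (qP t).2.
have ndq : nondecreasing_fun q.
  move=> s t st; rewrite leNgt; apply/negP => ts.
  have e0 : 0 < (q s - q t) / 2 by rewrite divr_gt0 // subr_gt0.
  have [n [/= ns nt]] := filter_ex (filterI (qG s _ e0) (qG t _ e0)).
  have := quant_nondecreasing (nu n) st; rewrite -!/(Q n _).
  by move: ns nt; rewrite !ltr_norml => /andP[? ?] /andP[? ?]; lra.
have mq : measurable_fun setT q by exact: nondecreasing_measurable.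
have PQ : Pm11 (nuq mq) by exact: Pm11_nuq.
have [m [g [del [del0 [cg nb]]]]] := cf _ PQ 1 ltr01.
have d2 : 0 < del / 2 by rewrite divr_gt0.
have /choice[C CP] i : exists C : R, 0 <= C /\ forall x y : R, J x -> J y ->
    `|g i x - g i y| <= del / 2 + C * `|x - y|.
  by have [C C0 H] := cont11_modulus (cg i) d2; exists C.
pose CC := \sum_i C i + 1.
have CC0 : 0 < CC by rewrite ltr_wpDl // sumr_ge0 // => i _; case: (CP i).
have CCi i : C i <= CC.
  rewrite /CC (bigD1 i) //= -addrA lerDl addr_ge0 // sumr_ge0 // => j _.
  by case: (CP j).
(* The grid step costs [2 / K <= e] and the grid values cost [e], so the Lipschitz part is at most
   [CC * (e + e) = del / 4]; the additive part of the modulus takes [del / 2]. *)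
pose e := del / 8 / CC; have e0 : 0 < e by rewrite !divr_gt0.
pose K := (Num.truncn (2 / e)).+1.
have KP : 2 / K%:R <= e.
  rewrite ler_pdivrMr ?ltr0n // mulrC -ler_pdivrMr // ltW //; exact: truncnS_gt.
pose N := (Num.truncn (`|f (nuq mq)| + 1)).
have : G [set n | (N.+1 <= n)%N /\ forall i : 'I_K.+1, `|Q n (i%:R / K%:R) - q (i%:R / K%:R)| < e].
  apply: filterI; first by apply: subG; exists N.+1.
  by apply: filter_forall => i; exact: qG.
move=> /filter_ex[n [Nn close]].
have : `|f (nu n) - f (nuq mq)| < 1.
  apply: nb; split=> // i.
  rewrite (wint_quant (Pnu n) (cg i)) (wint_nuq mq qJ (cg i)).
  have [Ci0 CiP] := CP i.
  have L := @monotone_grid_close (Q n) q K e isT (@quant_nondecreasing _) ndq (@quant_J _).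
  have {}L : (\int[leb]_(t in I01) `|Q n t - q t|%:E <= (2 / K%:R + e)%:E)%E.
    by apply: L => j jK; rewrite ltW // (close (Ordinal (jK : (j < K.+1)%N))).
  apply: (le_lt_trans (wint_close (measurable_quant (nu n)) mq (@quant_J _) qJ (cg i) Ci0 CiP L)).
  rewrite [ltRHS]splitr ltrD2l.
  apply: (@le_lt_trans _ _ (CC * (e + e))).
    by apply: ler_pM => //; [rewrite addr_ge0 // ?ltW // divr_ge0|rewrite lerD2r].
  rewrite /e -mulrDr (_ : CC * _ = del / 4); last by field; rewrite gt_eqF.
  by rewrite ltr_pM2l //; lra.
apply/negP; rewrite -leNgt.
apply: (le_trans _ (lerB_dist _ _)).
rewrite lerBrDl (le_trans _ (ltW (fnu n))) //.
rewrite (le_trans (ltW (truncnS_gt _))) // ler_nat.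
by rewrite -/N.
Qed.

End Compactness.

(** * Signed frequencies in Bernoulli shifts *)

Section Bernoulli.
Context {R : realType} {T : finType} {t0 : T}.
Local Notation Z := (SeqSp t0).
Variables (p : T -> R) (nu : probability Z R).
Hypothesis nu_cyl : forall w : seq T, nu (cyl w) = (\prod_(a <- w) p a)%:E.
Implicit Types (w : seq T) (A B : set Z).

Local Notation shiftn m := (fun u : Z => (fun n => u (m + n)%N) : Z).

Lemma bern_fin A : measurable A -> nu A \is a fin_num.
Proof. by move=> mA; exact: fin_num_measure. Qed.

Lemma letter_ge0 a : 0 <= p a.
Proof.
have e := nu_cyl [:: a]; rewrite big_seq1 in e.
by rewrite -lee_fin -e; exact: measure_ge0.
Qed.

Lemma measurable_shiftn_preimage m A : measurable A ->
  measurable (shiftn m @^-1` A).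
Proof. by move=> mA; rewrite -[X in measurable X]setTI; exact: measurable_shiftn. Qed.

(** Both sides are finite measures in [A], and on a cylinder [v] both equal the weight of the
    concatenation [w ++ v]. *)
Lemma renewal_cyl w A : measurable A ->
  nu (cyl w `&` (shiftn (size w) @^-1` A)) = (nu (cyl w) * nu A)%E.
Proof.
move=> mA.
pose m1 := push (mrestr nu (measurable_cyl (t0 := t0) w)) (measurable_shiftn (t0 := t0) (size w)).
have p0 : 0 <= \prod_(a <- w) p a by apply: prodr_ge0 => a _; exact: letter_ge0.
pose m2 := mscale (NngNum p0) nu.
have m1E B : m1 B = nu (cyl w `&` (shiftn (size w) @^-1` B)).
  by rewrite /m1 /push /pushforward /mrestr setIC.
have m2E B : m2 B = (nu (cyl w) * nu B)%E by rewrite /m2 /mscale /= nu_cyl.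
rewrite -m1E -m2E; apply: seqsp_measure_unique => // [v|].
  suff : m1 (cyl v) = m2 (cyl v) by [].
  rewrite m1E m2E !nu_cyl -EFinM -big_cat /= -nu_cyl; congr (nu _).
  by apply/seteqP; split => u /=; rewrite cyl_cat.
suff : (m1 setT < +oo)%E by [].
rewrite m1E; apply: (@le_lt_trans _ _ 1%E); last exact: ltry.
apply: probability_le1; apply: measurableI; first exact: measurable_cyl.
exact: measurable_shiftn_preimage.
Qed.

Lemma letter_partition (P : set T) A : measurable A ->
  nu ([set u | P (u 0%N)] `&` A) = (\sum_(a \in P) nu (cyl [:: a] `&` A))%E.
Proof.
move=> mA; rewrite -measure_fin_bigcup.
- congr (nu _); apply/seteqP; split => u.
    by move=> [Pu Au]; exists (u 0%N).
  by move=> [a Pa [/cylP/(_ 0%N isT) /= ua Au]]; split => //=; rewrite ua.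
- exact: finite_finset.
- move=> a b _ _ [u [[/cylP/(_ 0%N isT) /= ua _] [/cylP/(_ 0%N isT) /= ub _]]].
  by rewrite -ua -ub.
- by move=> a _; apply: measurableI => //; exact: measurable_cyl.
Qed.

Lemma renewal_letter (P : set T) A : measurable A ->
  nu ([set u | P (u 0%N)] `&` (@shift T @^-1` A)) =
  (nu [set u | P (u 0%N)] * nu A)%E.
Proof.
move=> mA; rewrite (letter_partition P (measurable_shiftn_preimage 1 mA)).
rewrite -[X in (nu X * _)%E]setIT (letter_partition P measurableT).
rewrite ge0_mule_fsuml; last by move=> a; exact: measure_ge0.
by apply: eq_fsbigr => a _; rewrite setIT; exact: (renewal_cyl [:: a]).
Qed.

Lemma shift_invariant A : measurable A -> nu (@shift T @^-1` A) = nu A.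
Proof.
move=> mA; have := renewal_letter setT mA.
by rewrite (_ : [set u | _] = setT) ?setTI ?probability_setT ?mul1e //; apply/seteqP.
Qed.

Local Open Scope ereal_scope.

(** The event [B] and its weight are left abstract, so that both cylinders and events on the first
    letter can be inserted. *)
Lemma ge0_integral_renewal m B (c : {nonneg R}) (phi : Z -> \bar R) : measurable B ->
  (forall A, measurable A -> nu (B `&` (shiftn m @^-1` A)) = c%:num%:E * nu A) ->
  measurable_fun setT phi -> (forall z, 0 <= phi z) ->
  \int[nu]_(z in B) phi (shiftn m z) = c%:num%:E * \int[nu]_z phi z.
Proof.
move=> mB H mphi phi0.
have ms := measurable_shiftn (t0 := t0) m.
rewrite -(ge0_integral_mscale nu measurableT c mphi) //.
transitivity (\int[push (mrestr nu mB) ms]_z phi z); last first.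
  apply: eq_measure_integral => A mA _.
  by rewrite -[LHS]/(nu ((shiftn m @^-1` A) `&` B)) setIC H.
have := ge0_integral_pushforward ms (mrestr nu mB) measurableT mphi.
rewrite preimage_setT => ->; last by move=> z _; exact: phi0.
rewrite [RHS](ge0_negligible_integral (N := ~` B)) //=.
- rewrite setTD setCK; apply: eq_measure_integral => A mA AB.
  by rewrite -[RHS]/(nu (A `&` B)) (setIidl AB).
- exact: measurableC.
- exact: measurableT_comp.
- by rewrite /mrestr setICl measure0.
Qed.

Local Close Scope ereal_scope.

Local Notation Ex := (Rintegral nu setT).

Lemma Rintegral_renewal m B (phi : Z -> R) (b : R) : measurable B ->
  (forall A, measurable A -> nu (B `&` (shiftn m @^-1` A)) = nu B * nu A)%E ->
  measurable_fun setT phi -> (forall z, `|phi z| <= b) ->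
  Rintegral nu B (fun z => phi (shiftn m z)) = fine (nu B) * Ex phi.
Proof.
move=> mB H mphi phib.
have b0 : 0 <= b by exact: le_trans (phib (fun=> t0)).
have c0 : 0 <= fine (nu B) by rewrite fine_ge0.
have fB := bern_fin mB.
(* The change of measure is available for nonnegative functions; adding the bound [b] reaches
   bounded ones, and the constant cancels at the end. *)
pose psi z := phi z + b.
have psi0 z : 0 <= psi z by have := phib z; rewrite ler_norml /psi => /andP[? _]; lra.
have mpsi : measurable_fun setT psi by apply: measurable_funD.
have psib z : `|psi z| <= b + b.
  by rewrite (le_trans (ler_normD _ _)) // lerD // ger0_norm.
have ms := measurable_shiftn (t0 := t0) m.
have mphis := measurableT_comp mphi ms.
have nT : fine (nu setT) = 1 by rewrite probability_setT.
have I0 (f : Z -> R) D c : measurable D -> measurable_fun setT f -> (forall z, `|f z| <= c) ->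
    nu.-integrable D (EFin \o f).
  move=> mD mf fc; apply: (le_bounded_integrable (B := c)) => //.
    by rewrite (le_lt_trans (probability_le1 _ _)) // ltry.
  exact: measurable_funTS.
have key : Rintegral nu B (fun z => psi (shiftn m z)) = fine (nu B) * Ex psi.
  have := @ge0_integral_renewal m B (NngNum c0) (EFin \o psi) mB.
  rewrite /Rintegral /= fineK // => -> //.
  - rewrite fineM ?fineK //.
    exact: integrable_fin_num (I0 _ _ _ measurableT mpsi psib).
  - exact/measurable_EFinP.
have e1 : Rintegral nu B (fun z => psi (shiftn m z)) =
    Rintegral nu B (fun z => phi (shiftn m z)) + b * fine (nu B).
  rewrite RintegralD ?Rintegral_cst //.
  - exact: (I0 _ _ b mB mphis (fun z => phib _)).
  - by apply: (I0 (cst b) _ b) => // z; rewrite /= ger0_norm.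
have e2 : Ex psi = Ex phi + b.
  rewrite RintegralD ?Rintegral_cst // ?nT ?mulr1 //.
  - exact: (I0 _ _ b).
  - by apply: (I0 (cst b) _ b) => // z; rewrite /= ger0_norm.
by move: key; rewrite e1 e2 mulrDr (mulrC b) => /addIr.
Qed.

(** * Ergodicity of the skew product with Z/2 *)

Section Ergodicity.
Variable neg : T -> bool.

Fixpoint parity w : bool := if w is a :: w' then neg a (+) parity w' else false.

Let rho := nu [set u | neg (u 0%N)].

Lemma letter_negE : nu [set u | ~~ neg (u 0%N)] = (1 - rho)%E.
Proof.
rewrite -probability_setC; last exact: (measurable_coord 0 [set a | neg a]).
by congr (nu _); apply/seteqP; split => u /=; [move/negP|move=> /negP].
Qed.

Lemma skew_measure (A : bool -> set Z) b : (forall b, measurable (A b)) ->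
  nu [set u | A (b (+) neg (u 0%N)) (shift u)] =
  ((1 - rho) * nu (A b) + rho * nu (A (~~ b)))%E.
Proof.
move=> mA.
have -> : [set u | A (b (+) neg (u 0%N)) (shift u)] =
   ([set u : Z | [set a | ~~ neg a] (u 0%N)] `&` (@shift T @^-1` A b)) `|`
   ([set u : Z | [set a | neg a] (u 0%N)] `&` (@shift T @^-1` A (~~ b))).
  apply/seteqP; split => u /=.
    by case: (boolP (neg (u 0%N))) => /= un; rewrite ?addbT ?addbF => Au; [right|left].
  by move=> [[/negbTE ->]|[->]]; rewrite ?addbT ?addbF.
have mS c : measurable ((@shift T : Z -> Z) @^-1` A c) by exact: (measurable_shiftn_preimage 1 (mA c)).
rewrite measureU.
- congr (_ + _)%E; last exact: renewal_letter.
  by rewrite -letter_negE; exact: renewal_letter.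
- by apply: measurableI => //; exact: measurable_coord.
- by apply: measurableI => //; exact: measurable_coord.
- by apply/seteqP; split => u //= -[[/negP un _] [un' _]].
Qed.

Lemma skew_invariant_word (A : bool -> set Z) b w :
  (forall b u, A b u <-> A (b (+) neg (u 0%N)) (shift u)) ->
  forall u, cyl w u -> A b u <-> A (b (+) parity w) (shiftn (size w) u).
Proof.
move=> H; elim: w b => [|a w IH] b u; first by rewrite addbF.
move=> /(cyl_cat [:: a] w)[/cylP/(_ 0%N isT) /= ua uw].
rewrite H ua (IH _ (shift u)) // addbA.
by split; congr (A _ _).
Qed.

(** Invariance writes [nu (A b)] as an average of the two sides with weights [1 - rho] and [rho], so
    the sides have equal measure unless [rho] is zero; in that case words of odd parity are null.
    Hence [A false] is independent of every cylinder, therefore of itself, and its measure solves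
    [x = x * x]. *)
Lemma skew_ergodic (A : bool -> set Z) : (forall b, measurable (A b)) ->
  (forall b u, A b u <-> A (b (+) neg (u 0%N)) (shift u)) ->
  if rho == 0%E then nu (A false) = 0%E \/ nu (A false) = 1%E
  else nu (A true) = nu (A false) /\ (nu (A false) = 0%E \/ nu (A false) = 1%E).
Proof.
move=> mA H.
have mneg : measurable [set u : Z | neg (u 0%N)] by exact: (measurable_coord 0 [set a | neg a]).
have fA b := bern_fin (mA b).
have frho : rho \is a fin_num by exact: bern_fin.
have Ainv b : nu (A b) = ((1 - rho) * nu (A b) + rho * nu (A (~~ b)))%E.
  rewrite -(skew_measure b mA); congr (nu _).
  by apply/seteqP; split => u /=; rewrite -H.
have eqtf : rho != 0%E -> nu (A true) = nu (A false).
  move: (Ainv true); rewrite /= -(fineK frho) -(fineK (fA true)) -(fineK (fA false)).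
  rewrite -EFinB -!EFinM -EFinD eqe => -[e] r0.
  congr EFin; apply: (mulfI r0); move: e; lra.
have word w : rho = 0%E -> parity w -> nu (cyl w) = 0%E.
  move=> r0; elim: w => //= a w IH; rewrite nu_cyl big_cons.
  have [na _|_ /= /IH] := boolP (neg a); last first.
    by rewrite nu_cyl => -[->]; rewrite mulr0.
  have : nu (cyl [:: a]) = 0%E.
    apply/eqP; rewrite -measure_le0 -r0 le_measure ?inE //; first exact: measurable_cyl.
    by move=> u /cylP/(_ 0%N isT) /= ->.
  by rewrite nu_cyl big_seq1 => -[->]; rewrite mul0r.
have step w : nu (A false `&` cyl w) = (nu (cyl w) * nu (A false))%E.
  transitivity (nu (cyl w `&` (shiftn (size w) @^-1` (A (parity w))))).
    congr (nu _); apply/seteqP; split => u /=.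
      by move=> [Au uw]; split => //; rewrite -[parity w]/(false (+) parity w) -(skew_invariant_word _ H uw).
    by move=> [uw Au]; split => //; rewrite (skew_invariant_word _ H uw).
  rewrite renewal_cyl //; case: (boolP (parity w)) => // pw.
  have [rho0|/eqtf -> //] := eqVneq rho 0%E.
  by rewrite (word _ rho0 pw) !mul0e.
have all01 : nu (A false) = 0%E \/ nu (A false) = 1%E.
  pose m1 := mrestr nu (mA false).
  pose m2 := mscale (NngNum (fine_ge0 (measure_ge0 nu (A false)))) nu.
  have : m1 (A false) = m2 (A false).
    apply: seqsp_measure_unique (mA false) => [w|].
      suff : m1 (cyl w) = m2 (cyl w) by [].
      by rewrite /m1 /mrestr setIC step /m2 /mscale /= fineK // muleC.
    suff : (m1 setT < +oo)%E by [].
    by rewrite /m1 /mrestr setTI (le_lt_trans (probability_le1 _ _)) // ltry.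
  rewrite /m1 /mrestr setIid /m2 /mscale /= fineK // -(fineK (fA false)) -EFinM.
  set x := fine _ => -[] /eqP; rewrite -subr_eq0 (_ : x - x * x = x * (1 - x)); last by ring.
  by rewrite mulf_eq0 subr_eq0 => /orP[/eqP ->|/eqP <-]; [left|right].
by case: eqP => // /eqP /eqtf.
Qed.

(** Integral counterpart of [skew_measure], used for the crossing of a roof in the proof of flow
    invariance. *)
Lemma skew_integral (phi : bool -> Z -> \bar R) b : (forall b, measurable_fun setT (phi b)) ->
  (forall b z, 0 <= phi b z)%E ->
  (\int[nu]_z phi (b (+) neg (z 0%N)) (shift z) =
   (1 - rho) * \int[nu]_z phi b z + rho * \int[nu]_z phi (~~ b) z)%E.
Proof.
move=> mphi phi0.
have mneg : measurable [set u : Z | neg (u 0%N)] by exact: (measurable_coord 0 [set a | neg a]).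
have mpos : measurable [set u : Z | ~~ neg (u 0%N)] by exact: (measurable_coord 0 [set a | ~~ neg a]).
have TE : [set: Z] = [set u : Z | ~~ neg (u 0%N)] `|` [set u : Z | neg (u 0%N)].
  by apply/seteqP; split => u //= _; case: (neg _); [right|left].
have mphis c : measurable_fun setT (fun z : Z => phi c (shift z)).
  by apply: measurableT_comp (mphi c) _; exact: measurable_shift.
rewrite [in LHS]TE ge0_integral_setU //; last 2 first.
- rewrite -TE; have -> : (fun z : Z => phi (b (+) neg (z 0%N)) (shift z)) =
    fun z => if neg (z 0%N) then phi (~~ b) (shift z) else phi b (shift z).
    by apply/funext => z; case: (neg _); rewrite ?addbT ?addbF.
  apply: measurable_fun_ifT => //.
  apply: (measurable_fun_bool true).
  by rewrite setTI; exact: mneg.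
- by rewrite disj_set2E; apply/eqP/seteqP; split => u //= -[/negP].
have eqn : (\int[nu]_(z in [set u : Z | ~~ neg (u 0%N)]) phi (b (+) neg (z 0%N)) (shift z) =
   \int[nu]_(z in [set u : Z | ~~ neg (u 0%N)]) phi b (shiftn 1 z))%E.
  by apply: eq_integral => z; rewrite inE /= => /negbTE ->; rewrite addbF.
have eqp : (\int[nu]_(z in [set u : Z | neg (u 0%N)]) phi (b (+) neg (z 0%N)) (shift z) =
   \int[nu]_(z in [set u : Z | neg (u 0%N)]) phi (~~ b) (shiftn 1 z))%E.
  by apply: eq_integral => z; rewrite inE /= => ->; rewrite addbT.
rewrite eqn eqp.
have frho := bern_fin mneg.
have c1 : 0 <= fine (nu [set u : Z | ~~ neg (u 0%N)]) by rewrite fine_ge0.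
have c2 : 0 <= fine rho by apply: fine_ge0; exact: measure_ge0.
rewrite (@ge0_integral_renewal 1 _ (NngNum c1)) //; last first.
  by move=> A mA; rewrite /= (fineK (bern_fin mpos)); exact: (renewal_letter [set a | ~~ neg a]).
rewrite (@ge0_integral_renewal 1 _ (NngNum c2)) //; last first.
  by move=> A mA; rewrite /= (fineK frho); exact: (renewal_letter [set a | neg a]).
by rewrite /= (fineK (bern_fin mpos)) (fineK frho) letter_negE.
Qed.

End Ergodicity.

Lemma bern_integrable (f : Z -> R) D c : measurable D -> measurable_fun setT f ->
  (forall z, `|f z| <= c) -> nu.-integrable D (EFin \o f).
Proof.
move=> mD mf fc; apply: (le_bounded_integrable (B := c)) => //.
  by rewrite (le_lt_trans (probability_le1 _ _)) // ltry.
exact: measurable_funTS.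
Qed.

Lemma Rintegral_le_bound (f : Z -> R) D c : measurable D -> measurable_fun setT f ->
  (forall z, `|f z| <= c) -> `|Rintegral nu D f| <= c.
Proof.
move=> mD mf fc.
have c0 : 0 <= c by exact: le_trans (fc (fun=> t0)).
rewrite (le_trans (le_normr_Rintegral mD (bern_integrable mD mf fc))) //.
apply: (@le_trans _ _ (Rintegral nu D (cst c))).
  apply: le_Rintegral => //.
  - by apply: (@bern_integrable _ _ c) => //; [exact: measurableT_comp|move=> z; rewrite /= normr_id].
  - by apply: (@bern_integrable _ _ c) => // z; rewrite /= ger0_norm.
rewrite Rintegral_cst // ler_piMr //.
by rewrite -lee_fin (fineK (bern_fin mD)) probability_le1.
Qed.

Lemma Ex_shift (f : Z -> R) c : measurable_fun setT f -> (forall z, `|f z| <= c) ->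
  Ex (fun z => f (shift z)) = Ex f.
Proof.
move=> mf fc.
have := @Rintegral_renewal 1 setT f c measurableT _ mf fc.
have nT : fine (nu setT) = 1 by rewrite probability_setT.
rewrite nT mul1r => <- // A mA.
by rewrite setTI (probability_setT nu) mul1e; exact: shift_invariant.
Qed.

(** * A strong law for sign-weighted counts of a word *)

Section StrongLaw.
Variables (w : seq T) (p0 : R) (g : T -> R) (K : R).
Hypothesis p001 : 0 <= p0 <= 1.
Hypothesis g2 : forall a, g a * g a = 1.

Definition ctr (z : Z) : R := \1_(cyl (t0 := t0) w) z - p0.

(** The recursion peels off the first letter, so the remainder is a shifted copy whose law is known.
    The choice [g = 1] counts occurrences of [w] about their mean; [g = -1] on reflecting letters
    with [p0 = 0] counts them with the sign of the orientation. *)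
Fixpoint wsum n (z : Z) : R :=
  if n is n'.+1 then ctr z + g (z 0%N) * wsum n' (shift z) else 0.

Lemma gnorm a : `|g a| = 1.
Proof.
have := g2 a => /(congr1 Num.norm); rewrite normrM normr1 => e.
have : (`|g a| - 1) * (`|g a| + 1) = 0 by move: e; lra.
move/eqP; rewrite mulf_eq0 subr_eq0 => /orP[/eqP //|].
by rewrite gt_eqF // ltr_wpDl.
Qed.

Lemma wsumE n z :
  wsum n z = \sum_(j < n) (\prod_(i < j) g (z i)) * ctr (shiftn j z).
Proof.
elim: n z => [|n IH] z /=; first by rewrite big_ord0.
rewrite big_ord_recl big_ord0 mul1r IH mulr_sumr; congr (ctr _ + _).
by apply: eq_bigr => j _; rewrite big_ord_recl /= mulrA.
Qed.

Lemma wsumD m l z :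
  wsum (m + l) z = wsum m z + (\prod_(i < m) g (z i)) * wsum l (shiftn m z).
Proof.
elim: m z => [|m IH] z /=; first by rewrite big_ord0 mul1r add0r.
by rewrite IH big_ord_recl mulrDr mulrA addrA.
Qed.

Lemma prod_gnorm m (z : Z) : `|\prod_(i < m) g (z i)| = 1.
Proof. by rewrite normr_prod big1 // => i _; rewrite gnorm. Qed.

Lemma ctr_le1 z : `|ctr z| <= 1.
Proof.
move: p001 => /andP[? ?]; rewrite /ctr indicE.
by case: (_ \in _); rewrite ler_norml; apply/andP; split; rewrite /=; lra.
Qed.

Lemma wsum_le n z : `|wsum n z| <= n%:R.
Proof.
elim: n z => [|n IH] z /=; first by rewrite normr0.
rewrite (le_trans (ler_normD _ _)) // -natr1 addrC lerD ?ctr_le1 //.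
by rewrite normrM gnorm mul1r.
Qed.

Lemma wsum_lip n j z : `|wsum (n + j) z| <= `|wsum n z| + j%:R.
Proof.
rewrite wsumD (le_trans (ler_normD _ _)) // lerD2l normrM prod_gnorm mul1r.
exact: wsum_le.
Qed.

Lemma measurable_ctr : measurable_fun setT ctr.
Proof.
apply: measurable_funB => //; apply: measurable_indic.
exact: measurable_cyl.
Qed.

Lemma measurable_letter (f : T -> R) n : measurable_fun setT (fun z : Z => f (z n)).
Proof. by move=> _ Y mY; rewrite setTI; exact: (measurable_coord n (f @^-1` Y)). Qed.

Lemma measurable_wsum n : measurable_fun setT (wsum n).
Proof.
elim: n => [|n IH] /=; first exact: measurable_cst.
apply: measurable_funD; first exact: measurable_ctr.
apply: measurable_funM; first exact: measurable_letter.
exact: (measurableT_comp IH (measurable_shift (t0 := t0))).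
Qed.

Hypothesis K_ge : forall l, `|Ex (wsum l)| <= K.

(** On the cylinder [w] the first [size w] terms are bounded by 1 each. After them the sum restarts,
    up to a sign, independently of [w], and [K_ge] bounds its mean. *)
Lemma wsum_cyl n : `|Rintegral nu (cyl w) (wsum n)| <= (size w)%:R + K.
Proof.
have K0 : 0 <= K by exact: le_trans (K_ge 0).
have mw := measurable_cyl (t0 := t0) w.
have [nm|/ltnW mn] := leqP n (size w).
  rewrite (le_trans (Rintegral_le_bound mw (measurable_wsum n) (wsum_le n))) //.
  by rewrite (le_trans (_ : _ <= (size w)%:R)) ?ler_nat // lerDl.
rewrite -(subnKC mn); set l := (n - size w)%N; set m := size w.
pose s := \prod_(a <- w) g a.
have mWl : measurable_fun setT (fun z : Z => s * wsum l (shiftn m z)).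
  apply: measurable_funM => //.
  exact: (measurableT_comp (measurable_wsum l) (measurable_shiftn (t0 := t0) m)).
have s1 : `|s| = 1.
  by rewrite /s normr_prod big1 // => i _; rewrite gnorm.
have Wlb (z : Z) : `|s * wsum l (shiftn m z)| <= l%:R by rewrite normrM s1 mul1r wsum_le.
have -> : Rintegral nu (cyl w) (wsum (m + l)) =
    Rintegral nu (cyl w) (fun z => wsum m z + s * wsum l (shiftn m z)).
  apply: eq_Rintegral => z; rewrite inE => /cylP zw; rewrite [LHS](wsumD m l z); congr (_ + _ * _).
  rewrite /s (big_nth t0) big_mkord; apply: eq_bigr => i _.
  by rewrite zw.
rewrite RintegralD //; last 2 first.
- exact: (bern_integrable mw (measurable_wsum m) (wsum_le m)).
- exact: (bern_integrable mw mWl Wlb).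
rewrite (le_trans (ler_normD _ _)) // lerD //.
  exact: (Rintegral_le_bound mw (measurable_wsum m) (wsum_le m)).
have mWl' : measurable_fun setT (fun z : Z => wsum l (shiftn m z)).
  exact: (measurableT_comp (measurable_wsum l) (measurable_shiftn (t0 := t0) m)).
rewrite RintegralZl //; last first.
  by apply: (bern_integrable mw mWl') => z; exact: wsum_le.
rewrite (@Rintegral_renewal m (cyl w) (wsum l) l%:R mw) //; last 3 first.
- by move=> A mA; exact: renewal_cyl.
- exact: measurable_wsum.
- exact: wsum_le.
rewrite !normrM s1 mul1r (le_trans _ (K_ge l)) // ler_piMl //.
rewrite ger0_norm ?fine_ge0 // -lee_fin (fineK (bern_fin mw)).
exact: probability_le1.
Qed.

Let C := 2 * ((size w)%:R + K + K).

(** Expanding the square along the recursion leaves the cross term of [ctr] with the sum, whose mean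
    is bounded independently of [n] by [wsum_cyl] and [K_ge]. The second moment therefore grows
    linearly, as it does for independent summands. *)
Lemma second_moment n : Ex (fun z => wsum n z ^+ 2) <= C * n%:R.
Proof.
have K0 : 0 <= K by exact: le_trans (K_ge 0).
have mw := measurable_cyl (t0 := t0) w.
elim: n => [|n IH].
  rewrite mulr0 (_ : (fun z => _) = cst 0) ?Rintegral_cst ?mul0r //.
  by apply/funext => z; rewrite /= expr0n.
have mW2 k : measurable_fun setT (fun z => wsum k z ^+ 2).
  by apply: measurable_funX; exact: measurable_wsum.
have W2b k z : `|wsum k z ^+ 2| <= k%:R ^+ 2.
  by rewrite normrX lerXn2r ?nnegrE // wsum_le.
have mdW k : measurable_fun setT (fun z => ctr z * wsum k z).
  by apply: measurable_funM; [exact: measurable_ctr|exact: measurable_wsum].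
have dWb k z : `|ctr z * wsum k z| <= k%:R.
  by rewrite normrM (le_trans _ (wsum_le k z)) // ler_piMl // ctr_le1.
have E0 : Ex (fun z => ctr z * wsum n.+1 z) <= (size w)%:R + K + K.
  have m1W : measurable_fun setT (fun z : Z => \1_(cyl (t0 := t0) w) z * wsum n.+1 z).
    by apply: measurable_funM; [exact: measurable_indic|exact: measurable_wsum].
  have W1b (z : Z) : `|\1_(cyl (t0 := t0) w) z * wsum n.+1 z| <= n.+1%:R.
    rewrite normrM (le_trans _ (wsum_le n.+1 z)) // ler_piMl //.
    by rewrite indicE; case: (_ \in _); rewrite ?normr1 ?normr0.
  have -> : (fun z => ctr z * wsum n.+1 z) =
      (fun z => \1_(cyl (t0 := t0) w) z * wsum n.+1 z - p0 * wsum n.+1 z).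
    by apply/funext => z; rewrite /ctr mulrBl.
  have mpW : measurable_fun setT (fun z => p0 * wsum n.+1 z).
    by apply: measurable_funM => //; exact: measurable_wsum.
  have pWb z : `|p0 * wsum n.+1 z| <= n.+1%:R.
    rewrite normrM (le_trans _ (wsum_le n.+1 z)) // ler_piMl //.
    by move: p001 => /andP[? ?]; rewrite ger0_norm.
  rewrite RintegralB //; last 2 first.
  - exact: (bern_integrable measurableT m1W W1b).
  - exact: (bern_integrable measurableT mpW pWb).
  rewrite RintegralZl //; last exact: (bern_integrable measurableT (measurable_wsum _) (wsum_le _)).
  have -> : Ex (fun z => \1_(cyl (t0 := t0) w) z * wsum n.+1 z) = Rintegral nu (cyl w) (wsum n.+1).
    rewrite [RHS]Rintegral_mkcond; apply: eq_Rintegral => z _.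
    by rewrite patchE indicE; case: (_ \in _); rewrite ?mul1r ?mul0r.
  rewrite (le_trans (ler_norm _)) // (le_trans (ler_normB _ _)) // lerD //.
    exact: wsum_cyl.
  rewrite normrM (le_trans _ (K_ge n.+1)) // ler_piMl //.
  by move: p001 => /andP[? ?]; rewrite ger0_norm.
have mS : measurable_fun setT (fun z : Z => wsum n (shift z) ^+ 2).
  exact: (measurableT_comp (mW2 n) (measurable_shift (t0 := t0))).
have m2d : measurable_fun setT (fun z => 2 * (ctr z * wsum n.+1 z)).
  exact: measurable_funM.
have b2d z : `|2 * (ctr z * wsum n.+1 z)| <= 2 * n.+1%:R.
  by rewrite normrM ger0_norm // ler_pM2l.
have -> : C * n.+1%:R = 2 * ((size w)%:R + K + K) + C * n%:R.
  by rewrite -natr1 /C; ring.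
(* Since [g] squares to 1, [(x + u y)^2 = 2 x (x + u y) - x^2 + y^2]; the term [- x^2] is
   dropped. *)
apply: (@le_trans _ _ (Ex (fun z => 2 * (ctr z * wsum n.+1 z) + wsum n (shift z) ^+ 2))).
  apply: le_Rintegral => //.
  - exact: (bern_integrable measurableT (mW2 _) (W2b _)).
  - apply: (@bern_integrable _ _ (2 * n.+1%:R + n%:R ^+ 2)) => //.
      exact: measurable_funD.
    by move=> z; rewrite (le_trans (ler_normD _ _)) // lerD.
  - move=> z _; have := g2 (z 0%N); rewrite /= !expr2.
    move: (ctr z) (wsum n _) (g _) => x y u uu.
    have -> : (x + u * y) * (x + u * y) = 2 * (x * (x + u * y)) - x * x + (u * u) * (y * y) by ring.
    rewrite uu mul1r lerD2r lerBlDr lerDl -expr2; exact: sqr_ge0.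
rewrite RintegralD //; last 2 first.
- exact: (bern_integrable measurableT m2d b2d).
- by apply: (bern_integrable measurableT mS) => z; exact: W2b.
rewrite (@Ex_shift (fun z => wsum n z ^+ 2) (n%:R ^+ 2)) //.
rewrite RintegralZl //; last exact: (bern_integrable measurableT (mdW _) (dWb _)).
by rewrite lerD // ler_pM2l.
Qed.

Lemma sum_inv_sqr (n : nat) : \sum_(k < n) (k.+1%:R ^- 2 : R) <= 2.
Proof.
have H : \sum_(k < n.+1) (k.+1%:R ^- 2 : R) <= 2 - n.+1%:R^-1.
  elim: n => [|n IH]; first by rewrite big_ord_recl big_ord0 /= expr1n invr1; lra.
  rewrite big_ord_recr /= (le_trans (lerD IH (lexx _))) //.
  have x0 : 0 < n.+1%:R :> R by rewrite ltr0n.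
  rewrite -[n.+2%:R]natr1; move: (n.+1%:R) x0 => x x0.
  have -> : (x + 1) ^- 2 = (x + 1)^-1 * (x + 1)^-1 by rewrite expr2 invfM.
  have -> : x^-1 = (x + 1)^-1 + (x + 1)^-1 * x^-1 by field; rewrite !gt_eqF // addr_gt0.
  have h : (x + 1)^-1 <= x^-1 by rewrite lef_pV2 ?posrE ?addr_gt0 // lerDl.
  have h0 : 0 <= (x + 1)^-1 by rewrite invr_ge0 addr_ge0 // ltW.
  have := ler_wpM2l h0 h; lra.
apply: (le_trans _ (le_trans H _)); first by rewrite big_ord_recr /= lerDl invr_ge0 exprn_ge0.
by rewrite gerBl invr_ge0.
Qed.

Lemma sqrt_floor (n : nat) : exists k : nat, (k * k <= n < k.+1 * k.+1)%N.
Proof.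
elim: n => [|n [k /andP[kn nk]]]; first by exists 0%N.
have [h|h] := ltnP n.+1 (k.+1 * k.+1)%N; first by exists k; rewrite h leqW.
by exists k.+1; rewrite h /=; lia.
Qed.

Lemma sqrt_gap (k n : nat) : (n < k.+1 * k.+1)%N -> (n - k * k <= 2 * k)%N.
Proof. by lia. Qed.

(* The second moment bound is summable along the squares, and between k^2 and (k+1)^2 the sum moves by at most 2k. *)
Lemma wsum_strong_law :
  {ae nu, forall z, (fun n => wsum n z / n%:R) @ \oo --> (0 : R)}.
Proof.
have K0 : 0 <= K by exact: le_trans (K_ge 0).
have C0 : 0 <= C by rewrite mulr_ge0 // !addr_ge0.
pose f k (z : Z) : R := (wsum (k.+1 * k.+1) z / (k.+1 * k.+1)%:R) ^+ 2.
have mf k : measurable_fun setT (f k).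
  by apply: measurable_funX; apply: measurable_funM => //; exact: measurable_wsum.
have f0 k z : 0 <= f k z by exact: sqr_ge0.
have Ef k : (\int[nu]_z (f k z)%:E <= (C * k.+1%:R ^- 2)%:E)%E.
  have mW2 : measurable_fun setT (fun z => wsum (k.+1 * k.+1) z ^+ 2).
    by apply: measurable_funX; exact: measurable_wsum.
  have W2b z : `|wsum (k.+1 * k.+1) z ^+ 2| <= (k.+1 * k.+1)%:R ^+ 2.
    by rewrite normrX lerXn2r ?nnegrE // wsum_le.
  have I2 := bern_integrable measurableT mW2 W2b.
  have := second_moment (k.+1 * k.+1).
  have x0 : 0 < k.+1%:R :> R by rewrite ltr0n.
  rewrite natrM; move: x0; set x : R := k.+1%:R => x0 sm.
  have -> : (\int[nu]_z (f k z)%:E)%E = (Rintegral nu setT (fun z => ((x * x) ^- 2) * wsum (k.+1 * k.+1) z ^+ 2))%:E.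
    rewrite /Rintegral fineK; last first.
      apply: (@integrable_fin_num _ _ _ nu _ measurableT).
      apply: (@bern_integrable _ _ ((x * x) ^- 2 * (k.+1 * k.+1)%:R ^+ 2)) => //.
        exact: measurable_funM.
      by move=> z; rewrite normrM ger0_norm ?invr_ge0 ?exprn_ge0 ?mulr_ge0 // ler_wpM2l // invr_ge0 exprn_ge0 // mulr_ge0.
    apply: eq_integral => z _; congr EFin.
    by rewrite /f natrM exprMn exprVn mulrC.
  rewrite lee_fin RintegralZl //.
  apply: (le_trans (ler_wpM2l _ sm)); first by rewrite invr_ge0 exprn_ge0 // mulr_ge0.
  by rewrite le_eqVlt; apply/orP; left; apply/eqP; field; rewrite gt_eqF.
(* The normalised squares have integrals of order [1 / (k + 1)^2]; hence their sum is almost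
   everywhere finite and its terms tend to zero. *)
have fin : (\int[nu]_z (\sum_(k <oo) (f k z)%:E) < +oo)%E.
  rewrite integral_nneseries //; [|by move=> k; exact/measurable_EFinP|by move=> k z _; rewrite lee_fin].
  apply: (@le_lt_trans _ _ (C * 2)%:E); last exact: ltry.
  apply: lime_le.
    by apply: is_cvg_nneseries => k _ _; apply: integral_ge0 => z _; rewrite lee_fin.
  apply: nearW => n; rewrite big_mkord.
  apply: (@le_trans _ _ (\sum_(k < n) (C * k.+1%:R ^- 2)%:E)%E); first exact: lee_sum.
  by rewrite sumEFin lee_fin -mulr_sumr ler_wpM2l // sum_inv_sqr.
have mS : measurable_fun setT (fun z : Z => (\sum_(k <oo) (f k z)%:E)%E).
  apply: ge0_emeasurable_sum => [k z _ _|k _]; first by rewrite lee_fin.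
  exact/measurable_EFinP.
have intS : nu.-integrable setT (fun z : Z => (\sum_(k <oo) (f k z)%:E)%E).
  apply/integrableP; split => //.
  have E z : z \in setT -> (`|\sum_(k <oo) (f k z)%:E| = \sum_(k <oo) (f k z)%:E)%E.
    by move=> _; rewrite gee0_abs //; apply: nneseries_ge0 => k _ _; rewrite lee_fin.
  by rewrite (eq_integral _ _ E).
have := integrable_ae measurableT intS; apply: filterS => z /(_ I) Sfin.
set S := (\sum_(k <oo) _)%E in Sfin.
have fz : (fun k => f k z) @ \oo --> (0 : R).
  apply: cvg_series_cvg_0.
  apply: (@nondecreasing_is_cvgn _ (series (fun k => f k z))).
    by apply/nondecreasing_seqP => n; rewrite seriesEnat /= big_nat_recr //= lerDl.
  exists (fine S) => _ [n _ <-]; rewrite -lee_fin fineK // seriesEnat /= -sumEFin.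
  by apply: nneseries_lim_ge => k _ _; rewrite lee_fin.
apply/cvgrPdist_le => e e0.
have e20 : 0 < (e / 2) ^+ 2 by rewrite exprn_gt0 // divr_gt0.
have [N1 _ H1] : \forall k \near \oo, f k z <= (e / 2) ^+ 2.
  move/cvgrPdist_le : fz => /(_ _ e20); apply: filterS => k.
  by rewrite sub0r normrN ger0_norm.
(* [N1.+1] compensates for [f k] being taken at time [(k + 1)^2]; the bound [4 / e < k] makes the
   gap [2 k] between squares at most [e / 2] times [k^2]. *)
pose N := maxn N1.+1 (Num.truncn (4 / e)).+1.
exists (N.+1 * N.+1)%N => // n /= Nn.
have [k /andP[kn nk]] := sqrt_floor n.
have Nk : (N <= k)%N.
  rewrite leqNgt; apply/negP => kN.
  by have := leq_trans nk (leq_mul kN kN); rewrite ltnNge (leq_trans _ Nn) // leq_mul.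
have k0 : (0 < k)%N by rewrite (leq_trans _ Nk) // leq_max.
have n0 : (0 < n)%N by rewrite (leq_trans _ kn) // muln_gt0 k0.
rewrite sub0r normrN normrM normfV ler_pdivrMr; last by rewrite normr_gt0 pnatr_eq0 -lt0n.
rewrite (@ger0_norm _ n%:R) //.
have Wk : `|wsum (k * k) z| <= e / 2 * (k * k)%:R.
  have := H1 k.-1; rewrite /= /f prednK // => /(_ _) h.
  have {}h : `|wsum (k * k) z / (k * k)%:R| <= e / 2.
    rewrite -ler_sqr ?nnegrE //; last by rewrite divr_ge0 // ltW.
    by rewrite real_normK ?num_real //; apply: h; rewrite -ltnS prednK // (leq_trans _ Nk) // leq_maxl.
  have kk0 : 0 < (k * k)%:R :> R by rewrite ltr0n muln_gt0 k0.
  by move: h; rewrite normrM normfV (gtr0_norm kk0) ler_pdivrMr.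
rewrite -(subnKC kn) (le_trans (wsum_lip _ _ _)) // natrD mulrDr.
have ek : 2 <= e / 2 * k%:R.
  have : 4 / e < k%:R.
    by rewrite (lt_le_trans (truncnS_gt _)) // ler_nat (leq_trans _ Nk) // leq_maxr.
  rewrite ltr_pdivrMr // => h; rewrite mulrAC ler_pdivlMr // (mulrC e).
  by rewrite (le_trans _ (ltW h)) // -natrM.
have jk : ((n - k * k)%N%:R : R) <= 2 * k%:R by rewrite -natrM ler_nat sqrt_gap.
have kk : 2 * k%:R <= e / 2 * (k * k)%:R by rewrite natrM mulrA ler_wpM2r.
have h0 : 0 <= e * (n - k * k)%N%:R by rewrite mulr_ge0 // ltW.
have -> : e * (k * k)%:R = e / 2 * (k * k)%:R + e / 2 * (k * k)%:R by rewrite -mulrDl -splitr.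
by rewrite -addrA lerD // (le_trans jk) // (le_trans kk) // lerDl.
Qed.

End StrongLaw.

(** * Frequencies of words jointly with the orientation *)

Section Frequencies.
Variables (neg : T -> bool).
Let rho := nu [set u | neg (u 0%N)].

(* The orientation never changes when no letter is reflecting; otherwise both orientations are equally likely in the limit. *)
Definition sgwt (b : bool) : R := if rho == 0%E then (~~ b)%:R else 2^-1.

Lemma measurable_shift_iter n A : measurable A ->
  nu (shiftn n @^-1` A) = nu A.
Proof.
elim: n A => [|n IH] A mA; first by [].
have mA' : measurable (shiftn n @^-1` A : set Z) by exact: measurable_shiftn_preimage.
rewrite -(IH A mA) -(shift_invariant mA'); congr (nu _).
Qed.

Lemma wsum_center l w : Ex (wsum w (fine (nu (cyl w))) (fun=> 1) l) = 0.
Proof.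
have mw := measurable_cyl (t0 := t0) w.
have nw := fineK (bern_fin mw).
have p01 : 0 <= fine (nu (cyl w)) <= 1.
  by rewrite fine_ge0 //= -lee_fin nw probability_le1.
have g1 (a : T) : (1 : R) * 1 = 1 by rewrite mulr1.
pose W := wsum w (fine (nu (cyl w))) (fun=> 1).
have mW n : measurable_fun setT (W n) by exact: measurable_wsum.
have Wb n z : `|W n z| <= n%:R by exact: wsum_le.
elim: l => [|l IH]; first by rewrite Rintegral_cst // mul0r.
rewrite /= -/(W l) (_ : (fun z => _) = (fun z : Z => ctr w (fine (nu (cyl w))) z + W l (shift z))); last first.
  by apply/funext => z; rewrite mul1r.
have md := measurable_ctr w (fine (nu (cyl w))).
have db := ctr_le1 w p01.
rewrite RintegralD //; last 2 first.
- exact: (bern_integrable measurableT md db).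
- apply: (@bern_integrable _ _ l%:R) => //.
  exact: (measurableT_comp (mW l) (measurable_shift (t0 := t0))).
rewrite (@Ex_shift (W l) l%:R) // IH addr0.
rewrite RintegralB //; last 2 first.
- apply: (@bern_integrable _ _ 1) => //.
  by move=> z; rewrite indicE; case: (_ \in _); rewrite ?normr1 ?normr0.
- apply: (@bern_integrable _ _ 1) => // z.
  by move: p01 => /andP[? ?]; rewrite ger0_norm.
have nT : fine (nu setT) = 1 by rewrite probability_setT.
by rewrite Rintegral_cst // nT mulr1 /Rintegral integral_indic // setIT subrr.
Qed.

Let sg (a : T) : R := if neg a then -1 else 1.

Lemma signE (z : Z) j : \prod_(i < j) sg (z i) = if parity neg (mkseq z j) then -1 else 1.
Proof.
elim: j z => [|j IH] z; first by rewrite big_ord0.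
rewrite big_ord_recl.
have -> : mkseq z j.+1 = z 0%N :: mkseq (shift z) j.
  by rewrite /mkseq /= (iotaDl 1 0) -map_comp.
rewrite (_ : \prod_(i < j) _ = \prod_(i < j) sg (shift z i)) //= IH /sg.
by case: (neg _); case: (parity _ _); rewrite /= ?mulN1r ?mul1r ?opprK.
Qed.

(** The sign of the first letter is independent of the shifted sequence and has mean
    [1 - 2 * rho]. *)
Lemma Ex_sign (phi : Z -> R) c : measurable_fun setT phi -> (forall z, `|phi z| <= c) ->
  Ex (fun z => sg (z 0%N) * phi (shift z)) = (1 - 2 * fine rho) * Ex phi.
Proof.
move=> mphi phic.
have mneg : measurable [set u : Z | neg (u 0%N)] by exact: (measurable_coord 0 [set a | neg a]).
have mpos : measurable [set u : Z | ~~ neg (u 0%N)] by exact: (measurable_coord 0 [set a | ~~ neg a]).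
have TE : [set: Z] = [set u : Z | ~~ neg (u 0%N)] `|` [set u : Z | neg (u 0%N)].
  by apply/seteqP; split => u //= _; case: (neg _); [right|left].
have mphis : measurable_fun setT (fun z : Z => phi (shift z)).
  exact: (measurableT_comp mphi (measurable_shift (t0 := t0))).
have mF : measurable_fun setT (fun z : Z => sg (z 0%N) * phi (shift z)).
  by apply: measurable_funM => //; exact: measurable_letter.
have Fb (z : Z) : `|sg (z 0%N) * phi (shift z)| <= c.
  by rewrite normrM /sg; case: (neg _); rewrite ?normrN normr1 mul1r.
rewrite [in LHS]TE Rintegral_setU //; last 2 first.
- by rewrite -TE; exact: (bern_integrable measurableT mF Fb).
- by rewrite disj_set2E; apply/eqP/seteqP; split => u //= -[/negP].
have -> : Rintegral nu [set u : Z | ~~ neg (u 0%N)] (fun z : Z => sg (z 0%N) * phi (shift z)) =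
    Rintegral nu [set u : Z | ~~ neg (u 0%N)] (fun z => phi (shiftn 1 z)).
  by apply: eq_Rintegral => z; rewrite inE /= /sg => /negbTE ->; rewrite mul1r.
have -> : Rintegral nu [set u : Z | neg (u 0%N)] (fun z : Z => sg (z 0%N) * phi (shift z)) =
    - Rintegral nu [set u : Z | neg (u 0%N)] (fun z => phi (shiftn 1 z)).
  rewrite -mulN1r -RintegralZl //; last by exact: (bern_integrable mneg mphis (fun z => phic _)).
  by apply: eq_Rintegral => z; rewrite inE /= /sg => ->.
rewrite (@Rintegral_renewal 1 _ phi c mpos) //; last first.
  by move=> A mA; exact: (renewal_letter [set a | ~~ neg a]).
rewrite (@Rintegral_renewal 1 _ phi c mneg) //; last first.
  by move=> A mA; exact: (renewal_letter [set a | neg a]).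
have -> : fine (nu [set u : Z | ~~ neg (u 0%N)]) = 1 - fine rho.
  by rewrite (letter_negE neg) fineB //; exact: bern_fin.
by rewrite -/rho; ring.
Qed.

(** The means satisfy [E_(n+1) = c + la * E_n] with [la = 1 - 2 * rho], hence
    [2 * rho * E_n = c * (1 - la ^+ n)]. The right side is at most 2 in absolute value, also for
    [la = -1], where the means need not converge. *)
Lemma wsum_sign_bound w l : rho != 0%E -> `|Ex (wsum w 0 sg l)| <= (fine rho)^-1.
Proof.
move=> rho0.
have mneg : measurable [set u : Z | neg (u 0%N)] by exact: (measurable_coord 0 [set a | neg a]).
have frho := fineK (bern_fin mneg).
have r01 : 0 < fine rho <= 1.
  apply/andP; split; last by rewrite -lee_fin frho; exact: probability_le1.
  rewrite lt_neqAle eq_sym fine_ge0 ?andbT; last exact: measure_ge0.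
  by rewrite -eqe frho.
have p01 : 0 <= (0 : R) <= 1 by rewrite lexx ler01.
have sg2 a : sg a * sg a = 1 by rewrite /sg; case: (neg a); rewrite ?mulrNN mulr1.
have mw := measurable_cyl (t0 := t0) w.
pose W := wsum w 0 sg.
have mW n : measurable_fun setT (W n) by exact: measurable_wsum.
have Wb n z : `|W n z| <= n%:R by exact: wsum_le.
have md := measurable_ctr w 0.
have db := ctr_le1 w p01.
pose la : R := 1 - 2 * fine rho.
pose c := Ex (ctr w 0).
have c1 : `|c| <= 1 by exact: (Rintegral_le_bound measurableT md db).
have rec n : Ex (W n.+1) = c + la * Ex (W n).
  have mS : measurable_fun setT (fun z : Z => sg (z 0%N) * W n (shift z)).
    apply: measurable_funM; first exact: measurable_letter.
    exact: (measurableT_comp (mW n) (measurable_shift (t0 := t0))).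
  rewrite /= RintegralD //; last 2 first.
  - exact: (bern_integrable measurableT md db).
  - apply: (bern_integrable measurableT mS) => z.
    by rewrite normrM (gnorm sg2) mul1r; exact: (Wb n (shift z)).
  by rewrite (@Ex_sign (W n) n%:R).
have closed n : Ex (W n) * (2 * fine rho) = c * (1 - la ^+ n).
  elim: n => [|n IH]; first by rewrite /= Rintegral_cst // !mul0r expr0 subrr mulr0.
  rewrite rec mulrDl -mulrA IH exprS /la; ring.
move: r01 => /andP[r0 r1].
have la1 : `|la| <= 1 by rewrite /la ler_norml; apply/andP; split; lra.
have : `|Ex (W l) * (2 * fine rho)| <= 2.
  rewrite closed normrM (le_trans (ler_piMl _ c1)) // (le_trans (ler_normB _ _)) //.
  rewrite normr1 normrX (_ : 2 = 1 + 1 :> R) ?lerD2l; last by ring.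
  exact: exprn_ile1.
have h2 : 0 <= 2 * fine rho by rewrite mulr_ge0 // ltW.
rewrite normrM (ger0_norm h2).
by rewrite -ler_pdivlMr ?mulr_gt0 // invfM mulrA divff ?mul1r // pnatr_eq0.
Qed.

(** For [rho] nonzero the indicator of orientation [b] is half of one plus or minus the orientation
    sign, so the frequency is half the plain frequency plus a signed average that tends to zero. For
    [rho] zero almost every sequence has no reflecting letter and the orientation stays [false]. *)
Lemma word_frequency w b : {ae nu, forall z,
  (fun n => (\sum_(j < n) (\1_(cyl (t0 := t0) w) (shiftn j z : Z) *
      (parity neg (mkseq z j) == b)%:R : R)) / n%:R)
    @ \oo --> fine (nu (cyl w)) * sgwt b}.
Proof.
have mw := measurable_cyl (t0 := t0) w.
set q := fine (nu (cyl w)).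
have p01 : 0 <= q <= 1.
  by rewrite fine_ge0 //= -lee_fin (fineK (bern_fin mw)) probability_le1.
have g1 (a : T) : (1 : R) * 1 = 1 by rewrite mulr1.
have A : {ae nu, forall z, (fun n => wsum w q (fun=> 1) n z / n%:R) @ \oo --> (0 : R)}.
  by apply: (wsum_strong_law p01 g1 (K := 0)) => l; rewrite wsum_center normr0.
have AE z n : wsum w q (fun=> 1) n z = \sum_(j < n) \1_(cyl (t0 := t0) w) (shiftn j z : Z) - q *+ n.
  rewrite wsumE.
  transitivity (\sum_(j < n) (\1_(cyl (t0 := t0) w) (shiftn j z : Z) - q)).
    by apply: eq_bigr => j _; rewrite big1 ?mul1r.
  by rewrite sumrB sumr_const card_ord.
have n0 n : (n.+1%:R : R) != 0 by rewrite pnatr_eq0.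
have Afreq z : (fun n => wsum w q (fun=> 1) n z / n%:R) @ \oo --> (0 : R) ->
    (fun n => (\sum_(j < n) \1_(cyl (t0 := t0) w) (shiftn j z : Z) : R) / n%:R) @ \oo --> q.
  move=> H; rewrite -(add0r q).
  apply: cvg_trans (cvgD H (cvg_cst q)); apply: near_eq_cvg; near=> n.
  have n1 : (0 < n)%N by near: n; exists 1%N.
  rewrite fctE AE /= mulrBl.
  have -> : q *+ n / n%:R = q by rewrite -(mulr_natr q) mulfK // pnatr_eq0 -lt0n.
  by rewrite subrK.
rewrite /sgwt; case: (boolP (rho == 0%E)) => [/eqP rho0|rho0].
  have B : {ae nu, forall z, forall i, ~~ neg (z i)}.
    apply: ae_foralln => i; exists [set z : Z | neg (z i)]; split.
    - exact: (measurable_coord i [set a | neg a]).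
    - rewrite -rho0 -[RHS](@measurable_shift_iter i); last exact: (measurable_coord 0 [set a | neg a]).
      by congr (nu _); apply/seteqP; split => z /=; rewrite addn0.
    - by move=> z /= /negP; rewrite negbK.
  apply: filterS2 A B => z Az Bz.
  have par j : parity neg (mkseq z j) = false.
    rewrite /mkseq; elim: (iota 0 j) => //= a s ->.
    by rewrite (negbTE (Bz a)).
  case: b => /=.
    rewrite mulr0 [X in X @ _](_ : _ = fun=> 0); first exact: cvg_cst.
    by apply/funext => n; rewrite big1 ?mul0r // => j _; rewrite par mulr0.
  rewrite mulr1 [X in X @ _](_ : _ = fun n =>
    (\sum_(j < n) \1_(cyl (t0 := t0) w) (shiftn j z : Z) : R) / n%:R); first exact: Afreq.
  apply/funext => n; congr (_ / _); apply: eq_bigr => j _.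
  by rewrite par eqxx mulr1.
have p00 : 0 <= (0 : R) <= 1 by rewrite lexx ler01.
have sg2 a : sg a * sg a = 1 by rewrite /sg; case: (neg a); rewrite ?mulrNN mulr1.
have B := wsum_strong_law p00 sg2 (wsum_sign_bound w ^~ rho0).
apply: filterS2 A B => z /Afreq Az Bz.
(* The sign for which [(1 + eb * sign) / 2] is the indicator of orientation [b]. *)
pose eb : R := if b then -1 else 1.
rewrite [X in X @ _](_ : _ = fun n =>
   2^-1 * ((\sum_(j < n) \1_(cyl (t0 := t0) w) (shiftn j z : Z) : R) / n%:R) +
   2^-1 * eb * (wsum w 0 sg n z / n%:R)).
  rewrite (_ : q / 2 = 2^-1 * q + 2^-1 * eb * 0); last by rewrite mulr0 addr0 mulrC.
  by apply: cvgD; apply: cvgM => //; exact: cvg_cst.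
apply/funext => n; rewrite !mulrA -mulrDl; congr (_ / _).
rewrite wsumE !mulr_sumr -big_split /=; apply: eq_bigr => j _.
rewrite signE /ctr subr0 {}/eb.
by case: b; case: (parity _ _); rewrite ?eqxx /=; field.
Unshelve. all: by end_near. Qed.

Lemma all_word_frequencies : {ae nu, forall z, forall w b,
  (fun n => (\sum_(j < n) (\1_(cyl (t0 := t0) w) (shiftn j z : Z) *
      (parity neg (mkseq z j) == b)%:R : R)) / n%:R)
    @ \oo --> fine (nu (cyl w)) * sgwt b}.
Proof.
have : {ae nu, forall z, forall k, forall x, unpickle k = Some x ->
  (fun n => (\sum_(j < n) (\1_(cyl (t0 := t0) x.1) (shiftn j z : Z) *
      (parity neg (mkseq z j) == x.2)%:R : R)) / n%:R)
    @ \oo --> fine (nu (cyl x.1)) * sgwt x.2}.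
  apply: ae_foralln => k; case e : (unpickle k) => [[w b]|]; last by apply: aeW.
  apply: filterS (word_frequency w b) => z H x [<-]; exact: H.
apply: filterS => z H w b.
exact: (H (pickle (w, b)) (w, b) (pickleK _)).
Qed.

End Frequencies.
End Bernoulli.

(** * Coding of the fibres *)

(** A set that is open in [D] for the prefix topology is the trace of a union of cylinders, and over
    a countable alphabet there are only countably many of these. *)
Lemma measurable_cyl_open (T : countType) (t0 : T) (D S : set (SeqSp t0)) :
  measurable D ->
  (forall z, D z -> S z -> exists n, cyl (t0 := t0) (mkseq z n) `&` D `<=` S) ->
  measurable (D `&` S).
Proof.
move=> mD H.
pose F (w : seq T) : set (SeqSp t0) :=
  if `[< cyl (t0 := t0) w `&` D `<=` S >] then cyl (t0 := t0) w else set0.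
rewrite (_ : D `&` S = D `&` \bigcup_w F w).
  apply: measurableI => //; apply: countable_bigcupT_measurable => [|w].
    exact: countableP.
  by rewrite /F; case: asboolP => _; [exact: measurable_cyl|exact: measurable0].
apply/seteqP; split => z [Dz].
  move=> Sz; split => //; have [n nS] := H z Dz Sz; exists (mkseq z n) => //.
  by rewrite /F asboolT //; exact: cyl_mkseq.
move=> [w _]; rewrite /F; case: asboolP => // wS zw; split => //.
exact: wS.
Qed.

(** Compactness of the sequence space over a finite alphabet: each coordinate is constant on a set
    of a free ultrafilter, and finitely many such sets meet at arbitrarily large indices. *)
Lemma konig (T : finType) (y : nat -> nat -> T) :
  exists l : nat -> T, forall m, exists2 n, (m <= n)%N & forall i, (i < m)%N -> y n i = l i.
Proof.
have [G [UG subG]] := ultraFilterLemma (eventually_filter : ProperFilter \oo).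
have PG : ProperFilter G by exact: ultra_proper.
have /choice[l lP] i : exists a : T, G [set n | y n i = a].
  apply: contrapT => H.
  have : G [set n | forall a : T, y n i <> a].
    apply: filter_forall => a.
    by have [Ga|] := in_ultra_setVsetC [set n | y n i = a] UG; [case: H; exists a|].
  by move=> /filter_ex[n /(_ (y n i))]; exact.
exists l => m.
have : G [set n | (m <= n)%N /\ forall i : 'I_m, y n i = l i].
  apply: filterI; first by apply: subG; exists m.
  by apply: filter_forall => i; exact: lP.
move=> /filter_ex[n [mn ny]]; exists n => // i im.
exact: (ny (Ordinal im)).
Qed.

Section Symbolic.
Context {R : realType} {I : finType} {i0 : I}.
Variables (k : I -> nat) (r : I -> R) (t : I -> nat -> R).
Hypothesis k_gt0 : forall i, (0 < k i)%N.
Hypothesis r_cond : forall i, r i != 0 /\ `|r i| < 1.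

Definition letter := {i : I & 'I_(k i)}.
HB.instance Definition _ := Finite.on letter.

Definition digit (a : letter) : nat := nat_of_ord (tagged a).

(** Digits outside the alphabet of [i] are sent to 0, which makes the coding map total; such digit
    sequences are null. *)
Definition mkT (i : I) (a : nat) : letter :=
  Tagged (fun i => 'I_(k i))
    (match ltnP a (k i) with LtnNotGeq h => Ordinal h | _ => Ordinal (k_gt0 i) end).

Definition l0 : letter := mkT i0 0.
Local Notation Z := (SeqSp l0).
Implicit Types (z : Z) (om : nat -> I) (u : nat -> nat).

Definition omz z : nat -> I := fun n => tag (z n).
Definition dgz z : nat -> nat := fun n => digit (z n).
Definition mkz om u : Z := fun n => mkT (om n) (u n).

Lemma mkT_tag i a : tag (mkT i a) = i. Proof. by []. Qed.

Lemma mkT_digit i a : (a < k i)%N -> digit (mkT i a) = a.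
Proof. by rewrite /digit /mkT /=; case: ltnP. Qed.

Lemma mkT_eta (a : letter) : mkT (tag a) (digit a) = a.
Proof.
case: a => i a; rewrite /digit /mkT /=; congr (Tagged _ _); apply: val_inj => /=.
by case: ltnP => //=; rewrite leqNgt ltn_ord.
Qed.

Lemma letter_eq (a b : letter) : tag a = tag b ->
  digit a = digit b -> a = b.
Proof. by move=> e1 e2; rewrite -(mkT_eta a) -(mkT_eta b) e1 e2. Qed.

Lemma dgz_Xinf z : Xinf k (omz z) (dgz z). Proof. by move=> n; exact: ltn_ord. Qed.

Lemma dgz_mkz om u : Xinf k om u -> dgz (mkz om u) = u.
Proof. by move=> H; apply/funext => n; exact: mkT_digit. Qed.

Definition rmax : R := \big[Num.max/0]_i `|r i|.
Definition tmax : R := \sum_(a : letter) `|t (tag a) (digit a)|.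
(** Stands in for the minimum: the product is positive, and below each factor because all the others
    are less than 1. *)
Definition rmin : R := \prod_i `|r i|.

Lemma rmax_lt1 : rmax < 1.
Proof.
by apply: (big_ind (fun x : R => x < 1)) => // [x y x1 y1|i _]; [rewrite gt_max x1|case: (r_cond i)].
Qed.

Lemma le_rmax i : `|r i| <= rmax.
Proof. exact: le_bigmax. Qed.

Lemma rmax_ge0 : 0 <= rmax.
Proof. exact: le_trans (le_rmax i0). Qed.

Lemma tmax_ge0 : 0 <= tmax. Proof. exact: sumr_ge0. Qed.

Lemma r_gt0 i : 0 < `|r i|. Proof. by rewrite normr_gt0; case: (r_cond i). Qed.

Lemma rmin_gt0 : 0 < rmin. Proof. by apply: prodr_gt0 => i _; exact: r_gt0. Qed.

Lemma rmin_le i : rmin <= `|r i|.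
Proof.
rewrite /rmin (bigD1 i) //= ler_piMr // prodr_ile1 // => j _.
by rewrite normr_ge0 /= ltW //; case: (r_cond j).
Qed.

Lemma le_tmax (a : letter) : `|t (tag a) (digit a)| <= tmax.
Proof. by rewrite /tmax (bigD1 a) //= lerDl sumr_ge0. Qed.

Definition term om u (n : nat) : R := (\prod_(j < n) r (om j)) * t (om n) (u n).

Lemma term_le om u n : Xinf k om u -> `|term om u n| <= tmax * rmax ^+ n.
Proof.
move=> X; rewrite /term normrM normr_prod mulrC; apply: ler_pM => //.
- by apply: prodr_ge0.
- by have := le_tmax (mkT (om n) (u n)); rewrite mkT_tag mkT_digit.
- rewrite -[n in _ ^+ n]card_ord -prodr_const; apply: ler_prod => j _.
  by rewrite normr_ge0 le_rmax.
Qed.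

Lemma cvg_term om u : Xinf k om u -> cvgn (series (term om u)).
Proof.
move=> X; apply: normed_cvg.
apply: (series_le_cvg _ _ (fun n => term_le n X)) => [n|n|]; first exact: normr_ge0.
  by rewrite mulr_ge0 ?tmax_ge0 // exprn_ge0 // rmax_ge0.
apply: is_cvg_geometric_series; rewrite ger0_norm ?rmax_ge0 //; exact: rmax_lt1.
Qed.

Definition point_of z : R := Pi r t (omz z) (dgz z).
Local Notation X := point_of.

Lemma point_ofE om u : Xinf k om u -> X (mkz om u) = Pi r t om u.
Proof. by move=> H; rewrite /point_of dgz_mkz. Qed.

Lemma point_rec z :
  X z = r (omz z 0%N) * X (shift z : Z) + t (omz z 0%N) (dgz z 0%N).
Proof.
rewrite /point_of /Pi -/(term _ _) -/(term (omz (shift z : Z)) (dgz (shift z : Z))).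
have c1 := cvg_term (dgz_Xinf (shift z : Z)).
apply/cvg_lim => //; rewrite -(cvg_shiftn 1) /=.
rewrite (_ : (fun n => _) = (fun n => r (omz z 0%N) *
    series (term (omz (shift z : Z)) (dgz (shift z : Z))) n + t (omz z 0%N) (dgz z 0%N))).
  apply: cvgD; last exact: cvg_cst.
  by apply: cvgM; [exact: cvg_cst|exact: c1].
apply/funext => n; rewrite addn1 !seriesEnat /= big_nat_recl //= addrC; congr (_ + _).
  rewrite mulr_sumr; apply: eq_bigr => i _.
  by rewrite /term big_ord_recl mulrA.
by rewrite /term big_ord0 mul1r.
Qed.

(** Sum of the geometric bound on the terms of the series. It bounds [|X z|], so two points are at
    distance at most [2 * diam]. *)
Definition diam : R := tmax / (1 - rmax).

Lemma diam_ge0 : 0 <= diam.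
Proof. by rewrite divr_ge0 ?tmax_ge0 // subr_ge0 ltW // rmax_lt1. Qed.

Lemma point_le z : `|X z| <= diam.
Proof.
have cX := cvg_term (dgz_Xinf z).
have : (fun n => `|series (term (omz z) (dgz z)) n|) @ \oo --> `|X z|.
  by apply: cvg_norm; exact: cX.
move=> /cvg_lim <- //; apply: limr_le; first by apply: is_cvg_norm; exact: cX.
apply: nearW => n; rewrite seriesEord /= (le_trans (ler_norm_sum _ _ _)) //.
have r1 : 0 < 1 - rmax by rewrite subr_gt0 rmax_lt1.
have H : forall n, \sum_(i < n) tmax * rmax ^+ i = tmax / (1 - rmax) * (1 - rmax ^+ n).
  elim=> [|m IH]; first by rewrite big_ord0 expr0 subrr mulr0.
  rewrite big_ord_recr /= IH exprS; field; rewrite gt_eqF //.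
apply: (@le_trans _ _ (\sum_(i < n) tmax * rmax ^+ i)).
  by apply: ler_sum => i _; apply: term_le; exact: dgz_Xinf.
by rewrite H ler_piMr ?diam_ge0 // gerBl exprn_ge0 // rmax_ge0.
Qed.

Definition agree n z z' := forall i, (i < n)%N -> z i = z' i.

Lemma point_close n z z' : agree n z z' -> `|X z - X z'| <= 2 * diam * rmax ^+ n.
Proof.
elim: n z z' => [|n IH] z z' zz'.
  by rewrite expr0 mulr1 (le_trans (ler_normB _ _)) // mulr_natl mulr2n lerD // point_le.
rewrite (point_rec z) (point_rec z') /omz /dgz -(zz' 0%N) // opprD addrACA subrr addr0.
rewrite -mulrBr normrM exprS mulrCA; apply: ler_pM => //; first exact: le_rmax.
by apply: IH => i ni; exact: zz'.
Qed.

Lemma rmax_small (e : R) : 0 < e -> exists n, 2 * diam * rmax ^+ n < e.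
Proof.
move=> e0.
have : (fun n => 2 * diam * rmax ^+ n) @ \oo --> (0 : R).
  rewrite -[0](mulr0 (2 * diam)); apply: cvgM; first exact: cvg_cst.
  by apply: cvg_expr; rewrite ger0_norm ?rmax_ge0 //; exact: rmax_lt1.
move=> /cvgrPdist_lt /(_ _ e0) [N _ /(_ N (leqnn N)) /=].
rewrite sub0r normrN ger0_norm; first by exists N.
by rewrite mulr_ge0 ?exprn_ge0 ?rmax_ge0 // mulr_ge0 // diam_ge0.
Qed.

Lemma measurable_point : measurable_fun setT (X : Z -> R).
Proof.
apply: (measurability (@RGenOpens.G R)); first exact: RGenOpens.measurableE.
move=> _ [_ [a [b ->]] <-]; rewrite setTI.
rewrite -[X in measurable X]setTI; apply: measurable_cyl_open => // z _ Xz.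
have : nbhs (X z) `]a, b[%classic by apply: open_nbhs_nbhs; split => //; exact: interval_open.
move=> /nbhs_ballP[e /= e0 He]; have [n small] := rmax_small e0.
exists n => z' [z'n _]; apply: He => /=; rewrite /ball /=.
apply: le_lt_trans small; apply: point_close => i ni.
by have := f_equal (fun s => nth l0 s i) z'n; rewrite size_mkseq !nth_mkseq.
Qed.

(** Separation is assumed fibre by fibre; uniformity comes from compactness of the code space. Pairs
    whose points get arbitrarily close have, by [konig], a limit pair with a common fibre, distinct
    first letters and the same point, which contradicts [SSC]. *)
Lemma ssc_gap : SSC k r t -> exists2 d : R, 0 < d &
  forall z z', omz z = omz z' -> z 0%N <> z' 0%N -> d <= `|X z - X z'|.
Proof.
move=> ssc; apply: contrapT => H.
have /choice[y yP] n : exists zz : Z * Z, [/\ omz zz.1 = omz zz.2, zz.1 0%N <> zz.2 0%N &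
    `|X zz.1 - X zz.2| < n.+1%:R^-1].
  apply: contrapT => K; apply: H; exists n.+1%:R^-1; first by rewrite invr_gt0.
  move=> z z' e ne; rewrite leNgt; apply/negP => L; apply: K.
  by exists (z, z').
have [l lP] := konig (fun n i => ((y n).1 i, (y n).2 i) : (letter * letter)%type).
pose z : Z := fun i => (l i).1; pose z' : Z := fun i => (l i).2.
have ez m : exists2 n, (m <= n)%N & agree m (y n).1 z /\ agree m (y n).2 z'.
  have [n mn e] := lP m; exists n => //; rewrite /z /z'.
  by split => i im; rewrite -(e i im).
have eom : omz z = omz z'.
  apply/funext => i; have [n _ [a1 a2]] := ez i.+1; have [e _ _] := yP n.
  by rewrite /omz -a1 // -a2 //; move: (congr1 (@^~ i) e).
have ne0 : z 0%N <> z' 0%N.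
  by have [n _ [a1 a2]] := ez 1%N; rewrite -a1 // -a2 //; case: (yP n).
have eX : X z = X z'.
  apply/eqP; rewrite -subr_eq0 -normr_le0 leNgt; apply/negP => e0.
  (* Three errors of at most a third each: the two replacements of the limit codes by approximating
     ones, and the distance between the points of the latter. *)
  have e3 : 0 < `|X z - X z'| / 3 by rewrite divr_gt0.
  have [m1 small] := rmax_small e3.
  pose m := maxn m1 (Num.truncn (3 / `|X z - X z'|)).+1.
  have [n mn [a1 a2]] := ez m; have [_ _ yn] := yP n.
  have sub p a b : agree m a b -> (p <= m)%N -> agree p a b by move=> H' pm i ip; apply: H'; exact: leq_trans pm.
  have c1 := point_close (sub _ _ _ a1 (leq_maxl _ _)).
  have c2 := point_close (sub _ _ _ a2 (leq_maxl _ _)).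
  have yn' : n.+1%:R^-1 <= `|X z - X z'| / 3.
    rewrite -[leRHS]invrK lef_pV2 ?posrE ?invr_gt0 // invf_div ltW //.
    by rewrite (lt_le_trans (truncnS_gt _)) // ler_nat ltnW // ltnS (leq_trans _ mn) // leq_maxr.
  have : `|X z - X z'| <= `|X (y n).1 - X z| + `|X (y n).1 - X (y n).2| + `|X (y n).2 - X z'|.
    rewrite (_ : X z - X z' = - (X (y n).1 - X z) + (X (y n).1 - X (y n).2) + (X (y n).2 - X z')); last by ring.
    by rewrite (le_trans (ler_normD _ _)) // lerD2r (le_trans (ler_normD _ _)) // normrN.
  move: (le_lt_trans c1 small) (le_lt_trans c2 small) (lt_le_trans yn yn').
  by move: (`|X z - X z'|) => x; lra.
have := ssc (omz z) (dgz z 0%N) (dgz z' 0%N) (dgz_Xinf z 0%N).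
have k' : (dgz z' 0 < k (omz z 0))%N by rewrite eom; exact: dgz_Xinf.
move=> /(_ k') H0.
have nd : dgz z 0%N <> dgz z' 0%N.
  by move=> e; apply: ne0; apply: letter_eq => //; exact: (congr1 (@^~ 0%N) eom).
have /seteqP[+ _] := H0 nd; move=> /(_ (X z)); apply; split.
  exists (X (shift z : Z)); last by rewrite /ifs_map -point_rec.
  by exists (shift (dgz z)) => //; exact: (dgz_Xinf (shift z : Z)).
exists (X (shift z' : Z)); last by rewrite /ifs_map eX (point_rec z') eom.
exists (shift (dgz z')); last by rewrite /point_of eom.
by have := dgz_Xinf (shift z' : Z); congr (Xinf _ _ _); rewrite eom.
Qed.

Section Gap.
Variable d : R.
Hypothesis d_gt0 : 0 < d.
Hypothesis gap : forall z z', omz z = omz z' -> z 0%N <> z' 0%N -> d <= `|X z - X z'|.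

(** Common first letters are removed one at a time, each scaling the distance by at least [rmin]; at
    the first disagreement [gap] applies. *)
Lemma point_sep n z z' : omz z = omz z' -> ~ agree n z z' ->
  d * rmin ^+ n <= `|X z - X z'|.
Proof.
have rm1 : rmin <= 1.
  by rewrite (le_trans (rmin_le i0)) // ltW //; case: (r_cond i0).
elim: n z z' => [|n IH] z z' e na; first by case: na.
have [e0|ne0] := pselect (z 0%N = z' 0%N); last first.
  rewrite (le_trans _ (gap e ne0)) // ler_piMr ?(ltW d_gt0) // exprn_ile1 // ltW //.
  exact: rmin_gt0.
rewrite (point_rec z) (point_rec z') /dgz /omz -e0 opprD addrACA subrr addr0.
rewrite -mulrBr normrM exprS mulrCA; apply: ler_pM => //.
- by rewrite ltW // rmin_gt0.
- by rewrite mulr_ge0 ?(ltW d_gt0) // exprn_ge0 // ltW // rmin_gt0.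
- exact: rmin_le.
apply: IH; first by have := congr1 (@shift I) e.
by move=> a; apply: na => -[//|i] ni; exact: a.
Qed.

End Gap.
End Symbolic.

(** * The random code *)

Section Measures.
Context {R : realType} {I : finType} {i0 : I}.
Variables (k : I -> nat) (r : I -> R) (t : I -> nat -> R).
Variables (p : I -> nat -> R) (q : I -> R).
Variable P : probability (SeqSp i0) R.
Variable mu : SeqSp i0 -> probability (SeqSp 0%N) R.
Variable eta : SeqSp i0 -> probability R R.
Hypothesis k_gt0 : forall i, (0 < k i)%N.
Hypothesis r_cond : forall i, r i != 0 /\ `|r i| < 1.
Hypothesis p_gt0 : forall i a, (a < k i)%N -> 0 < p i a.
Hypothesis P_cyl : forall w : seq I,
  P (@cyl I i0 w) = (\prod_(n < size w) q (nth i0 w n))%:E.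
Hypothesis mu_cyl : forall (om : SeqSp i0) (w : seq nat),
  mu om (@cyl nat 0%N w) = (\prod_(n < size w)
    (if (nth 0%N w n < k (om n))%N then p (om n) (nth 0%N w n) else 0))%:E.
Hypothesis eta_push : forall (om : SeqSp i0) (A : set R), measurable A ->
  eta om A = mu om (Pi r t om @^-1` A).

Local Notation lt0 := (l0 (i0 := i0) k_gt0).
Local Notation Z := (SeqSp lt0).
Local Notation X := (@point_of R I i0 k r t k_gt0 : Z -> R).
Local Notation omz := (@omz I i0 k k_gt0).
Local Notation dgz := (@dgz I i0 k k_gt0).
Local Notation mkz := (@mkz I i0 k k_gt0).
Implicit Types (om : SeqSp i0) (z : Z).

Lemma measurable_Xinf om : measurable (Xinf k om : set (SeqSp 0%N)).
Proof.
rewrite (_ : Xinf k om = \bigcap_n [set u : SeqSp 0%N | (u n < k (om n))%N]).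
  by apply: bigcapT_measurable => n; exact: (measurable_coord n [set a | (a < k (om n))%N]).
by apply/seteqP; split => u /= H n; [move=> _; exact: H|exact: (H n Logic.I)].
Qed.

(** [mu om] lives on all sequences of naturals; the product formula gives weight zero to each word
    with an inadmissible digit, and there are countably many words. *)
Lemma mu_digit om n : mu om [set u | ~ (u n < k (om n))%N] = 0%E.
Proof.
pose F (w : seq nat) : set (SeqSp 0%N) :=
  if (size w == n.+1) && ~~ (nth 0%N w n < k (om n))%N then cyl w else set0.
have F0 w : mu om (F w) = 0%E.
  rewrite /F; case: ifP => [/andP[/eqP sw /negbTE nw]|_]; last by rewrite measure0.
  rewrite mu_cyl; have nsw : (n < size w)%N by rewrite sw.
  by rewrite (bigD1 (Ordinal nsw)) //= nw mul0r.
have mF w : measurable (F w).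
  by rewrite /F; case: ifP => _; [exact: measurable_cyl|exact: measurable0].
pose G j := if @unpickle (seq nat) j is Some w then F w else set0.
have : (mu om).-negligible (\bigcup_j G j).
  apply: negligible_bigcup => j; rewrite /G; case: (unpickle j) => [w|].
    by apply/negligibleP; [exact: mF|exact: F0].
  exact: negligible_set0.
have m1 : measurable [set u : SeqSp 0%N | ~ (u n < k (om n))%N].
  exact: (measurable_coord n [set a | ~ (a < k (om n))%N]).
move=> neg; apply/negligibleP => //; apply: negligibleS neg => u /= un.
exists (pickle (mkseq u n.+1)) => //; rewrite /G pickleK /F size_mkseq eqxx nth_mkseq //.
by move/negP: un => ->; exact: cyl_mkseq.
Qed.

Lemma mu_XinfC om : mu om (~` Xinf k om) = 0%E.
Proof.
have mX := measurable_Xinf om.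
apply/negligibleP; first exact: measurableC.
have : (mu om).-negligible (\bigcup_n [set u : SeqSp 0%N | ~ (u n < k (om n))%N]).
  apply: negligible_bigcup => n; exists [set u : SeqSp 0%N | ~ (u n < k (om n))%N]; split => //.
    exact: (measurable_coord n [set a | ~ (a < k (om n))%N]).
  exact: mu_digit.
apply: negligibleS => u /= /existsNP[n un]; by exists n.
Qed.

Lemma mu_eq_Xinf om (A B : set (SeqSp 0%N)) : measurable A -> measurable B ->
  (forall u, Xinf k om u -> A u <-> B u) -> mu om A = mu om B.
Proof.
move=> mA mB AB; have mX := measurable_Xinf om.
have H C : measurable C -> mu om C = mu om (C `&` Xinf k om).
  move=> mC; rewrite (measureDI _ mC mX) [X in (X + _)%E](_ : _ = 0%E) ?add0e //.
  apply/eqP; rewrite -measure_le0 -(mu_XinfC om) le_measure ?inE //.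
  - exact: measurableD.
  - exact: measurableC.
rewrite (H A) // (H B) //; congr (mu om _); apply/seteqP; split => u [? Xu]; split => //;
  by apply/(AB u Xu).
Qed.

Lemma measurable_mkz om : measurable_fun setT (mkz om : SeqSp 0%N -> Z).
Proof.
apply: measurable_fun_seqsp => w.
have := measurable_prefix (t0 := 0%N) (size w)
  [set v | forall n, (n < size w)%N -> mkT k_gt0 (om n) (nth 0%N v n) = nth lt0 w n].
congr (measurable _); apply/seteqP; split => u /=.
  by move=> H; apply/cylP => n nw; rewrite -(H n nw) nth_mkseq.
by move=> /cylP H n nw; rewrite -(H n nw) nth_mkseq.
Qed.

(** Moving [mu om] into [Z] puts the measures of all fibres on one space, where they can be shifted,
    truncated and compared. *)
Definition lam om : {measure set Z -> \bar R} := push (mu om) (measurable_mkz om).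

Lemma lamE om A : lam om A = mu om (mkz om @^-1` A). Proof. by []. Qed.

Lemma lamT om : lam om setT = 1%E.
Proof. by rewrite lamE preimage_setT probability_setT. Qed.

Lemma lam_le1 om A : measurable A -> (lam om A <= 1)%E.
Proof. by move=> mA; rewrite -(lamT om) le_measure ?inE. Qed.

Lemma lam_fin om A : measurable A -> lam om A \is a fin_num.
Proof.
by move=> mA; rewrite ge0_fin_numE ?measure_ge0 // (le_lt_trans (lam_le1 om mA)) // ltry.
Qed.

Definition wt (w : seq (letter k)) : R := \prod_(a <- w) p (tag a) (digit a).

Lemma lam_cyl om w : lam om (cyl w) =
  if map tag w == mkseq om (size w) then (wt w)%:E else 0%E.
Proof.
rewrite lamE; case: eqP => [e|ne]; last first.
  rewrite (_ : _ @^-1` _ = set0) ?measure0 //; apply/seteqP; split => u //= uw.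
  apply: ne; rewrite -[in LHS](uw : mkseq (mkz om u) (size w) = w).
  by rewrite -map_comp.
have omE n : (n < size w)%N -> om n = tag (nth lt0 w n).
  by move=> nw; rewrite -(nth_mkseq i0 om nw) -e (nth_map lt0).
rewrite (@mu_eq_Xinf om _ (cyl (map (@digit I k) w))).
- rewrite mu_cyl size_map /wt (big_nth lt0) big_mkord; congr EFin.
  apply: eq_bigr => n _; rewrite (nth_map lt0) // omE //.
  by rewrite /digit ltn_ord.
- by rewrite -[X in measurable X]setTI; apply: measurable_mkz => //; exact: measurable_cyl.
- exact: measurable_cyl.
- move=> u Xu; split => /cylP H; apply/cylP => n.
    rewrite size_map => nw; rewrite (nth_map lt0) // -H //.
    by rewrite /mkz mkT_digit.
  move=> nw; apply: (letter_eq k_gt0); first by rewrite -omE.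
  by rewrite /mkz mkT_digit // H ?size_map // (nth_map lt0).
Qed.

(** All values of [mkz om] lie over [om], so events need to be compared on that fibre only. *)
Lemma lam_fiber om A B : measurable A -> measurable B ->
  (forall z, omz z = om -> A z <-> B z) -> lam om A = lam om B.
Proof.
move=> mA mB AB; rewrite !lamE; congr (mu om _); apply/seteqP; split => u /=.
  by move/AB; exact.
by move=> Bu; apply/AB.
Qed.

Lemma measurable_lam E : measurable E -> measurable_fun setT (fun om => lam om E).
Proof.
move: E; apply: seqsp_induction => [w|S mS IH|F mF tF IH].
- rewrite (_ : (fun om => _) =
     (fun om => if map tag w == mkseq om (size w) then (wt w)%:E else 0%E)).
    move=> _ Y mY; rewrite setTI.
    exact: (measurable_prefix (size w) [set v | Y (if map tag w == v then (wt w)%:E else 0%E)]).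
  by apply/funext => om; rewrite lam_cyl.
- rewrite (_ : (fun om => _) = (fun om => (1 - lam om S)%E)); first exact: emeasurable_funB.
  by apply/funext => om; exact: (measure1_setC mS (lamT om)).
- rewrite (_ : (fun om => _) = (fun om => (\sum_(n <oo) lam om (F n))%E)).
    by apply: ge0_emeasurable_sum => [n om _ _|n _]; [exact: measure_ge0|exact: IH].
  by apply/funext => om; rewrite measure_bigcup //; apply: eq_eseriesl => n; exact: in_setT.
Qed.

Definition nuZ (E : set Z) : \bar R := (\int[P]_om lam om E)%E.

Let nuZ0 : nuZ set0 = 0%E.
Proof. by rewrite /nuZ; under eq_integral do rewrite measure0; rewrite integral0. Qed.

Let nuZ_ge0 A : (0 <= nuZ A)%E.
Proof. by apply: integral_ge0 => om _; exact: measure_ge0. Qed.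

Let nuZ_sigma : semi_sigma_additive nuZ.
Proof.
move=> F mF tF mUF; rewrite /nuZ.
have -> : (\int[P]_om lam om (\bigcup_n F n) = \sum_(n <oo) \int[P]_om lam om (F n))%E.
  rewrite -integral_nneseries //; last by move=> n; exact: measurable_lam.
  apply: eq_integral => om _; rewrite measure_bigcup //.
  by apply: eq_eseriesl => n; exact: in_setT.
by apply: is_cvg_ereal_nneg_natsum => n _; exact: nuZ_ge0.
Qed.

HB.instance Definition _ := isMeasure.Build _ _ _ nuZ nuZ0 nuZ_ge0 nuZ_sigma.

Let nuZT : nuZ setT = 1%E.
Proof.
rewrite /nuZ; under eq_integral do rewrite lamT.
by rewrite integral_cst // mul1e; exact: probability_setT.
Qed.

HB.instance Definition _ := Measure_isProbability.Build _ _ _ nuZ nuZT.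

Definition nuP : probability Z R := nuZ.

Definition pz (a : letter k) : R := q (tag a) * p (tag a) (digit a).

Lemma nuZ_cyl w : nuZ (cyl w) = (\prod_(a <- w) pz a)%:E.
Proof.
rewrite /nuZ.
rewrite (_ : (fun om => _) = (fun om => (wt w)%:E * (\1_(cyl (t0 := i0) (map tag w)) om)%:E)%E); last first.
  apply/funext => om; rewrite lam_cyl indicE.
  have -> : (om \in cyl (t0 := i0) (map tag w)) = (map tag w == mkseq om (size w)).
    apply/idP/eqP; rewrite inE cylE size_map; first by move=> ->.
    by move=> ->.
  by case: eqP; rewrite ?mule1 ?mule0.
have w0 : 0 <= wt w by apply: prodr_ge0 => a _; rewrite ltW // p_gt0 // ltn_ord.
rewrite ge0_integralZl //; last first.
  by apply/measurable_EFinP; apply: measurable_indic; exact: measurable_cyl.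
rewrite integral_indic //; last exact: measurable_cyl.
transitivity ((wt w)%:E * P (@cyl I i0 (map tag w)))%E; first by rewrite setIT.
rewrite P_cyl size_map -EFinM /wt /pz big_split /= mulrC; congr (_ * _)%:E.
by rewrite [RHS](big_nth lt0) big_mkord; apply: eq_bigr => n _; rewrite (nth_map lt0).
Qed.

Lemma ae_nuZ (A : Z -> Prop) : {ae nuZ, forall z, A z} ->
  {ae P, forall om, {ae lam om, forall z, A z}}.
Proof.
move=> [E [mE E0 AE]].
have mf : measurable_fun setT (fun om => lam om E) by exact: measurable_lam.
have : (\int[P]_om `|lam om E| = 0)%E.
  by rewrite -E0; apply: eq_integral => om _; rewrite gee0_abs // measure_ge0.
move=> /(ae_eq_integral_abs P measurableT mf); apply: filterS => om /(_ Logic.I) omE.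
by exists E; split.
Qed.

(** Self-similarity of the fibre measures: removing the first letter leads from [om] to [shift om],
    at the cost of the weight of that letter. *)
Lemma lam_step om (a : letter k) B : measurable B ->
  lam om ([set z | z 0%N = a] `&` ((@shift _ : Z -> Z) @^-1` B)) =
  ((if tag a == om 0%N then p (tag a) (digit a) else 0)%:E * lam (shift om) B)%E.
Proof.
move=> mB.
have ma : measurable [set z : Z | z 0%N = a] by exact: (measurable_coord 0 [set b | b = a]).
have pa : 0 <= (if tag a == om 0%N then p (tag a) (digit a) else 0).
  by case: eqP => // _; rewrite ltW // p_gt0 // ltn_ord.
pose m1 := push (mrestr (lam om) ma) (measurable_shift (t0 := lt0)).
pose m2 := mscale (NngNum pa) (lam (shift om)).
have -> : lam om ([set z | z 0%N = a] `&` ((@shift _ : Z -> Z) @^-1` B)) = m1 B.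
  by rewrite /m1 /push /pushforward /mrestr setIC.
suff : m1 B = m2 B by [].
apply: seqsp_measure_unique mB => [w|].
  suff : m1 (cyl w) = m2 (cyl w) by [].
  have m1E A : m1 A = lam om ((@shift _ : Z -> Z) @^-1` A `&` [set z : Z | z 0%N = a]) by [].
  have m2E A : m2 A = ((if tag a == om 0%N then p (tag a) (digit a) else 0)%:E * lam (shift om) A)%E by [].
  rewrite m1E m2E lam_cyl.
  have -> : ((@shift _ : Z -> Z) @^-1` cyl w `&` [set z : Z | z 0%N = a]) = cyl (a :: w).
    apply/seteqP; split => z /=.
      by move=> [zw z0]; apply/(cyl_cat [:: a] w); split => //; apply/cylP => -[|//] _.
    by move=> /(cyl_cat [:: a] w)[/cylP/(_ 0%N isT) /= z0 zw].
  rewrite lam_cyl /= /wt big_cons.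
  have -> : mkseq om (size w).+1 = om 0%N :: mkseq (shift om) (size w).
    by rewrite /mkseq /= (iotaDl 1 0) -map_comp.
  rewrite eqseq_cons; case: eqP => _ /=; last by rewrite mul0e.
  by case: eqP; rewrite ?mule0.
suff : (m1 setT < +oo)%E by [].
rewrite /m1 /push /pushforward /mrestr (le_lt_trans (lam_le1 om _)) // ?ltry //.
by rewrite preimage_setT setTI.
Qed.

(** [Pi] is a [limn], which takes a default value where the series diverges, as it may for
    inadmissible digits. Measurability is therefore proved separately on the set of convergence and
    on its complement. *)
Lemma measurable_Pi om : measurable_fun setT (Pi r t om : SeqSp 0%N -> R).
Proof.
pose f n (u : SeqSp 0%N) : R := series (term r t om u) n.
have mf n : measurable_fun setT (f n).
  rewrite /f; under eq_fun do rewrite seriesEord; apply: measurable_sum => j.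
  apply: measurable_funM => //.
  by move=> _ Y mY; rewrite setTI; exact: (measurable_coord j (t (om j) @^-1` Y)).
pose C : set (SeqSp 0%N) := [set u | cvgn (fun n => f n u)].
(* The Cauchy criterion with countably many tolerances, which exhibits the set of convergence as
   measurable. *)
have CE : C = \bigcap_j \bigcup_N \bigcap_(n in [set n | (N <= n)%N])
    [set u | `|f N u - f n u| < j.+1%:R^-1].
  apply/seteqP; split => u /=.
    move=> cu j _; have j2 : 0 < j.+1%:R^-1 / 2 :> R by rewrite divr_gt0 // invr_gt0.
    have [N _ HN] : \forall n \near \oo, `|limn (fun n => f n u) - f n u| < j.+1%:R^-1 / 2.
      by move/cvgrPdist_lt : cu => /(_ _ j2).
    exists N => // n /= Nn.
    rewrite (_ : f N u - f n u = - (limn (fun n => f n u) - f N u) + (limn (fun n => f n u) - f n u)); last by ring.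
    rewrite (le_lt_trans (ler_normD _ _)) // normrN [ltRHS]splitr ltrD //; apply: HN => //=.
  move=> H; apply/cauchy_cvgP; apply: cauchy_exP => e e0.
  have [N _ HN] := H (Num.truncn e^-1) Logic.I.
  exists (f N u); exists N => // n /= Nn; rewrite /ball /=.
  apply: lt_trans (HN n Nn) _.
  by rewrite -[ltRHS]invrK ltf_pV2 ?posrE ?invr_gt0 // truncnS_gt.
have mC : measurable C.
  rewrite CE; apply: bigcapT_measurable => j; apply: bigcupT_measurable => N.
  apply: bigcap_measurable => [|n _]; first by exists N => /=.
  rewrite (_ : mkset _ = (fun u => `|f N u - f n u|) @^-1` `]-oo, j.+1%:R^-1[%classic).
    have mfn : measurable_fun setT (fun u => `|f N u - f n u|).
      by apply: measurableT_comp => //; exact: measurable_funB.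
    by rewrite -[X in measurable X]setTI; apply: mfn.
  by apply/seteqP; split => u /=; rewrite in_itv.
rewrite -(setvU C); apply/measurable_funU => //; first exact: measurableC.
split.
  apply: (eq_measurable_fun (cst (point : R))); last exact: measurable_cst.
  move=> u; rewrite inE => nu; rewrite /Pi.
  by have := dvgP (nu : ~ cvgn (fun n => f n u)) => ->.
apply: (@measurable_fun_cvg _ _ _ C f) => [n|u Cu]; first exact: measurable_funTS.
exact: Cu.
Qed.

Lemma eta_lam om A : measurable A -> eta om A = lam om (X @^-1` A).
Proof.
move=> mA; rewrite eta_push // lamE; apply: mu_eq_Xinf.
- by rewrite -[X in measurable X]setTI; exact: measurable_Pi.
- rewrite -[X in measurable X]setTI; apply: measurable_mkz => //.
  have mX : measurable_fun setT X by exact: measurable_point.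
  by rewrite -[X in measurable X]setTI; apply: mX.
- by move=> u Xu; rewrite /= point_ofE.
Qed.

End Measures.

(** * Sceneries at coded points *)

Section MeasureEquality.
Context {R : realType}.
Local Notation J := (`[(-1)%R, 1%R]%classic : set R).

(* Measures are total set functions whose values on non-measurable sets are arbitrary, so they are compared on measurable sets only *)
Definition meq (m1 m2 : PMT R) := forall A : set R, measurable A -> m1 A = m2 A.

Lemma meq_sym m1 m2 : meq m1 m2 -> meq m2 m1.
Proof. by move=> H A mA; rewrite H. Qed.

Lemma meq_trans m1 m2 m3 : meq m1 m2 -> meq m2 m3 -> meq m1 m3.
Proof. by move=> H H' A mA; rewrite H // H'. Qed.

Lemma meq_wint g m1 m2 : meq m1 m2 -> wint g m1 = wint g m2.
Proof.
by move=> H; rewrite /wint; congr fine; apply: eq_measure_integral => A mA _; rewrite H.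
Qed.

Lemma meq_Pm11 m1 m2 : meq m1 m2 -> Pm11 m1 -> Pm11 m2.
Proof.
move=> H [m1T m1J]; split; first by rewrite -m1T -H.
by rewrite -m1J -H //; apply: measurableC; exact: measurable_itv.
Qed.

Lemma meq_weak_open (U : set (PMT R)) m1 m2 : weak_open U -> meq m1 m2 -> U m1 -> U m2.
Proof.
move=> [UP Uo] H U1; have [m [g [del [d0 [cg sub]]]]] := Uo _ U1; apply: sub.
split; first by apply: meq_Pm11 H _; exact: UP.
by move=> i; rewrite (meq_wint _ H) subrr normr0.
Qed.

Lemma meq_measurable (E : set (PM R)) m1 m2 : measurable E -> meq m1 m2 -> E m1 <-> E m2.
Proof.
move=> mE; suff : forall m1 m2, meq m1 m2 -> E m1 -> E m2.
  by move=> H12 H; split; apply: H12 => //; exact: meq_sym.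
pose C : set (set (PM R)) := [set E | forall m1 m2 : PMT R, meq m1 m2 -> E m1 -> E m2].
have : <<s @weak_open R >> `<=` C; last by apply.
apply: smallest_sub; last by move=> U oU n1 n2; exact: meq_weak_open.
split => [n1 n2 _ []|A CA n1 n2 H|F CF n1 n2 H [i _ Fi]].
- by move=> [_ nA]; split => // A2; apply: nA; apply: CA A2; exact: meq_sym.
- by exists i => //; exact: CF Fi.
Qed.

Lemma meq_weak_continuous (f : PMT R -> R) m1 m2 : weak_continuous f -> Pm11 m1 ->
  meq m1 m2 -> f m1 = f m2.
Proof.
move=> cf P1 H; apply/eqP; rewrite -subr_eq0 -normr_le0 leNgt; apply/negP => e0.
have [m [g [del [d0 [cg sub]]]]] := cf _ P1 _ e0.
have : `|f m2 - f m1| < `|f m1 - f m2|.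
  apply: sub; split; first exact: meq_Pm11 P1.
  by move=> i; rewrite (meq_wint _ H) subrr normr0.
by rewrite distrC ltxx.
Qed.

Lemma weak_continuous_measurable (f : PM R -> R) : weak_continuous f ->
  measurable_fun (Pm11 : set (PM R)) f.
Proof.
move=> cf; apply: (measurability (@RGenOpens.G R)); first exact: RGenOpens.measurableE.
move=> _ [_ [a [b ->]] <-]; apply: sub_sigma_algebra.
split=> [m []//|nu [Pnu fab]].
have [e e0 He] : exists2 e : R, 0 < e & forall y, `|f nu - y| < e -> y \in `]a, b[.
  have : nbhs (f nu) `]a, b[%classic by apply: open_nbhs_nbhs; split => //; exact: interval_open.
  by move=> /nbhs_ballP[e /= e0 He]; exists e => // y ye; apply: He.
have [m [g [del [d0 [cg sub]]]]] := cf _ Pnu _ e0.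
exists m, g, del; split => //; split => // nu' N.
by split; [case: N|apply: He; rewrite distrC; exact: sub].
Qed.

Lemma measurable_Pm11 : measurable (Pm11 : set (PM R)).
Proof.
apply: sub_sigma_algebra; split=> // nu Pnu.
exists 0%N, (fun _ => cst 0), 1; split=> //; split; first by case.
by move=> nu' [].
Qed.

(** [zoom] with a signed scale: for [c < 0] it gives the scenery reflected at [x], so both
    orientations obey one formula. *)
Definition zm (nu : {measure set R -> \bar R}) (x c : R) : PMT R :=
  mscale (normc (nu `[x - `|c|, x + `|c|]%classic))
    (mrestr (pf nu x c) (measurable_m11 (R := R))).

Lemma zmE nu x c A : zm nu x c A =
  ((`|fine (nu `[x - `|c|, x + `|c|]%classic)|^-1)%:E *
   nu (aff x c @^-1` (A `&` J)))%E.
Proof. by []. Qed.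

Lemma aff_itv x c : c != 0 -> aff x c @^-1` J = `[x - `|c|, x + `|c|]%classic.
Proof.
move=> c0; apply/seteqP; split => y; rewrite /aff /= !in_itv /= -!ler_norml -?ler_distlC.
  by rewrite normrM normfV ler_pdivrMr ?normr_gt0 // mul1r distrC.
by rewrite normrM normfV ler_pdivrMr ?normr_gt0 // mul1r distrC.
Qed.

Lemma zoom_zm nu x s : 0 < s -> meq (zoom nu x s) (zm nu x s).
Proof. by move=> s0 A mA; rewrite zmE (gtr0_norm s0). Qed.

Section Positive.
Variables (nu : {measure set R -> \bar R}) (x c : R).
Hypothesis nuT : nu setT = 1%E.
Hypothesis c0 : c != 0.
Let V (e : R) := fine (nu `[x - e, x + e]%classic).
Hypothesis V_gt0 : forall e, 0 < e -> 0 < V e.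

Let mpre A : measurable A -> measurable (aff x c @^-1` A).
Proof. by move=> mA; rewrite -[X in measurable X]setTI; exact: measurable_aff. Qed.

Let nu_fin A : measurable A -> nu A \is a fin_num.
Proof.
move=> mA; rewrite ge0_fin_numE ?measure_ge0 //.
by rewrite (@le_lt_trans _ _ 1%E) ?ltry // -nuT le_measure ?inE.
Qed.

Lemma zm_norm : (`|V `|c| |^-1)%:E = (V `|c|)^-1%:E.
Proof. by rewrite gtr0_norm // V_gt0 // normr_gt0. Qed.

Lemma Pm11_zm : Pm11 (zm nu x c).
Proof.
have V0 : V `|c| != 0 by rewrite gt_eqF // V_gt0 // normr_gt0.
split; rewrite zmE -/(V _) zm_norm.
  rewrite setTI aff_itv // -(fineK (nu_fin (measurable_itv _))) -EFinM mulVf //.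
by rewrite setICl preimage_set0 measure0 mule0.
Qed.

(** Zooming twice multiplies the scales, and the inner normalisation cancels; positivity of the
    masses around [x] makes this legitimate. *)
Lemma Sflow_zm (tt : R) : 0 <= tt -> meq (Sflow tt (zm nu x c)) (zm nu x (c * expR (- tt))).
Proof.
move=> t0 A mA; set s := expR (- tt).
have s0 : 0 < s by exact: expR_gt0.
have s1 : s <= 1 by rewrite /s -expR0 ler_expR oppr_le0.
have cs0 : c * s != 0 by rewrite mulf_neq0 // gt_eqF.
have key B : B `<=` J -> aff x c @^-1` ((aff 0 s @^-1` B) `&` J) = aff x (c * s) @^-1` B.
  move=> BJ; apply/seteqP; split => y /=; rewrite /aff subr0.
    by rewrite invfM mulrA; case.
  rewrite invfM mulrA => yB; split => //.
  have := BJ _ yB; rewrite /= !in_itv /= -!ler_norml normrM normfV (gtr0_norm s0).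
  by rewrite ler_pdivrMr // mul1r => /le_trans; exact.
rewrite [LHS](zoom_zm _ _ s0 mA) zmE (zmE nu x (c * s)).
have N0 : 0 < (V `|c|)^-1 by rewrite invr_gt0 V_gt0 // normr_gt0.
have -> : `[0 - `|s|, 0 + `|s|]%classic = aff 0 s @^-1` J by rewrite aff_itv // gt_eqF.
rewrite !zmE -!/(V _) zm_norm.
rewrite key // key; last by move=> y [].
have mB : measurable (aff x (c * s) @^-1` (A `&` J)).
  rewrite -[X in measurable X]setTI; apply: measurable_aff => //.
  by apply: measurableI => //; exact: measurable_itv.
rewrite aff_itv // -(fineK (nu_fin mB)) -(fineK (nu_fin (measurable_itv _))) -!EFinM /= -/(V _).
have a0 : 0 < V `|c| by rewrite V_gt0 // normr_gt0.
have b0 : 0 < V `|c * s| by rewrite V_gt0 // normr_gt0.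
rewrite normrM (gtr0_norm N0) (gtr0_norm b0); congr EFin.
by field; rewrite !gt_eqF.
Qed.

Lemma Msq_zm : Msq (zm nu x c : PM R).
Proof.
split; first exact: Pm11_zm.
move=> e e0; rewrite zmE -/(V _) zm_norm.
have N0 : 0 < (V `|c|)^-1 by rewrite invr_gt0 V_gt0 // normr_gt0.
apply: mule_gt0; first by rewrite lte_fin.
pose e' := Num.min 1 (e / 2) * `|c|.
have m0 : 0 < Num.min 1 (e / 2) by rewrite lt_min ltr01 divr_gt0.
have e'0 : 0 < e' by rewrite mulr_gt0 // normr_gt0.
apply: (@lt_le_trans _ _ (nu `[x - e', x + e']%classic)).
  by rewrite -(fineK (nu_fin (measurable_itv _))) lte_fin; exact: V_gt0.
apply: le_measure; rewrite ?inE //.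
  by apply: mpre; apply: measurableI; exact: measurable_itv.
move=> y; rewrite /= in_itv /= -ler_distlC /e' -ler_pdivrMr ?normr_gt0 // => h.
rewrite /aff !in_itv /= -ler_norml -ltr_norml normrM normfV distrC.
move: h; rewrite le_min => /andP[h1 h2]; split => //.
by rewrite (le_lt_trans h2) // ltr_pdivrMr // ltr_pMr // ltr1n.
Qed.

End Positive.
End MeasureEquality.

Lemma Rintegral_mscale d (T : measurableType d) (R : realType)
    (m : {measure set T -> \bar R}) (c : {nonneg R}) (D : set T) (f : T -> R) (B : R) :
  measurable D -> (m D < +oo)%E -> measurable_fun D f -> (forall x, D x -> `|f x| <= B) ->
  Rintegral (mscale c m) D f = c%:num * Rintegral m D f.
Proof.
move=> mD fin mf fB.
have fin' : (mscale c m D < +oo)%E.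
  by rewrite /mscale /= lte_mul_pinfty // lee_fin.
have key : Rintegral (mscale c m) D (fun x => f x + B) = c%:num * Rintegral m D (fun x => f x + B).
  rewrite /Rintegral ge0_integral_mscale //.
  - rewrite fineM //.
    apply: integrable_fin_num => //; apply: (le_bounded_integrable (B := B + B)) => //.
      exact: measurable_funD.
    move=> x Dx; have b0 : 0 <= B by exact: le_trans (fB _ Dx).
    by rewrite (le_trans (ler_normD _ _)) // (ger0_norm b0) lerD2r fB.
  - by apply/measurable_EFinP; exact: measurable_funD.
  - by move=> x Dx; rewrite lee_fin -lerBlDr sub0r; have := fB _ Dx; rewrite ler_norml => /andP[].
have I1 (m' : {measure set T -> \bar R}) : (m' D < +oo)%E -> m'.-integrable D (EFin \o f).
  by move=> f'; apply: (le_bounded_integrable (B := B)).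
have I2 (m' : {measure set T -> \bar R}) : (m' D < +oo)%E -> m'.-integrable D (EFin \o cst B).
  by move=> f'; apply: (le_bounded_integrable (B := `|B|)).
move: key; rewrite (RintegralD mD (I1 _ fin') (I2 _ fin')) (RintegralD mD (I1 _ fin) (I2 _ fin)).
rewrite !Rintegral_cst // /mscale /= fineM //; last by rewrite ge0_fin_numE.
by rewrite mulrDr mulrCA => /addIr.
Qed.

(** * Sceneries in code coordinates and comparison of fibres *)

Section Scaling.
Context {R : realType} {I : finType} {i0 : I}.
Variables (k : I -> nat) (r : I -> R) (t : I -> nat -> R).
Variables (p : I -> nat -> R) (q : I -> R).
Variable P : probability (SeqSp i0) R.
Variable mu : SeqSp i0 -> probability (SeqSp 0%N) R.
Variable eta : SeqSp i0 -> probability R R.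
Hypothesis k_gt0 : forall i, (0 < k i)%N.
Hypothesis r_cond : forall i, r i != 0 /\ `|r i| < 1.
Hypothesis p_gt0 : forall i a, (a < k i)%N -> 0 < p i a.
Hypothesis P_cyl : forall w : seq I,
  P (@cyl I i0 w) = (\prod_(n < size w) q (nth i0 w n))%:E.
Hypothesis mu_cyl : forall (om : SeqSp i0) (w : seq nat),
  mu om (@cyl nat 0%N w) = (\prod_(n < size w)
    (if (nth 0%N w n < k (om n))%N then p (om n) (nth 0%N w n) else 0))%:E.
Hypothesis eta_push : forall (om : SeqSp i0) (A : set R), measurable A ->
  eta om A = mu om (Pi r t om @^-1` A).

Local Notation lt0 := (l0 (i0 := i0) k_gt0).
Local Notation Z := (SeqSp lt0).
Local Notation X := (@point_of R I i0 k r t k_gt0 : Z -> R).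
Local Notation omz := (@omz I i0 k k_gt0).
Local Notation dgz := (@dgz I i0 k k_gt0).
Local Notation mkz := (@mkz I i0 k k_gt0).

Local Notation lam := (lam mu k_gt0).
Local Notation nuZ := (nuZ P mu k_gt0).
Local Notation J := (`[(-1)%R, 1%R]%classic : set R).
Local Notation wt := (@wt R I k p).
Implicit Types (om : SeqSp i0) (z : Z) (g : R -> R).

Let mX : measurable_fun setT X. Proof. exact: measurable_point. Qed.
Let lam_cyl := lam_cyl k_gt0 mu_cyl.
Let lam_le1 := @lam_le1 R I i0 k mu k_gt0.
Let lam_fin := @lam_fin R I i0 k mu k_gt0.
Let lamT := @lamT R I i0 k mu k_gt0.
Let eta_lam := eta_lam k_gt0 r_cond mu_cyl eta_push.

Definition scn z c : PMT R := zm (eta (omz z)) (X z) c.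
Definition mass z (e : R) : R := fine (eta (omz z) `[X z - e, X z + e]%classic).
Let Y z c (z' : Z) : R := aff (X z) c (X z').
(** Unnormalised integral of [g] over the window of radius [|c|], written in code space; for [g = 1]
    it is the mass of the window. The cut-off outside [-1,1] creates the discontinuity that atoms
    could charge. *)
Definition Jf g z c : R := Rintegral (lam (omz z)) setT (fun z' => (g \_ J) (Y z c z')).

Lemma wt_gt0 (w : seq (letter k)) : 0 < wt w.
Proof. by apply: prodr_gt0 => a _; apply: p_gt0; exact: ltn_ord. Qed.

Lemma lam_cyl_gt0 z n : (0 < lam (omz z) (cyl (mkseq z n)))%E.
Proof.
rewrite lam_cyl size_mkseq; case: eqP => [_|]; first by rewrite lte_fin wt_gt0.
by rewrite -map_comp.
Qed.

Let mcl (a b : R) : measurable (`[a, b]%classic : set R). Proof. exact: measurable_itv. Qed.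

Let meta_pre A : measurable A -> measurable (X @^-1` A).
Proof. by move=> mA; rewrite -[X in measurable X]setTI; exact: mX. Qed.

Lemma mass_gt0 z e : 0 < e -> 0 < mass z e.
Proof.
move=> e0; have [n small] : exists n, 2 * diam k r t * rmax r ^+ n < e by exact: rmax_small.
rewrite -lte_fin /mass eta_lam // fineK; last by apply: lam_fin; exact: meta_pre.
apply: (lt_le_trans (lam_cyl_gt0 z n)); apply: le_measure; rewrite ?inE.
- exact: measurable_cyl.
- exact: meta_pre.
move=> z' zz'; rewrite /= in_itv /= -ler_distlC.
apply: le_trans (ltW small); apply: point_close => // i ni.
by have := f_equal (fun s => nth lt0 s i) zz'; rewrite size_mkseq !nth_mkseq.
Qed.

Let etaT om : eta om setT = 1%E. Proof. exact: probability_setT. Qed.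

Lemma Pm11_scn z c : c != 0 -> Pm11 (scn z c).
Proof. by move=> c0; exact: (Pm11_zm (etaT _) c0 (@mass_gt0 z)). Qed.

Lemma Msq_scn z c : c != 0 -> Msq (scn z c : PM R).
Proof. by move=> c0; exact: (Msq_zm (etaT _) c0 (@mass_gt0 z)). Qed.

Lemma Sflow_scn z c tt : c != 0 -> 0 <= tt ->
  meq (Sflow tt (scn z c)) (scn z (c * expR (- tt))).
Proof. by move=> c0 t0; exact: (Sflow_zm (etaT _) c0 (@mass_gt0 z)). Qed.

Lemma measurable_Y z c : measurable_fun setT (Y z c).
Proof. exact: (measurableT_comp (measurable_aff (X z) c) mX). Qed.

Lemma Jf1 z c : c != 0 -> Jf (cst 1) z c = mass z `|c|.
Proof.
move=> c0; rewrite /Jf /mass eta_lam // -aff_itv //.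
have mA : measurable (X @^-1` (aff (X z) c @^-1` J)).
  by apply: meta_pre; rewrite aff_itv.
rewrite -[in RHS](setIT (X @^-1` _)) -integral_indic // /Rintegral; congr fine.
apply: eq_integral => z' _; congr EFin; rewrite patchE indicE.
by rewrite [z' \in _](_ : _ = (Y z c z' \in J)) //; case: (_ \in J).
Qed.

Lemma wint_scn g z c : c != 0 -> cont11 g -> wint g (scn z c) = (mass z `|c|)^-1 * Jf g z c.
Proof.
move=> c0 cg; have [B B0 gB] := cont11_bounded cg.
have mg := cont11_measurable cg.
have M0 : 0 < mass z `|c| by rewrite mass_gt0 // normr_gt0.
have mJ : measurable J by exact: measurable_itv.
pose m := push (lam (omz z)) (measurable_Y z c).
have k0 : 0 <= (mass z `|c|)^-1 by rewrite invr_ge0 ltW.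
have mg' : measurable_fun setT (g \_ J) by apply/(measurable_restrictT _ mJ).
have mT A : measurable A -> (m A < +oo)%E.
  move=> mA; rewrite (le_lt_trans (lam_le1 _ _)) ?ltry //.
  by rewrite -[X in measurable X]setTI; exact: measurable_Y.
have -> : wint g (scn z c) = Rintegral (mscale (NngNum k0) (mrestr m mJ)) J g.
  rewrite /wint /Rintegral; congr fine; apply: eq_measure_integral => A mA _.
  transitivity ((mass z `|c|)^-1%:E * eta (omz z) (aff (X z) c @^-1` (A `&` J)))%E.
    by rewrite /scn zmE -/(mass _ _) gtr0_norm.
  by rewrite eta_lam // -[X in measurable X]setTI; apply: measurable_aff => //; exact: measurableI.
rewrite (@Rintegral_mscale _ _ _ (mrestr m mJ) (NngNum k0) J g B mJ) //=; last by rewrite /mrestr setIid mT.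
congr (_ * _).
have -> : Rintegral (mrestr m mJ) J g = Rintegral m J g.
  rewrite /Rintegral; congr fine; apply: eq_measure_integral => A mA AJ.
  by rewrite /= /mrestr (setIidl AJ).
rewrite Rintegral_mkcond /Jf /Rintegral /m integral_push //.
  exact/measurable_EFinP.
apply: (le_bounded_integrable (B := B)) => //.
- by rewrite lamT ltry.
- by apply: measurableT_comp => //; exact: measurable_Y.
- move=> z' _; rewrite /= patchE; case: ifPn => [/set_mem/gB//|_].
  by rewrite normr0 ltW.
Qed.

Section Truncation.
Variable m : nat.
(** A function of the truncated code has the same integral for two fibres that agree up to [m]; this
    is how integrals over different fibres are compared. *)
Definition trunc (z : Z) : Z := fun n => if (n < m)%N then z n else lt0.

Lemma trunc_cyl w : trunc @^-1` cyl w =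
  if [forall n : 'I_(size w), (m <= n)%N ==> (nth lt0 w n == lt0)] then cyl (take m w) else set0 :> set Z.
Proof.
case: ifPn => [/forallP H|/forallPn[n]].
  apply/seteqP; split => z /=.
    move=> /cylP zw; apply/cylP => n; rewrite size_take_min leq_min => /andP[nm nw].
    by rewrite nth_take // -zw // /trunc nm.
  move=> /cylP zw; apply/cylP => n nw; rewrite /trunc; case: ltnP => nm.
    by rewrite zw ?nth_take // size_take_min leq_min nm nw.
  by have /implyP/(_ nm)/eqP -> := H (Ordinal nw).
rewrite negb_imply => /andP[mn /eqP nn]; apply/seteqP; split => z //= /cylP /(_ n (ltn_ord n)).
by rewrite /trunc ltnNge mn /= => e; case: nn.
Qed.

Lemma measurable_trunc : measurable_fun setT (trunc : Z -> Z).
Proof.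
apply: measurable_fun_seqsp => w; rewrite trunc_cyl; case: ifP => _ //.
exact: measurable_cyl.
Qed.

Lemma lam_trunc om om' A : (forall n, (n < m)%N -> om n = om' n) -> measurable A ->
  lam om (trunc @^-1` A) = lam om' (trunc @^-1` A).
Proof.
move=> e mA.
pose m1 := push (lam om) measurable_trunc; pose m2 := push (lam om') measurable_trunc.
suff : m1 A = m2 A by [].
apply: seqsp_measure_unique mA => [w|]; last first.
  suff : (lam om (trunc @^-1` setT) < +oo)%E by [].
  by rewrite preimage_setT lamT ltry.
suff : lam om (trunc @^-1` cyl w) = lam om' (trunc @^-1` cyl w) by [].
rewrite trunc_cyl; case: ifP => _; last by rewrite !measure0.
rewrite !lam_cyl; have -> // : mkseq om (size (take m w)) = mkseq om' (size (take m w)).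
apply: (@eq_from_nth _ i0) => [|n]; rewrite !size_mkseq // => nw; rewrite !nth_mkseq // e //.
by move: nw; rewrite size_take_min leq_min => /andP[].
Qed.

Lemma lam_trunc_integral om om' (f : Z -> R) B : (forall n, (n < m)%N -> om n = om' n) ->
  measurable_fun setT f -> (forall z, `|f z| <= B) ->
  Rintegral (lam om) setT (f \o trunc) = Rintegral (lam om') setT (f \o trunc).
Proof.
move=> e mf fB.
have H o : Rintegral (lam o) setT (f \o trunc) = Rintegral (push (lam o) measurable_trunc) setT f.
  have mE : measurable_fun setT (EFin \o f) by exact/measurable_EFinP.
  have I1 : (lam o).-integrable setT (EFin \o (f \o trunc)).
    apply: (le_bounded_integrable (B := B)) => //; first by rewrite lamT ltry.
      exact: (measurableT_comp mf measurable_trunc).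
    by move=> x _; exact: fB.
  by rewrite /Rintegral (integral_push measurable_trunc mE I1).
rewrite !H /Rintegral; congr fine; apply: eq_measure_integral => A mA _.
exact: lam_trunc.
Qed.

End Truncation.

(** Where both positions lie in [-1,1] the modulus of [g] applies, and where neither does both
    values vanish. Otherwise the truncated position is within [kap] of the boundary, and the mass of
    this layer enters multiplied by the bound of [g]. *)
Lemma Jf_trunc m g z c z' c' (e kap C B : R) :
  cont11 g -> c != 0 -> 0 <= C -> 0 <= kap -> 0 <= e -> (forall y, J y -> `|g y| <= B) -> 0 <= B ->
  (forall x y, J x -> J y -> `|g x - g y| <= e + C * `|x - y|) ->
  (forall z'', `|Y z' c' z'' - Y z c (trunc m z'')| <= kap) ->
  `|Jf g z' c' - Rintegral (lam (omz z')) setT ((fun z'' => (g \_ J) (Y z c z'')) \o trunc m)| <=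
  e + C * kap + B * fine (lam (omz z') (trunc m @^-1` [set z'' | `| `|Y z c z''| - 1| <= kap])).
Proof.
move=> cg c0 C0 kap0 e0 gB B0 modu close.
have mJ : measurable J by exact: measurable_itv.
have mg' : measurable_fun setT (g \_ J) by apply/(measurable_restrictT _ mJ); exact: cont11_measurable.
have gJB y : `|(g \_ J) y| <= B.
  by rewrite patchE; case: ifPn => [/set_mem/gB//|_]; rewrite normr0.
pose f1 z'' := (g \_ J) (Y z' c' z''); pose f2 := (fun z'' => (g \_ J) (Y z c z'')) \o trunc m.
have mf1 : measurable_fun setT f1 by apply: measurableT_comp => //; exact: measurable_Y.
have mf2 : measurable_fun setT f2.
  apply: (measurableT_comp (f := fun z'' => (g \_ J) (Y z c z''))); last exact: measurable_trunc.
  by apply: measurableT_comp => //; exact: measurable_Y.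
pose S : set Z := trunc m @^-1` [set z'' | `| `|Y z c z''| - 1| <= kap].
have mS : measurable S.
  rewrite -[X in measurable X]setTI; apply: measurable_trunc => //.
  rewrite (_ : mkset _ = (fun z'' => `| `|Y z c z''| - 1|) @^-1` `]-oo, kap]%classic); last first.
    by apply/seteqP; split => y /=; rewrite in_itv.
  have mh : measurable_fun setT (fun z'' => `| `|Y z c z''| - 1|).
    apply: measurableT_comp => //; apply: measurable_funB => //.
    by apply: measurableT_comp => //; exact: measurable_Y.
  by rewrite -[X in measurable X]setTI; apply: mh => //; exact: measurable_itv.
have pw z'' : `|f1 z'' - f2 z''| <= (e + C * kap) + B * \1_S z''.
  have eC : 0 <= e + C * kap by rewrite addr_ge0 // mulr_ge0.
  rewrite /f1 /f2 /= !patchE.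
  have cl := close z''.
  have inS (b : bool) : (`|Y z' c' z''| <= 1) = b -> (`|Y z c (trunc m z'')| <= 1) = ~~ b -> \1_S z'' = 1 :> R.
    move=> h1 h2; rewrite indicE mem_set // /S /=.
    have := ler_dist_dist (Y z' c' z'') (Y z c (trunc m z'')).
    move: cl h1 h2; move: (`|Y z' c' z'' - _|) => D.
    move: (`|Y z' c' z''|) (`|Y z c (trunc m z'')|) => u v Dk.
    case: b => h1 h2; rewrite ler_norml => /andP[? ?]; rewrite ler_norml; move: h1 h2.
      by move=> u1 /negbT; rewrite -ltNge => v1; apply/andP; split; lra.
    by move=> /negbT; rewrite -ltNge => u1 v1; apply/andP; split; lra.
  have memJ y : (y \in J) = (`|y| <= 1).
    by apply/idP/idP; rewrite inE /= in_itv /= -ler_norml.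
  rewrite !memJ; case: (boolP (`|Y z' c' z''| <= 1)) => h1; case: (boolP (`|Y z c (trunc m z'')| <= 1)) => h2.
  - apply: (le_trans (modu _ _ _ _)); [by rewrite /= in_itv /= -ler_norml|by rewrite /= in_itv /= -ler_norml|].
    by rewrite -addrA lerD2l (le_trans (ler_wpM2l C0 cl)) // lerDl mulr_ge0 // indicE ler0n.
  - rewrite (_ : point = 0 :> R) // subr0 (inS true h1 (negbTE h2)) mulr1 (le_trans (gB _ _)) ?lerDr //.
    by rewrite /= in_itv /= -ler_norml.
  - rewrite (_ : point = 0 :> R) // sub0r normrN (inS false (negbTE h1) h2) mulr1 (le_trans (gB _ _)) ?lerDr //.
    by rewrite /= in_itv /= -ler_norml.
  - by rewrite subrr normr0 addr_ge0 // mulr_ge0 // indicE ler0n.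
have bI (f : Z -> R) b : measurable_fun setT f -> (forall x, `|f x| <= b) ->
    (lam (omz z')).-integrable setT (EFin \o f).
  by move=> mf fb; apply: (le_bounded_integrable (B := b)) => //; rewrite lamT ltry.
have If1 := bI _ _ mf1 (fun x => gJB _); have If2 := bI _ _ mf2 (fun x => gJB _).
rewrite -[Jf _ _ _]/(Rintegral (lam (omz z')) setT f1) -/f2 -RintegralB //.
have mf12 : measurable_fun setT (fun x => f1 x - f2 x) by exact: measurable_funB.
have f12b x : `|f1 x - f2 x| <= B + B.
  by rewrite (le_trans (ler_normB _ _)) // lerD // gJB.
have I12 := bI _ _ mf12 f12b.
rewrite (le_trans (le_normr_Rintegral _ I12)) //.
have mR : measurable_fun setT (fun x : Z => B * \1_S x : R).
  by apply: measurable_funM => //; exact: measurable_indic.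
have Rb x : `|B * \1_S x| <= B.
  by rewrite normrM (ger0_norm B0) ler_piMr // indicE; case: (_ \in _); rewrite ?normr1 ?normr0.
apply: (@le_trans _ _ (Rintegral (lam (omz z')) setT (fun x => (e + C * kap) + B * \1_S x))).
  apply: le_Rintegral => //.
  - by apply: (bI (fun x => `|f1 x - f2 x|) (B + B)) => [|x]; [exact: measurableT_comp|rewrite normr_id].
  - apply: (bI _ (`|e + C * kap| + B)) => [|x]; first exact: measurable_funD.
    by rewrite (le_trans (ler_normD _ _)) // lerD2l.
rewrite RintegralD //; last 2 first.
- by apply: (bI (cst _) `|e + C * kap|).
- exact: (bI _ B).
rewrite Rintegral_cst // RintegralZl //; last first.
  by apply: (bI _ 1) => [|x]; [exact: measurable_indic|rewrite indicE; case: (_ \in _); rewrite ?normr1 ?normr0].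
have -> : fine (lam (omz z') setT) = 1 by rewrite lamT.
by rewrite mulr1 lerD2l ler_wpM2l // /Rintegral integral_indic // setIT.
Qed.

End Scaling.

Lemma negligible_bigcup_count d (T : measurableType d) (R : realType)
    (m : {measure set T -> \bar R}) (U : countType) (F : U -> set T) :
  (forall i, m.-negligible (F i)) -> m.-negligible (\bigcup_i F i).
Proof.
move=> H; pose G j := if @unpickle U j is Some i then F i else set0.
have : m.-negligible (\bigcup_j G j).
  apply: negligible_bigcup => j; rewrite /G; case: (unpickle j) => [i|]; first exact: H.
  exact: negligible_set0.
apply: negligibleS => x [i _ Fx]; exists (pickle i) => //.
by rewrite /G pickleK.
Qed.

Lemma div_close (R : realFieldType) (a b a' b' tau eps : R) : 0 < b ->
  `|a' - a| <= tau -> `|b' - b| <= tau -> tau <= b / 2 ->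
  2 * tau * (b + `|a|) < eps * (b * b) -> `|b'^-1 * a' - b^-1 * a| < eps.
Proof.
move=> b0 ha hb t2 small.
have b'0 : b / 2 <= b'.
  by move: hb; rewrite ler_norml => /andP[h _]; lra.
have b'p : 0 < b' by rewrite (lt_le_trans _ b'0) // divr_gt0.
have -> : b'^-1 * a' - b^-1 * a = ((a' - a) * b - a * (b' - b)) / (b * b').
  by field; rewrite !gt_eqF.
rewrite normrM normfV (@gtr0_norm _ (b * b')) ?mulr_gt0 // ltr_pdivrMr ?mulr_gt0 //.
have e0 : 0 < eps.
  rewrite -(pmulr_lgt0 _ (mulr_gt0 b0 b0)) (le_lt_trans _ small) // mulr_ge0 //.
    by rewrite mulr_ge0 // (le_trans _ ha).
  by rewrite addr_ge0 // ltW.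
have h1 : `|(a' - a) * b - a * (b' - b)| <= tau * (b + `|a|).
  rewrite (le_trans (ler_normB _ _)) // !normrM (gtr0_norm b0) mulrDr lerD ?ler_wpM2r ?(ltW b0) //.
  by rewrite mulrC ler_wpM2r.
rewrite (le_lt_trans h1) //.
apply: (@lt_le_trans _ _ (eps * (b * b) / 2)); first by rewrite ltr_pdivlMr // (_ : _ * 2 = 2 * tau * (b + `|a|)) //; ring.
by rewrite -mulrA ler_pM2l // -mulrA ler_pM2l.
Qed.

Lemma dist1_close (R : realFieldType) (u v a : R) :
  `|u - v| <= a -> `|v - 1| <= a -> `|u - 1| <= 2 * a.
Proof.
by rewrite !ler_norml => /andP[? ?] /andP[? ?]; apply/andP; split; lra.
Qed.

Lemma eight_parts (R : realFieldType) (x y e a b : R) : 0 < e ->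
  x <= e / 8 + a + b -> y <= e / 8 + a + b -> b <= e / 8 -> a <= e / 8 -> x + y <= e.
Proof. by lra. Qed.

Lemma div_close_tolerance (R : realFieldType) (b A eps : R) : 0 < b -> 0 <= A -> 0 < eps ->
  exists tau : R, [/\ 0 < tau, tau <= b / 2 & 2 * tau * (b + A) < eps * (b * b)].
Proof.
move=> b0 A0 e0; have ba : 0 < b + A by rewrite ltr_pwDl.
have bb : 0 < eps * (b * b) by rewrite !mulr_gt0.
exists (Num.min (b / 2) (eps * (b * b) / (4 * (b + A)))); split.
- by rewrite lt_min !divr_gt0 ?mulr_gt0.
- by rewrite ge_min lexx.
have : Num.min (b / 2) (eps * (b * b) / (4 * (b + A))) <= eps * (b * b) / (4 * (b + A)).
  by rewrite ge_min lexx orbT.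
move: (Num.min _ _) => tau; rewrite ler_pdivlMr ?mulr_gt0 //.
by move: (eps * (b * b)) bb => w w0; lra.
Qed.

(** * Continuity in code and scale, and self-similarity of sceneries *)

Section Continuity.
Context {R : realType} {I : finType} {i0 : I}.
Variables (k : I -> nat) (r : I -> R) (t : I -> nat -> R).
Variables (p : I -> nat -> R) (q : I -> R).
Variable P : probability (SeqSp i0) R.
Variable mu : SeqSp i0 -> probability (SeqSp 0%N) R.
Variable eta : SeqSp i0 -> probability R R.
Hypothesis k_gt0 : forall i, (0 < k i)%N.
Hypothesis r_cond : forall i, r i != 0 /\ `|r i| < 1.
Hypothesis p_gt0 : forall i a, (a < k i)%N -> 0 < p i a.
Hypothesis P_cyl : forall w : seq I,
  P (@cyl I i0 w) = (\prod_(n < size w) q (nth i0 w n))%:E.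
Hypothesis mu_cyl : forall (om : SeqSp i0) (w : seq nat),
  mu om (@cyl nat 0%N w) = (\prod_(n < size w)
    (if (nth 0%N w n < k (om n))%N then p (om n) (nth 0%N w n) else 0))%:E.
Hypothesis eta_push : forall (om : SeqSp i0) (A : set R), measurable A ->
  eta om A = mu om (Pi r t om @^-1` A).

Local Notation lt0 := (l0 (i0 := i0) k_gt0).
Local Notation Z := (SeqSp lt0).
Local Notation X := (@point_of R I i0 k r t k_gt0 : Z -> R).
Local Notation omz := (@omz I i0 k k_gt0).
Local Notation dgz := (@dgz I i0 k k_gt0).
Local Notation mkz := (@mkz I i0 k k_gt0).

Local Notation lam := (lam mu k_gt0).
Local Notation nuZ := (nuZ P mu k_gt0).
Local Notation J := (`[(-1)%R, 1%R]%classic : set R).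
Local Notation wt := (@wt R I k p).
Implicit Types (om : SeqSp i0) (z : Z) (g : R -> R).

Let mX : measurable_fun setT X. Proof. exact: measurable_point. Qed.
Let lam_cyl := lam_cyl k_gt0 mu_cyl.
Let lam_le1 := @lam_le1 R I i0 k mu k_gt0.
Let lam_fin := @lam_fin R I i0 k mu k_gt0.
Let lamT := @lamT R I i0 k mu k_gt0.
Let eta_lam := eta_lam k_gt0 r_cond mu_cyl eta_push.
Local Notation scn := (scn r t eta (k_gt0 := k_gt0)).
Local Notation mass := (mass r t eta (k_gt0 := k_gt0)).
Local Notation Jf := (Jf r t mu (k_gt0 := k_gt0)).
Local Notation trunc := (trunc (k_gt0 := k_gt0)).
Local Notation D := (diam k r t).

Let mcl (a b : R) : measurable (`[a, b]%classic : set R). Proof. exact: measurable_itv. Qed.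

Let meta_pre A : measurable A -> measurable (X @^-1` A).
Proof. by move=> mA; rewrite -[X in measurable X]setTI; exact: mX. Qed.

(** The layers shrink to the two points where [aff] equals 1 or -1, which are null since the fibre
    has no atoms. The factor 2 leaves room for the displacement caused by truncation. *)
Lemma boundary_small z c (tau : R) : c != 0 -> 0 < tau ->
  (forall x, eta (omz z) [set x] = 0%E) ->
  exists2 N : nat, True & forall n, (N <= n)%N ->
    fine (lam (omz z) [set z' | `| `|aff (X z) c (X z')| - 1| <= 2 * n.+1%:R^-1]) < tau.
Proof.
move=> c0 t0 na.
pose S n : set R := [set y | `| `|aff (X z) c y| - 1| <= 2 * n.+1%:R^-1].
have mS n : measurable (S n).
  rewrite (_ : S n = (fun y => `| `|aff (X z) c y| - 1|) @^-1` `]-oo, 2 * n.+1%:R^-1]%classic); last first.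
    by apply/seteqP; split => y /=; rewrite in_itv.
  have mh : measurable_fun setT (fun y : R => `| `|aff (X z) c y| - 1|).
    apply: measurableT_comp => //; apply: measurable_funB => //.
    by apply: measurableT_comp => //; exact: measurable_aff.
  by rewrite -[X in measurable X]setTI; apply: mh => //; exact: measurable_itv.
have capS : \bigcap_n S n `<=` [set X z + c] `|` [set X z - c].
  move=> y Sy; have : `|aff (X z) c y| = 1.
    apply/eqP; rewrite -subr_eq0 -normr_le0 leNgt; apply/negP => e0.
    have := Sy (Num.truncn (2 / `| `|aff (X z) c y| - 1|)) Logic.I; rewrite /S /= leNgt => /negP; apply.
    by rewrite ltr_pdivrMr ?ltr0n // mulrC -ltr_pdivrMr // truncnS_gt.
  rewrite /aff => /eqP; rewrite eqr_norml ler01 andbT => /orP[] /eqP h; [left|right].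
    by rewrite /= -[y](subrK (X z)) -[y - X z](divfK c0) h mul1r addrC.
  by rewrite /= -[y](subrK (X z)) -[y - X z](divfK c0) h mulN1r addrC.
have cap0 : eta (omz z) (\bigcap_n S n) = 0%E.
  apply: (@subset_measure0 _ _ _ (eta (omz z)) _ ([set X z + c] `|` [set X z - c])) => //.
  - exact: bigcapT_measurable.
  - by apply: measurableU; exact: measurable_set1.
  - apply/eqP; rewrite -measure_le0 -[leRHS](adde0 0%E) -{1}(na (X z + c)) -(na (X z - c)).
    by apply: measureU2; exact: measurable_set1.
have : eta (omz z) (S n) @[n --> \oo] --> eta (omz z) (\bigcap_n S n).
  apply: nonincreasing_cvg_mu => //.
  - by rewrite (le_lt_trans (probability_le1 _ _)) // ltry.
  - exact: bigcapT_measurable.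
  - move=> m n mn; apply/subsetPset => y; rewrite /S /= => /le_trans; apply.
    by rewrite ler_pM2l // lef_pV2 ?posrE // ler_nat.
rewrite cap0 => /fine_cvgP[_ /cvgrPdist_lt /(_ _ t0)] [N _ HN]; exists N => // n Nn.
have := HN n Nn; rewrite /= sub0r normrN ger0_norm ?fine_ge0 //.
by rewrite eta_lam.
Qed.

(** The integrals at [(z', c')] and at [(z, c)] are both compared with that of the truncated
    function at [(z, c)], which is the same on the two fibres. Each comparison costs [eps / 8] from
    the modulus, [C * kap], and [B] times the mass of the boundary layer; the last two are made at
    most [eps / 8]. *)
Lemma Jf_continuous g z c (eps : R) : c != 0 -> cont11 g -> 0 < eps ->
  (forall x, eta (omz z) [set x] = 0%E) ->
  exists (m : nat) (del : R), 0 < del /\ forall z' c', agree m z z' -> `|c' - c| < del ->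
    c' != 0 /\ `|Jf g z' c' - Jf g z c| <= eps.
Proof.
move=> c0 cg e0 na.
have [B B0 gB] := cont11_bounded cg.
have e8 : 0 < eps / 8 by rewrite divr_gt0.
have [C C0 modu] := cont11_modulus cg e8.
have tau0 : 0 < eps / 8 / B by rewrite divr_gt0.
have [N _ HN] := boundary_small c0 tau0 na.
pose n := maxn N (Num.truncn (C / (eps / 8))).
pose kap : R := n.+1%:R^-1.
have kap0 : 0 < kap by rewrite invr_gt0 ltr0n.
have Ckap : C * kap <= eps / 8.
  rewrite ler_pdivrMr ?ltr0n // mulrC -ler_pdivrMr // ltW // (lt_le_trans (truncnS_gt _)) //.
  by rewrite ler_nat ltnS leq_maxr.
have bdry := HN n (leq_maxl _ _).
have nc0 : 0 < `|c| by rewrite normr_gt0.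
have [m small] : exists m, 2 * D * rmax r ^+ m < kap * `|c| / 4.
  by apply: rmax_small => //; rewrite divr_gt0 // mulr_gt0.
have D0 : 0 <= D by exact: diam_ge0.
(* Half of [kap] is for the change of scale, multiplied by distances up to [2 * D], with 1 added to
   avoid a zero denominator; the other half is for two displacements of points, each below
   [kap * |c| / 4] before division by [c]. *)
have ik : 0 < kap / 2 / (2 * D + 1).
  by rewrite !divr_gt0 // ltr_wpDl // mulr_ge0.
have [del [del0 [delc Hdel]]] : exists del : R, 0 < del /\ del <= `|c| /\
   forall c', `|c' - c| < del -> `|c'^-1 - c^-1| < kap / 2 / (2 * D + 1).
  have := inv_continuous c0 => /cvgrPdist_lt /(_ _ ik) /nbhs_ballP[d /= d0 Hd].
  exists (Num.min d `|c|); split; first by rewrite lt_min d0.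
  split; first by rewrite ge_min lexx orbT.
  move=> c'; rewrite lt_min => /andP[h _]; rewrite distrC; apply: Hd.
  by rewrite /ball /= distrC.
exists m, del; split => // z' c' zz' cc'.
have c'0 : c' != 0.
  apply: contraTneq cc' => ->; by rewrite sub0r normrN -leNgt.
split => //.
have close z1 c1 : agree m z z1 -> `|c1 - c| < del -> c1 != 0 -> forall z'',
    `|aff (X z1) c1 (X z'') - aff (X z) c (X (trunc m z''))| <= kap.
  move=> zz1 cc1 c10 z''.
  have tz : agree m z'' (trunc m z'') by move=> i im; rewrite /Submission.trunc im.
  have p1 : `|X z'' - X (trunc m z'')| <= 2 * D * rmax r ^+ m by exact: point_close.
  have p2 : `|X z - X z1| <= 2 * D * rmax r ^+ m by exact: point_close.
  have p3 : `|X z''| <= D by exact: point_le.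
  have p4 : `|X z1| <= D by exact: point_le.
  have -> : aff (X z1) c1 (X z'') - aff (X z) c (X (trunc m z'')) =
     (X z'' - X z1) * (c1^-1 - c^-1) + ((X z'' - X (trunc m z'')) + (X z - X z1)) / c.
    by rewrite /aff; ring.
  rewrite (le_trans (ler_normD _ _)) // [leRHS]splitr lerD //.
    rewrite normrM.
    apply: (@le_trans _ _ ((2 * D + 1) * (kap / 2 / (2 * D + 1)))).
      apply: ler_pM => //; last exact: ltW (Hdel _ cc1).
      rewrite (le_trans (ler_normB _ _)) // (le_trans (lerD p3 p4)) //.
      by rewrite mulr_natl mulr2n lerDl.
    by rewrite mulrC divfK // gt_eqF // ltr_wpDl // mulr_ge0.
  rewrite normrM normfV ler_pdivrMr // (le_trans (ler_normD _ _)) //.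
  rewrite (le_trans (lerD p1 p2)) //.
  have -> : kap / 2 * `|c| = kap * `|c| / 4 + kap * `|c| / 4 by field.
  by rewrite lerD // ltW.
have agr : agree m z z by [].
have cc0 : `|c - c| < del by rewrite subrr normr0.
have k0 := ltW kap0.
have B0' := ltW B0.
have e8' := ltW e8.
have H1 := Jf_trunc mu r_cond cg c0 C0 k0 e8' gB B0' modu (close z' c' zz' cc' c'0).
have H2 := Jf_trunc mu r_cond cg c0 C0 k0 e8' gB B0' modu (close z c agr cc0 c0).
have mJ : measurable J by exact: measurable_itv.
have mg' : measurable_fun setT (g \_ J) by apply/(measurable_restrictT _ mJ); exact: cont11_measurable.
have mY : measurable_fun setT (fun z'' : Z => aff (X z) c (X z'')).
  exact: (measurableT_comp (measurable_aff (X z) c) mX).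
have mf : measurable_fun setT (fun z'' : Z => (g \_ J) (aff (X z) c (X z''))).
  exact: (measurableT_comp mg' mY).
have fB (z'' : Z) : `|(g \_ J) (aff (X z) c (X z''))| <= B.
  by rewrite patchE; case: ifPn => [/set_mem/gB//|_]; rewrite normr0.
have omeq i : (i < m)%N -> omz z' i = omz z i by move=> im; rewrite /Submission.omz zz'.
have eI := lam_trunc_integral mu_cyl omeq mf fB.
have mS : measurable [set z'' : Z | `| `|aff (X z) c (X z'')| - 1| <= kap].
  rewrite (_ : mkset _ = (fun z'' : Z => `| `|aff (X z) c (X z'')| - 1|) @^-1` `]-oo, kap]%classic); last first.
    by apply/seteqP; split => y /=; rewrite in_itv.
  have mh : measurable_fun setT (fun z'' : Z => `| `|aff (X z) c (X z'')| - 1|).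
    apply: measurableT_comp => //; apply: measurable_funB => //.
    exact: measurableT_comp.
  by rewrite -[X in measurable X]setTI; apply: mh => //; exact: measurable_itv.
have eS := lam_trunc mu_cyl omeq mS.
have mS' : measurable (trunc m @^-1` [set z'' : Z | `| `|aff (X z) c (X z'')| - 1| <= kap]).
  by rewrite -[X in measurable X]setTI; apply: measurable_trunc.
(* Truncation moves the position by at most [kap], so the truncated layer of width [kap] lies in the
   untruncated layer of width [2 * kap], which [boundary_small] controls. *)
have bS : fine (lam (omz z) (trunc m @^-1` [set z'' : Z | `| `|aff (X z) c (X z'')| - 1| <= kap])) <= eps / 8 / B.
  rewrite (le_trans _ (ltW bdry)) // fine_le //; [exact: lam_fin| |].
    apply: lam_fin.
    rewrite (_ : mkset _ = (fun z'' : Z => `| `|aff (X z) c (X z'')| - 1|) @^-1` `]-oo, 2 * n.+1%:R^-1]%classic); last first.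
      by apply/seteqP; split => y /=; rewrite in_itv.
    have mh : measurable_fun setT (fun z'' : Z => `| `|aff (X z) c (X z'')| - 1|).
      apply: measurableT_comp => //; apply: measurable_funB => //.
      exact: measurableT_comp.
    by rewrite -[X in measurable X]setTI; apply: mh => //; exact: measurable_itv.
  apply: le_measure; rewrite ?inE //.
    rewrite (_ : mkset _ = (fun z'' : Z => `| `|aff (X z) c (X z'')| - 1|) @^-1` `]-oo, 2 * n.+1%:R^-1]%classic); last first.
      by apply/seteqP; split => y /=; rewrite in_itv.
    have mh : measurable_fun setT (fun z'' : Z => `| `|aff (X z) c (X z'')| - 1|).
      apply: measurableT_comp => //; apply: measurable_funB => //.
      exact: measurableT_comp.
    by rewrite -[X in measurable X]setTI; apply: mh => //; exact: measurable_itv.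
  move=> z'' /= h; have cl := close z c agr cc0 c0 z''.
  have := ler_dist_dist (aff (X z) c (X z'')) (aff (X z) c (X (trunc m z''))).
  move=> /le_trans /(_ cl) h'; exact: (dist1_close h' h).
have {}bS : B * fine (lam (omz z) (trunc m @^-1` [set z'' : Z | `| `|aff (X z) c (X z'')| - 1| <= kap])) <= eps / 8.
  by rewrite mulrC -ler_pdivlMr.
rewrite eS in H1.
rewrite eI in H1.
rewrite distrC in H2.
rewrite -(subrKA (Rintegral (lam (omz z)) setT ((fun z'' => (g \_ J) (aff (X z) c (X z''))) \o trunc m))).
rewrite (le_trans (ler_normD _ _)) //.
exact: (eight_parts e0 H1 H2 bS Ckap).
Qed.

(** The integral against a scenery is a quotient of two values of [Jf], the denominator being that
    of [cst 1], which is positive at [(z, c)]. *)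
Lemma scn_continuous g z c (eps : R) : c != 0 -> cont11 g -> 0 < eps ->
  (forall x, eta (omz z) [set x] = 0%E) ->
  exists (m : nat) (del : R), 0 < del /\ forall z' c', agree m z z' -> `|c' - c| < del ->
    c' != 0 /\ `|wint g (scn z' c') - wint g (scn z c)| < eps.
Proof.
move=> c0 cg e0 na.
have nc0 : 0 < `|c| by rewrite normr_gt0.
have eb := Jf1 r_cond mu_cyl eta_push z c0.
have b0 : 0 < Jf (cst 1) z c by rewrite eb; exact: (mass_gt0 r_cond p_gt0 mu_cyl eta_push z nc0).
have [tau [tau0 tb ts]] := div_close_tolerance b0 (normr_ge0 (Jf g z c)) e0.
have cont1 : cont11 (cst 1 : R -> R) by apply: continuous_subspaceT => x; exact: cvg_cst.
have [m1 [d1 [d10 H1]]] := Jf_continuous c0 cg tau0 na.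
have [m2 [d2 [d20 H2]]] := Jf_continuous c0 cont1 tau0 na.
exists (maxn m1 m2), (Num.min d1 d2); split; first by rewrite lt_min d10.
move=> z' c' ag; rewrite lt_min => /andP[cd1 cd2].
have ag1 : agree m1 z z' by move=> i im; apply: ag; rewrite leq_max im.
have ag2 : agree m2 z z' by move=> i im; apply: ag; rewrite leq_max im orbT.
have [c'0 h1] := H1 z' c' ag1 cd1; have [_ h2] := H2 z' c' ag2 cd2; split => //.
rewrite (wint_scn r_cond p_gt0 mu_cyl eta_push z' c'0 cg).
rewrite (wint_scn r_cond p_gt0 mu_cyl eta_push z c0 cg).
have eb' := Jf1 r_cond mu_cyl eta_push z' c'0.
rewrite -eb' -eb; exact: (div_close b0 h1 h2 tb ts).
Qed.

Lemma meq_Sflow tt (m1 m2 : PMT R) : meq m1 m2 -> meq (Sflow tt m1) (Sflow tt m2).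
Proof.
move=> H A mA; set s := expR (- tt); have s0 : 0 < s by exact: expR_gt0.
have mB : measurable (aff 0 s @^-1` (A `&` J)).
  rewrite -[X in measurable X]setTI; apply: measurable_aff => //.
  by apply: measurableI => //; exact: measurable_itv.
apply: (etrans (zoom_zm m1 0 s0 mA)); apply: (etrans _ (esym (zoom_zm m2 0 s0 mA))).
by rewrite zmE zmE (H _ mB) (H _ (mcl _ _)).
Qed.

Lemma Sflow_loc z tt : 0 <= tt ->
  meq (Sflow tt (loc (eta (omz z)) (X z))) (scn z (expR (- tt))).
Proof.
move=> t0; apply: (@meq_trans _ _ (Sflow tt (scn z 1))).
  by apply: meq_Sflow; apply: zoom_zm.
have := Sflow_scn r_cond p_gt0 mu_cyl eta_push z (oner_neq0 R) t0.
by rewrite mul1r.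
Qed.

(** The fibre measure at [om] is a weighted sum of affine images of the one at [shift om], so an
    atom at [om] forces one at [shift om]. *)
Lemma atomless_shift om : (forall x, eta (shift om) [set x] = 0%E) ->
  forall x, eta om [set x] = 0%E.
Proof.
move=> na x; have m1 y : measurable [set y : R] by exact: measurable_set1.
rewrite (eta_lam om (m1 x)); apply/negligibleP; first exact: meta_pre.
pose F (a : letter k) : set Z := [set z | z 0%N = a] `&`
  ((@shift _ : Z -> Z) @^-1` (X @^-1` [set (x - t (tag a) (digit a)) / r (tag a)])).
have : (lam om).-negligible (\bigcup_a F a).
  apply: negligible_bigcup_count => a.
  have mF : measurable (F a).
    apply: measurableI; first exact: (measurable_coord 0 [set b | b = a]).
    by rewrite -[X in measurable X]setTI; apply: measurable_shift => //; exact: meta_pre.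
  apply/negligibleP => //.
  apply: (etrans (lam_step p_gt0 mu_cyl om a (meta_pre (m1 _)))).
  by rewrite -(eta_lam (shift om) (m1 _)) na mule0.
apply: negligibleS => z /= Xz; exists (z 0%N) => //; split => //=.
have r0 : r (tag (z 0%N)) != 0 by case: (r_cond (tag (z 0%N))).
rewrite -Xz (point_rec t r_cond z) /Submission.omz /dgz /=.
by rewrite addrK mulrC mulKf.
Qed.

Section SelfSimilarity.
Variable d : R.
Hypothesis gap : forall z z', omz z = omz z' -> z 0%N <> z' 0%N -> d <= `|X z - X z'|.

(** By [gap], a window of radius below [d] around [X z] meets the fibre only in the piece with the
    first letter of [z]. That piece is an affine image, of ratio [r (omz z 0)], of the shifted
    fibre; its weight cancels in the normalisation, and the sign of the ratio stays in the scale. *)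
Lemma scn_selfsim z c : c != 0 -> `|c| < d ->
  meq (scn z (c * r (omz z 0%N))) (scn (shift z : Z) c).
Proof.
move=> c0 cd; set rr := r (omz z 0%N).
have [r0 r1] : rr != 0 /\ `|rr| < 1 by exact: r_cond.
have cr0 : c * rr != 0 by rewrite mulf_neq0.
have pz0 : 0 < p (tag (z 0%N)) (digit (z 0%N)) by apply: p_gt0; exact: ltn_ord.
have mJ : measurable J by exact: measurable_itv.
have maff x e A : measurable A -> measurable (aff x e @^-1` A).
  by move=> mA; rewrite -[X in measurable X]setTI; exact: measurable_aff.
have key A : measurable A -> A `<=` J ->
    eta (omz z) (aff (X z) (c * rr) @^-1` A) =
    ((p (tag (z 0%N)) (digit (z 0%N)))%:E *
     eta (omz (shift z : Z)) (aff (X (shift z : Z)) c @^-1` A))%E.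
  move=> mA AJ; rewrite !eta_lam //; [|exact: maff|exact: maff].
  have mB : measurable (X @^-1` (aff (X (shift z : Z)) c @^-1` A)).
    by apply: meta_pre; exact: maff.
  have := lam_step p_gt0 mu_cyl (omz z) (z 0%N) mB.
  rewrite /Submission.omz eqxx => <-.
  apply: lam_fiber.
  - by apply: meta_pre; exact: maff.
  - apply: measurableI; first exact: (measurable_coord 0 [set b | b = z 0%N]).
    by rewrite -[X in measurable X]setTI; apply: measurable_shift.
  move=> z' omz'.
  have eqX : z' 0%N = z 0%N ->
      aff (X z) (c * rr) (X z') = aff (X (shift z : Z)) c (X (shift z' : Z)).
    move=> e0; rewrite /aff (point_rec t r_cond z') (point_rec t r_cond z) /Submission.omz /dgz /= e0 -/rr.
    by field; rewrite c0 r0.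
  split => /= [Az'|[e0]]; last by rewrite eqX.
  have e0 : z' 0%N = z 0%N.
    apply: contrapT => ne.
    have := gap omz' ne; rewrite leNgt => /negP; apply; apply: le_lt_trans cd.
    have := AJ _ Az'; rewrite /aff /= in_itv /= -ler_norml normrM normfV ler_pdivrMr ?normr_gt0 //.
    by move=> /le_trans; apply; rewrite mul1r normrM ler_piMr // ltW.
  by split => //; rewrite -eqX.
move=> A mA.
have AJ : A `&` J `<=` J by move=> y [].
have mAJ : measurable (A `&` J) by exact: measurableI.
have L : scn z (c * rr) A = ((`|fine (eta (omz z) (aff (X z) (c * rr) @^-1` J))|^-1)%:E *
    eta (omz z) (aff (X z) (c * rr) @^-1` (A `&` J)))%E by rewrite aff_itv.
have Rr : scn (shift z : Z) c A =
    ((`|fine (eta (omz (shift z : Z)) (aff (X (shift z : Z)) c @^-1` J))|^-1)%:E *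
    eta (omz (shift z : Z)) (aff (X (shift z : Z)) c @^-1` (A `&` J)))%E by rewrite aff_itv.
rewrite L Rr (key _ mAJ AJ) (key _ mJ (@subset_refl _ J)).
have f1 B : measurable B -> eta (omz (shift z : Z)) B \is a fin_num by move=> mB; exact: fin_num_measure.
have mb0 := mass_gt0 r_cond p_gt0 mu_cyl eta_push (shift z : Z).
have M0 : 0 < fine (eta (omz (shift z : Z)) (aff (X (shift z : Z)) c @^-1` J)).
  by rewrite aff_itv //; apply: mb0; rewrite normr_gt0.
have fa : eta (omz (shift z : Z)) (aff (X (shift z : Z)) c @^-1` (A `&` J)) \is a fin_num.
  by apply: f1; exact: maff.
have fb : eta (omz (shift z : Z)) (aff (X (shift z : Z)) c @^-1` J) \is a fin_num.
  by apply: f1; exact: maff.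
set a := eta (omz (shift z : Z)) (aff (X (shift z : Z)) c @^-1` (A `&` J)) in fa *.
set b := eta (omz (shift z : Z)) (aff (X (shift z : Z)) c @^-1` J) in fb M0 *.
rewrite -(fineK fa) -(fineK fb) -!EFinM /=; congr EFin; move: M0 pz0.
move: (fine a) (fine b) (p _ _) => u v w v0 w0.
rewrite normrM (gtr0_norm v0) (gtr0_norm w0).
by field; rewrite !gt_eqF.
Qed.

End SelfSimilarity.

End Continuity.

(** * The suspension and its limit distribution *)

Section Translation.
Context {R : realType}.

Lemma measurable_translate (u : R) :
  measurable_fun [set: R] (fun s : R => s + u).
Proof. exact: measurable_funD. Qed.

Lemma lebesgue_translate (u : R) (A : set R) : measurable A ->
  lebesgue_measure [set s : R | A (s + u)] = lebesgue_measure A.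
Proof.
move=> mA; apply/esym.
have mf : measurable_fun [set: measurableTypeR R]
    ((fun s => s + u) : measurableTypeR R -> measurableTypeR R) := measurable_translate u.
apply: (@lebesgue_measure_unique R (push lebesgue_measure mf)) => //= _ [[a b]] _ <- /=.
rewrite /push /pushforward (_ : _ @^-1` _ = `]a - u, b - u]%classic); last first.
  by apply/seteqP; split => s /=; rewrite !in_itv /= ltrBlDr lerBrDr.
by rewrite !lebesgue_measure_itv /= !lte_fin ltrD2r -!EFinB opprB addrA subrK.
Qed.

End Translation.

Section Suspension.
Context {R : realType} {T : finType} {t0 : T}.
Variables (pT : T -> R) (nu : probability (SeqSp t0) R).
Hypothesis nu_cyl : forall w : seq T, nu (@cyl T t0 w) = (\prod_(a <- w) pT a)%:E.
Local Notation Z := (SeqSp t0).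
Variables (neg : T -> bool) (ell : T -> R) (C lmin lmax : R).
Hypothesis lmin_gt0 : 0 < lmin.
Hypothesis lmin_le : forall a, lmin <= ell a.
Hypothesis le_lmax : forall a, ell a <= lmax.
(* F b z s is the scenery at code z, orientation b and scale e^-s; the shift-invariant set N excludes the codes of fibres with atoms, where F takes the flow-fixed value delta0. *)
Variable N : set Z.
Hypothesis mN : measurable N.
Hypothesis N_null : nu (~` N) = 0%E.
Hypothesis N_shift : forall z : Z, N z -> N (shift z).
Variable F : bool -> Z -> R -> PMT R.
Hypothesis F_Msq : forall b z s, Msq (F b z s : PM R).
Hypothesis F_flow : forall b z s tt, 0 <= tt -> meq (Sflow tt (F b z s)) (F b z (s + tt)).
Hypothesis F_step : forall b z s, C <= s ->
  meq (F b z (s + ell (z 0%N))) (F (b (+) neg (z 0%N)) (shift z) s).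
Hypothesis F_cont : forall b z s g eps, N z -> cont11 g -> 0 < eps ->
  exists (m : nat) (del : R), 0 < del /\ forall (z' : Z) s', N z' ->
    (forall i, (i < m)%N -> z i = z' i) -> `|s' - s| < del ->
    `|wint g (F b z' s') - wint g (F b z s)| < eps.
Hypothesis F_atom : forall b z s, N z -> F b z s [set 0] = 0%E.
Hypothesis F_out : forall b z s, ~ N z -> F b z s = (delta0 : PM R).

Local Notation rho := (nu [set u | neg (u 0%N)]).
Local Notation sgw := (sgwt nu neg).
Implicit Types (z : Z) (b : bool) (E : set (PM R)).

Let ell_gt0 a : 0 < ell a. Proof. exact: lt_le_trans lmin_gt0 (lmin_le a). Qed.
Let F_Pm11 b z s : Pm11 (F b z s). Proof. exact: (F_Msq b z s).1. Qed.

Lemma F_near (U : set (PMT R)) b z s : weak_open U -> N z -> U (F b z s) ->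
  \forall s' \near s & n \near \oo, forall z' : Z, N z' ->
    (forall i, (i < n)%N -> z i = z' i) -> U (F b z' s').
Proof.
move=> oU Nz Us; have [m [g [del [d0 [cg sub]]]]] := oU.2 _ Us.
have : \forall x \near filter_prod (nbhs s) (\oo : set_system nat),
    forall i : 'I_m, forall z' : Z, N z' -> (forall i, (i < x.2)%N -> z i = z' i) ->
    `|wint (g i) (F b z' x.1) - wint (g i) (F b z s)| < del.
  apply: filter_forall => i.
  have [n [e [e0 He]]] := F_cont b s Nz (cg i) d0.
  exists (ball s e, [set l | (n <= l)%N]); first by split; [exact: nbhsx_ballx|exact: nbhs_infty_ge].
  move=> [s' l] /= [bs nl] z' Nz' ag; apply: He => //.
    by move=> j jn; apply: ag; exact: leq_trans jn nl.
  by rewrite distrC; exact: bs.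
apply: filterS => -[s' n] /= H z' Nz' ag; apply: sub; split; first exact: F_Pm11.
by move=> i; exact: H.
Qed.

(** On [N], membership in a weakly open set is stable under small changes of code and height, so the
    preimage there is the trace of a countable union of products of cylinders and rational
    intervals. Off [N] the map is constant. *)
Lemma measurable_F b : measurable_fun [set: Z * R] (fun x : Z * R => F b x.1 x.2 : PM R).
Proof.
have eG : @measurable _ (PM R) = <<s @weak_open R >> by [].
apply: (measurability (@weak_open R : set (set (PM R))) eG) => _ [U oU <-]; rewrite setTI.
pose good (v : seq T * (rat * rat)) := forall z' s', @cyl T t0 v.1 z' ->
  ratr v.2.1 < s' < ratr v.2.2 -> N z' -> U (F b z' s').
pose G (v : seq T * (rat * rat)) : set (Z * R) :=
  if `[< good v >] then (@cyl T t0 v.1) `*` `](ratr v.2.1), (ratr v.2.2)[%classic else set0.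
rewrite (_ : _ @^-1` U = ((N `*` setT) `&` \bigcup_v G v) `|`
   ((~` N `*` setT) `&` [set _ : Z * R | U (delta0 : PM R)])); last first.
  apply/seteqP; split => -[z s] /=; last first.
    case=> [[[Nz _] [v _]]|[[Nz _]]]; last by move=> U0; rewrite F_out.
    rewrite /G; case: asboolP => // gv [/= cz]; rewrite in_itv /= => sv; exact: gv.
  move=> Us; have [Nz|Nz] := pselect (N z); last by right; split => //; rewrite -(F_out b s Nz).
  left; split => //.
  have [[/= A B] [/= /nbhs_ballP [e /= e0 eA] [n _ nB]] AB] := F_near oU Nz Us.
  have [q1] : exists q1, ratr q1 \in `](s - e), s[ by apply: rat_in_itvoo; lra.
  have [q2] : exists q2, ratr q2 \in `]s, (s + e)[ by apply: rat_in_itvoo; lra.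
  rewrite !in_itv /= => /andP[sq2 q2e] /andP[eq1 q1s].
  exists (mkseq z n, (q1, q2)) => //; rewrite /G; case: asboolP => /= [_|ng].
    by split => /=; [exact: cyl_mkseq | rewrite in_itv /= q1s].
  apply: ng => z' s' /= cz' /andP[s1 s2] Nz'; apply: (AB (s', n)) => //=.
    split; last by apply: nB => /=.
    by apply: eA; rewrite /ball /= ltr_distlC; apply/andP; split; lra.
  move=> i ni; move/cylP : cz'; rewrite size_mkseq => /(_ i ni) ->.
  by rewrite nth_mkseq.
apply: measurableU; apply: measurableI.
- exact: measurableX.
- apply: countable_bigcupT_measurable => // v; rewrite /G; case: asboolP => _ //.
  by apply: measurableX; [exact: measurable_cyl|exact: measurable_itv].
- by apply: measurableX => //; exact: measurableC.
- have [H|H] := pselect (U (delta0 : PM R)).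
    by rewrite (_ : mkset _ = setT) //; apply/seteqP; split.
  by rewrite (_ : mkset _ = set0) //; apply/seteqP; split.
Qed.

Lemma measurable_len : measurable_fun [set: Z] (fun z => ell (z 0%N)).
Proof.
move=> _ Y mY; rewrite setTI; exact: (measurable_coord 0 (ell @^-1` Y)).
Qed.

Definition strip (a c : Z -> R) : set (Z * R) := [set x | a x.1 <= x.2 < c x.1].

Lemma measurable_strip (a c : Z -> R) : measurable_fun setT a -> measurable_fun setT c ->
  measurable (strip a c).
Proof.
move=> ma mc.
have m1 : measurable_fun [set: Z * R] (fun x : Z * R => x.2 - a x.1).
  by apply: measurable_funB => //; exact: measurableT_comp.
have m2 : measurable_fun [set: Z * R] (fun x : Z * R => x.2 - c x.1).
  by apply: measurable_funB => //; exact: measurableT_comp.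
rewrite (_ : strip a c = (fun x : Z * R => x.2 - a x.1) @^-1` `[0, +oo[%classic `&`
   (fun x : Z * R => x.2 - c x.1) @^-1` `]-oo, 0[%classic).
  by apply: measurableI; rewrite -[X in measurable X]setTI; [apply: m1|apply: m2].
apply/seteqP; split => -[z s] /=; rewrite !in_itv /= subr_ge0 subr_lt0 ?andbT.
  by move/andP.
by move=> [h1 h2]; rewrite /strip /= h1 h2.
Qed.

(** Occupation time of [E]. Invariance and ergodicity of the limit are reduced to additivity and
    translation of this quantity. *)
Definition occ b E (a c : R) z : \bar R :=
  lebesgue_measure [set s : R | a <= s < c /\ E (F b z s)].

Let measurable_slice b E z a c : measurable E ->
  measurable [set s : R | a <= s < c /\ E (F b z s)].
Proof.
move=> mE.
have mS : measurable (strip (cst a) (cst c) `&` (fun x : Z * R => F b x.1 x.2 : PM R) @^-1` E).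
  apply: measurableI; first exact: measurable_strip.
  by rewrite -[X in measurable X]setTI; exact: measurable_F.
have := measurable_xsection z mS; congr (measurable _).
by apply/seteqP; split => s /=; rewrite /xsection /= inE.
Qed.

Lemma measurable_occ b E (a c : Z -> R) : measurable E ->
  measurable_fun setT a -> measurable_fun setT c ->
  measurable_fun setT (fun z => occ b E (a z) (c z) z).
Proof.
move=> mE ma mc.
have mS : measurable (strip a c `&` (fun x : Z * R => F b x.1 x.2 : PM R) @^-1` E).
  apply: measurableI; first exact: measurable_strip.
  by rewrite -[X in measurable X]setTI; exact: measurable_F.
have := measurable_fun_xsection (@lebesgue_measure R) mS; congr (measurable_fun _ _).
apply/funext => z /=; congr (lebesgue_measure _).
by apply/seteqP; split => s /=; rewrite /xsection /= inE.
Qed.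

Lemma occ_ge0 b E a c z : (0 <= occ b E a c z)%E.
Proof. exact: measure_ge0. Qed.

Lemma occT b E a c z : a <= c -> (forall s, E (F b z s)) -> occ b E a c z = (c - a)%:E.
Proof.
move=> ac HE; rewrite /occ (_ : mkset _ = `[a, c[%classic).
  rewrite lebesgue_measure_itv /= lte_fin; move: ac; rewrite le_eqVlt => /predU1P[->|->] //.
  by rewrite ltxx subrr.
by apply/seteqP; split => s /=; rewrite in_itv /=; [case|move=> h; split].
Qed.

Lemma occ_le b E a c z : measurable E -> a <= c -> (occ b E a c z <= (c - a)%:E)%E.
Proof.
move=> mE ac; rewrite -(@occT b setT a c z) //; apply: le_measure; rewrite ?inE.
- exact: measurable_slice.
- exact: measurable_slice.
- by move=> s /= [].
Qed.

Lemma occ_split b E a e c z : measurable E -> a <= e -> e <= c ->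
  occ b E a c z = (occ b E a e z + occ b E e c z)%E.
Proof.
move=> mE ae ec; rewrite /occ -measureU; [|exact: measurable_slice|exact: measurable_slice|].
  congr (lebesgue_measure _); apply/seteqP; split => s /=.
    case=> /andP[s1 s2] Es; case: (ltP s e) => se; [left|right]; split => //; apply/andP; by split.
  by case=> -[/andP[s1 s2] Es]; split => //; apply/andP; split; lra.
by apply/seteqP; split => s //= [[/andP[_ se] _] [/andP[es _] _]]; lra.
Qed.

Lemma occ_step b E a c z : measurable E -> C <= a ->
  occ b E (a + ell (z 0%N)) (c + ell (z 0%N)) z = occ (b (+) neg (z 0%N)) E a c (shift z).
Proof.
move=> mE Ca; rewrite /occ -(lebesgue_translate (ell (z 0%N))); last exact: measurable_slice.
congr (lebesgue_measure _); apply/seteqP; split => s /=; rewrite lerD2r ltrD2r => -[ac Es]; split => //.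
  by apply/(meq_measurable mE (F_step b z (le_trans Ca (proj1 (andP ac))))).
by apply/(meq_measurable mE (F_step b z (le_trans Ca (proj1 (andP ac))))).
Qed.

Lemma occ_flow b E a c z tt : measurable E -> 0 <= tt ->
  occ b (Sflow tt @^-1` E `&` Msq) a c z = occ b E (a + tt) (c + tt) z.
Proof.
move=> mE tt0; rewrite [RHS]/occ -(lebesgue_translate tt); last exact: measurable_slice.
congr (lebesgue_measure _); apply/seteqP; split => s /=; rewrite lerD2r ltrD2r.
  by case=> ac [Es _]; split => //; apply/(meq_measurable mE (F_flow b z s tt0)).
by case=> ac Es; split => //; split => //; apply/(meq_measurable mE (F_flow b z s tt0)).
Qed.

Let mD0 : measurable (strip (cst C) (fun z => C + ell (z 0%N))).
Proof.
apply: measurable_strip => //; apply: measurable_funD => //; exact: measurable_len.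
Qed.

(** Image of the product measure on the region under the roof, for one orientation. The region
    starts at height [C] because [F_step] holds only from there. *)
Definition Qside b := push (mrestr (nu \x (@lebesgue_measure R))%E mD0) (measurable_F b).

Lemma QsideE b E : Qside b E = (\int[nu]_z occ b E C (C + ell (z 0%N)) z)%E.
Proof.
rewrite /Qside /push /pushforward /mrestr /= /product_measure1; apply: eq_integral => z _ /=.
congr (lebesgue_measure _); apply/seteqP; split => s; rewrite /xsection /strip /= inE /= => -[];
  by split.
Qed.

Definition mean_len : R := fine (\int[nu]_z (ell (z 0%N))%:E).

Let len_int : nu.-integrable setT (fun z => (ell (z 0%N))%:E).
Proof.
apply: (le_bounded_integrable (B := lmax)) => //; [|exact: measurable_len|].
  by rewrite [X in (X < _)%E]probability_setT ltry.
by move=> z _; rewrite gtr0_norm.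
Qed.

Lemma mean_lenE : (\int[nu]_z (ell (z 0%N))%:E)%E = mean_len%:E.
Proof. by rewrite /mean_len fineK //; exact: integrable_fin_num. Qed.

Lemma mean_len_gt0 : 0 < mean_len.
Proof.
apply: (lt_le_trans lmin_gt0); rewrite -lee_fin -mean_lenE.
have -> : lmin%:E = (\int[nu]_z (cst lmin%:E z))%E.
  by rewrite integral_cst // [X in (_ * X)%E]probability_setT mule1.
apply: ge0_le_integral => //.
- by move=> z _; rewrite lee_fin ltW.
- by apply/measurable_EFinP; exact: measurable_len.
- by move=> z _; rewrite lee_fin.
Qed.

Lemma sgw_ge0 b : 0 <= sgw b.
Proof. by rewrite /sgwt; case: ifP => _ //; case: b. Qed.

Lemma sgw_sum : sgw false + sgw true = 1.
Proof. by rewrite /sgwt; case: ifP => _ /=; rewrite ?addr0 //; lra. Qed.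

Let mean_len_inv_ge0 : 0 <= mean_len^-1.
Proof. by rewrite invr_ge0 ltW // mean_len_gt0. Qed.

(** Each side has mass [mean_len], and the orientations enter with their limiting frequencies. *)
Definition Qlim : set (PM R) -> \bar R := mscale (NngNum mean_len_inv_ge0)
  (measure_add (mscale (NngNum (sgw_ge0 false)) (Qside false))
     (mscale (NngNum (sgw_ge0 true)) (Qside true))).

HB.instance Definition _ := Measure.on Qlim.

Lemma QlimE E : Qlim E =
  ((mean_len^-1)%:E * ((sgw false)%:E * Qside false E + (sgw true)%:E * Qside true E))%E.
Proof.
transitivity ((mean_len^-1)%:E * measure_add (mscale (NngNum (sgw_ge0 false)) (Qside false))
     (mscale (NngNum (sgw_ge0 true)) (Qside true)) E)%E; first by [].
by rewrite measure_addE.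
Qed.

Lemma Qside_full b E : (forall z s, E (F b z s)) -> Qside b E = mean_len%:E.
Proof.
move=> HE; rewrite QsideE -mean_lenE; apply: eq_integral => z _; rewrite occT.
- by rewrite addrAC subrr add0r.
- by rewrite lerDl ltW.
- by move=> s; exact: HE.
Qed.

Lemma Qlim_full E : (forall b z s, E (F b z s)) -> Qlim E = 1%E.
Proof.
move=> HE; rewrite QlimE !Qside_full; [|exact: HE|exact: HE].
rewrite -(EFinM (sgw false)) -(EFinM (sgw true)) -(EFinD (sgw false * _)) -EFinM -mulrDl.
by rewrite sgw_sum mul1r mulVf // gt_eqF // mean_len_gt0.
Qed.

Let Qlim_setT : Qlim setT = 1%E. Proof. exact: Qlim_full. Qed.

HB.instance Definition _ := Measure_isProbability.Build _ _ _ Qlim Qlim_setT.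

Lemma Qlim_Msq : Qlim Msq = 1%E.
Proof. exact: Qlim_full. Qed.

Let rho_fin : rho \is a fin_num.
Proof.
apply: fin_num_measure; exact: (measurable_coord 0 [set a | neg a]).
Qed.

(** The weights are either equal, or zero on the side [true] in the absence of reflecting letters;
    in both cases [j0] and [j1] cancel from the weighted sum. *)
Let real_identity (w0 w1 rh i0 i1 j0 j1 k0 k1 : R) :
  (w1 = 0 /\ rh = 0) \/ (w0 = w1) ->
  i0 + j0 = k0 + ((1 - rh) * j0 + rh * j1) ->
  i1 + j1 = k1 + ((1 - rh) * j1 + rh * j0) ->
  w0 * i0 + w1 * i1 = w0 * k0 + w1 * k1.
Proof.
case=> [[-> ->] H1 H2|-> H1 H2].
  rewrite !mul0r !addr0; congr (_ * _); lra.
rewrite -!mulrDr; congr (_ * _); lra.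
Qed.

(** The occupation of [[C, C + ell + tt[] is cut in two ways. One gives [A + J]; the other gives [K]
    plus the part above the roof, which [occ_step] carries to the shifted code at heights [[C, C +
    tt[], where its integral mixes [J] of the two orientations as in [skew_integral]. *)
Lemma Qlim_invariant tt E : 0 <= tt -> measurable E ->
  Qlim ((Sflow tt) @^-1` E `&` Msq) = Qlim E.
Proof.
move=> tt0 mE; rewrite !QlimE; congr (_ * _)%E.
pose A b := (\int[nu]_z occ b E (C + tt) (C + ell (z 0%N) + tt) z)%E.
pose J b := (\int[nu]_z occ b E C (C + tt) z)%E.
pose K b := (\int[nu]_z occ b E C (C + ell (z 0%N)) z)%E.
have mell := measurable_len.
have fin (a c : Z -> R) b : measurable_fun setT a -> measurable_fun setT c ->
    (forall z, 0 <= c z - a z <= tt + lmax) ->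
    (\int[nu]_z occ b E (a z) (c z) z)%E \is a fin_num.
  move=> ma mc ac; rewrite ge0_fin_numE; last by apply: integral_ge0 => z _; exact: occ_ge0.
  apply: (@le_lt_trans _ _ (\int[nu]_z (cst (tt + lmax)%:E z))%E); last first.
    by rewrite integral_cst // [X in (_ * X)%E]probability_setT mule1 ltry.
  apply: ge0_le_integral => //.
  - exact: measurable_occ.
  - move=> z _ /=; have /andP[h1 h2] := ac z.
    apply: (@le_trans _ _ (c z - a z)%:E); last by rewrite lee_fin.
    by apply: occ_le => //; rewrite -subr_ge0.
have finA b : A b \is a fin_num.
  apply: fin; [exact: measurable_cst| |].
    by apply: measurable_funD => //; apply: measurable_funD.
  by move=> z; have := ell_gt0 (z 0%N); have := le_lmax (z 0%N) => h1 h2; apply/andP; split; lra.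
have lm0 : 0 <= lmax by exact: le_trans (ltW (ell_gt0 t0)) (le_lmax t0).
have finJ b : J b \is a fin_num.
  by apply: fin => // z; apply/andP; split; lra.
have finK b : K b \is a fin_num.
  apply: fin; [exact: measurable_cst|by apply: measurable_funD|].
  by move=> z; have := ell_gt0 (z 0%N); have := le_lmax (z 0%N) => h1 h2; apply/andP; split; lra.
have key b : (A b + J b = K b + ((1 - rho) * J b + rho * J (~~ b)))%E.
  have := @skew_integral _ _ _ _ _ nu_cyl neg (fun b z => occ b E C (C + tt) z) b.
  rewrite -/(J b) -/(J (~~ b)) => <-; last 2 first.
  - by move=> b'; exact: (measurable_occ b' mE (measurable_cst _) (measurable_cst _)).
  - by move=> b' z; exact: occ_ge0.
  rewrite (eq_integral (fun z => occ b E (C + ell (z 0%N)) (C + tt + ell (z 0%N)) z)); last first.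
    by move=> z _; rewrite occ_step.
  rewrite /A /J /K -!ge0_integralD //.
  - apply: eq_integral => z _; rewrite [RHS](_ : _ = occ b E C (C + tt + ell (z 0%N)) z).
      rewrite addeC [in LHS](addrAC C) -occ_split //; have := ell_gt0 (z 0%N) => h; lra.
    by rewrite -occ_split //; have := ell_gt0 (z 0%N) => h; lra.
  - by apply: measurable_occ => //; apply: measurable_funD.
  - by apply: measurable_occ => //; repeat apply: measurable_funD.
  - by apply: measurable_occ => //; repeat apply: measurable_funD.
  - exact: (measurable_occ b mE (measurable_cst _) (measurable_cst _)).
have eA b : Qside b ((Sflow tt) @^-1` E `&` Msq) = A b.
  by rewrite QsideE; apply: eq_integral => z _; rewrite occ_flow.
have eK b : Qside b E = K b by rewrite QsideE.
rewrite !eA !eK -(fineK (finA false)) -(fineK (finA true)) -(fineK (finK false)) -(fineK (finK true)).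
rewrite -!EFinM -!EFinD; congr (_%:E).
have keyR b : fine (A b) + fine (J b) =
    fine (K b) + ((1 - fine rho) * fine (J b) + fine rho * fine (J (~~ b))).
  apply: EFin_inj; rewrite !EFinD !EFinM EFinB !fineK //; exact: key.
apply: (@real_identity _ _ (fine rho) _ _ _ _ _ _ _ (keyR false) (keyR true)).
rewrite /sgwt; case: ifPn => [/eqP r0|_]; [left|by right].
by rewrite r0.
Qed.

(** Membership of [F b z s] in an invariant set does not depend on the height, so it defines sets of
    codes invariant under the skew product. The segment under the roof above a code lies entirely
    inside or entirely outside, and [skew_ergodic] decides which happens almost everywhere. *)
Lemma Qlim_ergodic E : measurable E ->
  (forall tt : R, 0 <= tt -> (Sflow tt) @^-1` E `&` Msq = E `&` Msq) ->
  Qlim E = 0%E \/ Qlim E = 1%E.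
Proof.
move=> mE inv.
have flowE b z s tt : 0 <= tt -> E (F b z s) <-> E (F b z (s + tt)).
  move=> tt0; rewrite -(meq_measurable mE (F_flow b z s tt0)).
  have := inv tt tt0; move/seteqP => [h1 h2]; split => H.
    by have [] := h2 (F b z s) (conj H (F_Msq b z s)).
  by have [] := h1 (F b z s) (conj H (F_Msq b z s)).
(* The flow only runs forward, so the lower of the two heights is flowed up to the higher one. *)
have stE b z s : E (F b z s) <-> E (F b z C).
  have [sC|Cs] := leP s C.
    have h : 0 <= C - s by lra.
    by rewrite (flowE b z s _ h) addrC subrK.
  have h : 0 <= s - C by lra.
  by rewrite (flowE b z C _ h) addrC subrK.
pose A b : set Z := [set z | E (F b z C)].
have mA b : measurable (A b).
  have mS : measurable ((fun x : Z * R => F b x.1 x.2 : PM R) @^-1` E).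
    by rewrite -[X in measurable X]setTI; exact: measurable_F.
  have := measurable_ysection C mS; congr (measurable _).
  by apply/seteqP; split => z /=; rewrite /ysection /= inE.
have Ainv b z : A b z <-> A (b (+) neg (z 0%N)) (shift z).
  rewrite /A /= -(meq_measurable mE (F_step b z (lexx C))).
  by rewrite (stE b z (C + _)).
have occA b : Qside b E = (\int[nu]_(z in A b) (ell (z 0%N))%:E)%E.
  rewrite QsideE [RHS]integral_mkcond; apply: eq_integral => z _; rewrite /patch.
  case: ifPn; rewrite ?notin_setE ?inE => Az.
    rewrite occT; [|by rewrite lerDl ltW|by move=> s; apply/stE].
    by rewrite addrAC subrr add0r.
  rewrite /occ (_ : mkset _ = set0) ?measure0 //; apply/seteqP; split => s //= [_ Es].
  by apply: Az; apply/(stE b z s).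
have Q0 b : nu (A b) = 0%E -> Qside b E = 0%E.
  move=> A0; rewrite occA; apply: (@null_set_integral _ _ _ nu) => //.
  by apply/measurable_EFinP/measurable_funTS; exact: measurable_len.
have Q1 b : nu (A b) = 1%E -> Qside b E = mean_len%:E.
  move=> A1; rewrite occA -mean_lenE [RHS](negligible_integral (N := ~` A b)) //=.
  - by rewrite setTD setCK.
  - exact: measurableC.
  - by rewrite probability_setC // A1 subee.
have fin : ((mean_len^-1)%:E * mean_len%:E)%E = 1%E.
  by rewrite -EFinM mulVf // gt_eqF // mean_len_gt0.
have := skew_ergodic nu_cyl mA Ainv; rewrite QlimE.
have := sgw_sum; rewrite /sgwt; case: ifPn => _ sm.
  case=> H; [left|right]; first by rewrite (Q0 _ H) mule0 mul0e adde0 mule0.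
  by rewrite (Q1 _ H) mul1e mul0e adde0.
move=> [eqA H]; case: H => H; [left|right].
  by rewrite !Q0 ?mule0 ?adde0 ?mule0 // eqA.
rewrite !Q1 ?eqA //.
have -> : (((2^-1 : R)%:E * mean_len%:E) + ((2^-1 : R)%:E * mean_len%:E) = mean_len%:E)%E.
  by rewrite -!EFinM -EFinD -mulrDl sm mul1r.
exact: fin.
Qed.

Lemma wint_norm_atom (m : PMT R) : Pm11 m -> wint (fun y => `|y|) m = 0 -> m [set 0] = 1%E.
Proof.
move=> [m1 mJ].
have mJm : measurable (`[(-1)%R, 1%R] : set R) by exact: measurable_itv.
have mI : measurable_fun (`[(-1)%R, 1%R] : set R) (EFin : R -> \bar R).
  by apply/measurable_EFinP.
have fin : (\int[m]_(y in `[(-1)%R, 1%R]) (`|y|)%:E)%E \is a fin_num.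
  apply: integrable_fin_num => //; apply: (le_bounded_integrable (f := fun y : R => `|y|) (B := 1)) => //.
  - apply: (le_lt_trans (le_measure m _ _ (@subsetT _ _))); rewrite ?inE //.
    suff : (m [set: R] < +oo)%E by [].
    by rewrite m1 ltry.
  - by apply: measurable_funTS; apply: continuous_measurable_fun; exact: norm_continuous.
  - by move=> y /=; rewrite in_itv /= normr_id ler_norml.
rewrite /wint => w0.
have i0 : (\int[m]_(y in `[(-1)%R, 1%R]) `|y%:E|)%E = 0%E.
  by rewrite -[RHS]/((0:R)%:E) -w0 fineK.
have [M [mM M0 sM]] := (ae_eq_integral_abs m mJm mI).1 i0.
have : (m setT <= m [set 0%R] + (m (~` (`[(-1)%R, 1%R]%classic : set R)) + m M))%E.
  apply: (@le_trans _ _ (m ([set 0%R] `|` (~` (`[(-1)%R, 1%R]%classic : set R) `|` M)))).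
    apply: le_measure; rewrite ?inE //.
      by apply: measurableU => //; apply: measurableU => //; exact: measurableC.
    move=> y _; have [->|y0] := eqVneq y 0; first by left.
    right; have [yJ|yJ] := pselect ((`[(-1)%R, 1%R]%classic : set R) y); [right|by left].
    by apply: sM => /= H; move/eqP: y0; apply; have [] := H yJ.
  apply: (le_trans (measureU2 _ _ _)) => //.
    by apply: measurableU => //; exact: measurableC.
  by apply: leeD => //; apply: measureU2 => //; exact: measurableC.
rewrite mJ M0 m1 !adde0 => h; apply/eqP; rewrite eq_le h andbT -m1.
by apply: le_measure; rewrite ?inE.
Qed.

(** The set of probability measures with vanishing mean of [|y|] is measurable and contains the
    point mass at 0, but no scenery with code in [N], since those do not charge 0. *)
Lemma Qlim_nontrivial : ~ trivial_distr (Qlim : probability (PM R) R).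
Proof.
move=> triv; pose nrm := wint (fun y : R => `|y|).
have cn : cont11 (fun y : R => `|y|).
  by apply: continuous_subspaceT => y; exact: norm_continuous.
have wc : weak_continuous (nrm : PMT R -> R).
  move=> m _ eps e0; exists 1%N, (fun _ y => `|y|), eps; split => //; split => //.
  by move=> m' [_ /(_ ord0)].
pose E : set (PM R) := (Pm11 : set (PM R)) `&` nrm @^-1` [set 0].
have mE : measurable E.
  by apply: (weak_continuous_measurable wc) => //; exact: measurable_Pm11.
have := triv E mE; rewrite diracE mem_set; last first.
  have dE (A : set R) : (delta0 : PMT R) A = ((0 : R) \in A)%:R%:E by exact: diracE.
  split; first split.
  - by rewrite dE in_setT.
  - by rewrite dE memNset //= => H; apply: H; rewrite in_itv /= lerN10 ler01.
  rewrite /= /nrm /wint /delta0 integral_dirac //.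
    by rewrite diracE mem_set ?mul1e ?normr0 //= in_itv /= lerN10 ler01.
  apply/measurable_EFinP; apply: measurable_funTS; apply: continuous_measurable_fun.
  exact: norm_continuous.
have Q0 b : Qside b E = 0%E.
  rewrite QsideE (ge0_negligible_integral (N := ~` N)) //=.
  - rewrite setTD setCK integral0_eq // => z Nz; rewrite /occ (_ : mkset _ = set0) ?measure0 //.
    apply/seteqP; split => s //= [_ [Ps /= ns]].
    have := wint_norm_atom Ps ns; rewrite (F_atom b s Nz) => /eqP.
    by rewrite eq_sym onee_eq0.
  - exact: measurableC.
  - exact: (measurable_occ b mE (measurable_cst _) (measurable_funD (measurable_cst _) measurable_len)).
have : Qlim E = 0%E by rewrite QlimE !Q0 !mule0 adde0 mule0.
move=> H1 H2; have : (0 : \bar R) = 1%E by rewrite -[LHS]H1; exact: H2.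
by move=> /esym /eqP; rewrite onee_eq0.
Qed.

Lemma word_sum n (phi : seq T -> R) (z : Z) :
  phi (mkseq z n) = \sum_(w : n.-tuple T) phi w * \1_(@cyl T t0 w) z.
Proof.
pose w0 : n.-tuple T := Tuple (introT eqP (size_mkseq z n)).
rewrite (bigD1 w0) //= indicE mem_set; last exact: cyl_mkseq.
rewrite mulr1 [X in _ + X]big1 ?addr0 // => w nw; rewrite indicE.
have [cz|cz] := pselect (@cyl T t0 w z); last by rewrite memNset ?mulr0.
exfalso; move/eqP : nw; apply; apply: val_inj => /=.
move/cylP : cz => cz; apply: (@eq_from_nth _ t0); first by rewrite size_mkseq size_tuple.
by move=> i; rewrite size_tuple => i_n; rewrite nth_mkseq // -cz // size_tuple.
Qed.

Local Notation Ex := (Rintegral nu setT).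

Lemma Ex_word n (phi : seq T -> R) :
  Ex (fun z => phi (mkseq z n)) = \sum_(w : n.-tuple T) phi w * fine (nu (@cyl T t0 w)).
Proof.
rewrite (_ : (fun z => _) = fun z : Z => \sum_(w <- index_enum (n.-tuple T)) phi w * \1_(@cyl T t0 w) z); last first.
  by apply/funext => z; exact: word_sum.
have ind1 (w : seq T) z : `|\1_(@cyl T t0 w) z : R| <= 1.
  by rewrite indicE; case: (_ \in _); rewrite ?normr1 ?normr0.
have mi (w : seq T) : measurable_fun [set: Z] (\1_(@cyl T t0 w) : Z -> R).
  by apply: measurable_indic; exact: measurable_cyl.
elim: (index_enum _) => [|w s IH].
  rewrite big_nil (_ : (fun z => _) = cst 0); first by rewrite Rintegral_cst // mul0r.
  by apply/funext => z; rewrite big_nil.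
rewrite big_cons -IH (_ : (fun z => _) = fun z : Z => phi w * \1_(@cyl T t0 w) z +
   \sum_(w <- s) phi w * \1_(@cyl T t0 w) z); last by apply/funext => z; rewrite big_cons.
rewrite RintegralD //; last 2 first.
- apply: (bern_integrable nu (c := `|phi w|)) => //; first exact: measurable_funM.
  by move=> z; rewrite normrM ler_piMr.
- apply: (bern_integrable nu (c := \sum_(w <- s) `|phi w|)) => //.
    by apply: measurable_sum => v; exact: measurable_funM.
  by move=> z; apply: (le_trans (ler_norm_sum _ _ _)); apply: ler_sum => v _; rewrite normrM ler_piMr.
rewrite RintegralZl //; last exact: (bern_integrable nu (c := 1)).
congr (_ * _ + _); rewrite /Rintegral integral_indic ?setIT //; exact: measurable_cyl.
Qed.

Lemma cvg_fsum (J : Type) (s : seq J) (u : J -> nat -> R) (l : J -> R) :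
  (forall j, u j @ \oo --> l j) ->
  (fun n => \sum_(j <- s) u j n) @ \oo --> \sum_(j <- s) l j.
Proof.
move=> H; elim: s => [|j s IH].
  rewrite big_nil [X in X @ _](_ : _ = fun=> 0); first exact: cvg_cst.
  by apply/funext => n; rewrite big_nil.
rewrite big_cons [X in X @ _](_ : _ = fun n => u j n + \sum_(j <- s) u j n); first exact: cvgD.
by apply/funext => n; rewrite big_cons.
Qed.

(** Integral against the product of the orientation weights and [nu], the base measure of the
    suspension. *)
Definition sgwE (phi : bool -> Z -> R) : R := sgw false * Ex (phi false) + sgw true * Ex (phi true).

Definition typical (z : Z) := forall w b,
  (fun n => (\sum_(j < n) (\1_(cyl (t0 := t0) w) ((fun i => z (j + i)%N) : Z) *
      (parity neg (mkseq z j) == b)%:R : R)) / n%:R)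
    @ \oo --> fine (nu (cyl (t0 := t0) w)) * sgw b.

Definition orbsum (phi : bool -> Z -> R) (z : Z) n : R :=
  \sum_(j < n) phi (parity neg (mkseq z j)) ((fun i => z (j + i)%N) : Z).

(** Both the average and its limit are finite combinations over orientations and words of length
    [n], so typicality applies term by term. *)
Lemma word_average n (phi : bool -> seq T -> R) z : typical z ->
  (fun m => orbsum (fun b z => phi b (mkseq z n)) z m / m%:R) @ \oo -->
    sgwE (fun b z => phi b (mkseq z n)).
Proof.
move=> ty.
have -> : sgwE (fun b z => phi b (mkseq z n)) =
    \sum_(x : bool * n.-tuple T) phi x.1 x.2 * (fine (nu (@cyl T t0 x.2)) * sgw x.1).
  rewrite -(pair_bigA _ (fun b (w : n.-tuple T) => phi b w * (fine (nu (@cyl T t0 w)) * sgw b))) /=.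
  rewrite big_bool /= addrC /sgwE !Ex_word !mulr_sumr; congr (_ + _); apply: eq_bigr => w _;
  by rewrite mulrC mulrA.
rewrite [X in X @ _](_ : _ = fun m => \sum_(x : bool * n.-tuple T) phi x.1 x.2 *
   ((\sum_(j < m) (\1_(cyl (t0 := t0) x.2) ((fun i => z (j + i)%N) : Z) *
      (parity neg (mkseq z j) == x.1)%:R : R)) / m%:R)); last first.
  apply/funext => m; under [RHS]eq_bigr do rewrite mulrA mulr_sumr.
  rewrite -mulr_suml exchange_big /=; congr (_ / _); apply: eq_bigr => j _.
  rewrite -(pair_bigA _ (fun b (w : n.-tuple T) => phi b w * (\1_(@cyl T t0 w) ((fun i => z (j + i)%N) : Z) *
      (parity neg (mkseq z j) == b)%:R))) /= big_bool /=.
  case: (parity neg (mkseq z j)) => /=.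
    rewrite [X in _ + X]big1 ?addr0; last by move=> w _; rewrite !mulr0.
    by rewrite (word_sum n (phi true) ((fun i => z (j + i)%N) : Z)); apply: eq_bigr => w _; rewrite mulr1.
  rewrite [X in X + _]big1 ?add0r; last by move=> w _; rewrite !mulr0.
  by rewrite (word_sum n (phi false) ((fun i => z (j + i)%N) : Z)); apply: eq_bigr => w _; rewrite mulr1.
apply: cvg_fsum => x; apply: cvgM; first exact: cvg_cst.
exact: ty.
Qed.

Let N_shiftn n z : N z -> N ((fun i => z (n + i)%N) : Z).
Proof.
elim: n z => [|n IH] z Nz; first by [].
have := IH _ (N_shift Nz); congr (N _); apply/funext => i; by rewrite /shift addSn.
Qed.

Lemma sgwE_le (phi psi : bool -> Z -> R) K :
  (forall b, measurable_fun setT (phi b)) -> (forall b, measurable_fun setT (psi b)) ->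
  (forall b z, `|phi b z| <= K) -> (forall b z, `|psi b z| <= K) ->
  (forall b z, N z -> phi b z <= psi b z) -> sgwE phi <= sgwE psi.
Proof.
move=> m1 m2 b1 b2 H; rewrite /sgwE.
have h b : Ex (phi b) <= Ex (psi b).
  have toN (g : Z -> R) : measurable_fun setT g -> (forall z, `|g z| <= K) -> Ex g = Rintegral nu N g.
    move=> mg gK; rewrite /Rintegral; congr fine.
    rewrite (negligible_integral (N := ~` N)) //=; first by rewrite setTD setCK.
    - exact: measurableC.
    - exact: (bern_integrable nu (c := K)).
  rewrite !toN //; apply: le_Rintegral => //; [exact: (bern_integrable nu (c := K))|exact: (bern_integrable nu (c := K))|].
  by move=> z Nz; exact: H.
by apply: lerD; apply: ler_wpM2l => //; exact: sgw_ge0.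
Qed.

Lemma Ex_indic_prefix n (B : set (seq T)) :
  Ex (fun z => (`[< B (mkseq z n) >])%:R) = fine (nu [set z | B (mkseq z n)]).
Proof.
rewrite /Rintegral -(setIT [set z | _]) -integral_indic //; last exact: measurable_prefix.
Qed.

(** Bad words define a decreasing sequence of events whose intersection misses [N], hence is
    null. *)
Lemma bad_words_small (B : nat -> set (seq T)) (e : R) :
  (forall n z, B n.+1 (mkseq z n.+1) -> B n (mkseq z n)) ->
  (forall z, N z -> exists n, ~ B n (mkseq z n)) -> 0 < e ->
  exists n, fine (nu [set z | B n (mkseq z n)]) < e.
Proof.
move=> dec ex e0; pose G n : set Z := [set z | B n (mkseq z n)].
have mG n : measurable (G n) by exact: (measurable_prefix n (B n)).
have cv : nu \o G @ \oo --> nu (\bigcap_n G n).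
  apply: nonincreasing_cvg_mu => //.
  - by rewrite (le_lt_trans (probability_le1 _ _)) // ltry.
  - exact: bigcapT_measurable.
  - by apply/nonincreasing_seqP => n; apply/subsetPset => z; exact: dec.
have G0 : nu (\bigcap_n G n) = 0%E.
  apply: (subset_measure0 (B := ~` N)) => //; first exact: bigcapT_measurable.
    exact: measurableC.
  by move=> z Gz Nz; have [n] := ex z Nz; apply; exact: Gz.
have /cvgrPdist_lt /(_ _ e0) [n _ /(_ n (leqnn n))] : (fine \o (nu \o G)) @ \oo --> (0 : R).
  by apply: fine_cvg; rewrite -[X in _ --> X]G0.
by rewrite /= sub0r normrN ger0_norm; [exists n|rewrite fine_ge0].
Qed.

Let small_osc (h : bool -> Z -> R) (e : R) (w : seq T) := forall b (z' z'' : Z),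
  N z' -> N z'' -> @cyl T t0 w z' -> @cyl T t0 w z'' -> `|h b z' - h b z''| <= e.

(* h is only continuous on N, so it is squeezed between two functions of the first n letters that differ by little except on words of small total measure. *)
Lemma orbit_average (h : bool -> Z -> R) K z :
  (forall b, measurable_fun setT (h b)) -> (forall b z, `|h b z| <= K) ->
  (forall b z eps, N z -> 0 < eps -> exists m, forall z' : Z, N z' ->
    (forall i, (i < m)%N -> z i = z' i) -> `|h b z' - h b z| < eps) ->
  typical z -> N z -> (fun n => orbsum h z n / n%:R) @ \oo --> sgwE h.
Proof.
move=> mh hK ch ty Nz; have K0 : 0 <= K by exact: le_trans (hK true z).
apply/cvgrPdist_lt => eps eps0.
(* Chosen so that [2 * (e + 2 * K * e)], which bounds the gap [U - L], equals [eps / 2]; the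
   convergence of each word average takes another [eps / 4]. *)
pose e := eps / (4 * (1 + 2 * K)).
have e0 : 0 < e by rewrite divr_gt0 // mulr_gt0 //; lra.
have [n nB] : exists n, fine (nu [set z | (~` small_osc h e) (mkseq z n)]) < e.
  apply: (@bad_words_small (fun n => ~` small_osc h e)) => //.
    move=> n y; apply: contra_not => H b z' z'' N1 N2 c1 c2; apply: H => //;
    by apply/cylP => i; move/cylP : c1 c2; rewrite !size_mkseq => c1 /cylP c2 ni;
      rewrite ?c1 ?c2 ?size_mkseq ?(leq_trans ni) // !nth_mkseq ?(leq_trans ni).
  move=> y Ny; have e2 : 0 < e / 2 by lra.
  have [m1 H1] := ch false y _ Ny e2; have [m2 H2] := ch true y _ Ny e2.
  exists (maxn m1 m2); apply => b z' z'' N1 N2 c1 c2.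
  have ag (x : Z) : @cyl T t0 (mkseq y (maxn m1 m2)) x -> forall i, (i < maxn m1 m2)%N -> y i = x i.
    by move/cylP => c i im; rewrite c ?size_mkseq // nth_mkseq.
  have a1 := ag _ c1; have a2 := ag _ c2.
  have Hb (x : Z) : N x -> (forall i, (i < maxn m1 m2)%N -> y i = x i) -> `|h b x - h b y| < e / 2.
    move=> Nx ax; case: b; [apply: H2|apply: H1] => // i im; apply: ax.
      exact: leq_trans im (leq_maxr _ _).
    exact: leq_trans im (leq_maxl _ _).
  have h1 := Hb _ N1 a1; have h2 := Hb _ N2 a2.
  rewrite (_ : _ - _ = (h b z' - h b y) - (h b z'' - h b y)); last by ring.
  by rewrite (le_trans (ler_normB _ _)) // ltW //; lra.
pose good w := small_osc h e w.
(* A representative in [N] of every word that has one; [z] is the default for the other words. *)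
have /choice [rep Hrep] : forall w : seq T, exists y : Z, (exists2 x, N x & @cyl T t0 w x) -> N y /\ @cyl T t0 w y.
  move=> w; have [[x Nx cx]|H] := pselect (exists2 x, N x & @cyl T t0 w x); first by exists x.
  by exists z.
pose g b w := h b (rep w).
pose er (w : seq T) : R := e + 2 * K * (`[< (~` good) w >])%:R.
have sand b y : N y -> `|h b y - g b (mkseq y n)| <= er (mkseq y n).
  move=> Ny; have [Nr cr] : N (rep (mkseq y n)) /\ @cyl T t0 (mkseq y n) (rep (mkseq y n)).
    by apply: Hrep; exists y => //; exact: cyl_mkseq.
  rewrite /er; case: asboolP => [_|/contrapT gw].
    rewrite mulr1; apply: (le_trans (ler_normB _ _)); have := hK b y; have := hK b (rep (mkseq y n)).
    rewrite /g; lra.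
  by rewrite mulr0 addr0; apply: gw => //; exact: cyl_mkseq.
pose up b w := g b w + er w; pose lo b w := g b w - er w.
have er0 w : 0 <= er w <= e + 2 * K.
  by rewrite /er; case: (`[< _ >]); rewrite ?mulr1 ?mulr0; apply/andP; split; lra.
have mw (f : seq T -> R) : measurable_fun [set: Z] (fun z => f (mkseq z n)) by exact: measurable_fun_prefix.
pose U := sgwE (fun b z => up b (mkseq z n)); pose L := sgwE (fun b z => lo b (mkseq z n)).
have gK b w : `|g b w| <= K by exact: hK.
have Kup b w : `|up b w| <= e + 3 * K.
  by rewrite (le_trans (ler_normD _ _)) // (ger0_norm (proj1 (andP (er0 w)))) //; have := gK b w; have /andP[_] := er0 w; lra.
have Klo b w : `|lo b w| <= e + 3 * K.
  by rewrite (le_trans (ler_normB _ _)) // (ger0_norm (proj1 (andP (er0 w)))) //; have := gK b w; have /andP[_] := er0 w; lra.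
have K3 b y : `|h b y| <= e + 3 * K by have := hK b y; lra.
have LS : L <= sgwE h.
  apply: (@sgwE_le _ _ (e + 3 * K)) => // b y Ny; have := sand b y Ny; rewrite ler_distl /lo.
  by move/andP => [].
have SU : sgwE h <= U.
  apply: (@sgwE_le _ _ (e + 3 * K)) => // b y Ny; have := sand b y Ny; rewrite ler_distl /up.
  by move/andP => [].
have UL : U - L <= eps / 2.
  have iw (f : seq T -> R) M : (forall w, `|f w| <= M) -> nu.-integrable setT (EFin \o (fun z : Z => f (mkseq z n))).
    by move=> fM; apply: (bern_integrable nu (c := M)).
  have erK w : `|er w| <= e + 2 * K by have /andP[h1 h2] := er0 w; rewrite ger0_norm.
  have Eup b : Ex (fun z => up b (mkseq z n)) = Ex (fun z => g b (mkseq z n)) + Ex (fun z => er (mkseq z n)).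
    by rewrite -RintegralD //; [exact: (iw (g b) K)|exact: (iw er (e + 2 * K))].
  have Elo b : Ex (fun z => lo b (mkseq z n)) = Ex (fun z => g b (mkseq z n)) - Ex (fun z => er (mkseq z n)).
    by rewrite -RintegralB //; [exact: (iw (g b) K)|exact: (iw er (e + 2 * K))].
  have Eer : Ex (fun z => er (mkseq z n)) <= e + 2 * K * e.
    pose ind (w : seq T) : R := (`[< (~` good) w >])%:R.
    have i1 w : `|ind w| <= 1 by rewrite /ind; case: (`[< _ >]); rewrite ?normr1 ?normr0.
    have eE : Ex (fun z => er (mkseq z n)) = e + 2 * K * Ex (fun z => ind (mkseq z n)).
      rewrite -(RintegralZl (2 * K) measurableT (iw ind 1 i1)).
      rewrite -[X in X + _](_ : Ex (fun=> e) = e); last first.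
        by rewrite (Rintegral_cst nu measurableT e) [X in fine X]probability_setT mulr1.
      rewrite -RintegralD //; first exact: (bern_integrable nu (c := `|e|)).
      apply: (iw (fun w => 2 * K * ind w) (2 * K)) => w; rewrite normrM ger0_norm ?ler_piMr //; lra.
    rewrite eE lerD2l; apply: ler_wpM2l; first lra.
    rewrite (_ : Ex _ = fine (nu [set z | (~` small_osc h e) (mkseq z n)])) ?ltW //.
    exact: (Ex_indic_prefix n (~` good)).
  have h1 := sgw_sum.
  have -> : U - L = (sgw false + sgw true) * (2 * Ex (fun z => er (mkseq z n))).
    by rewrite /U /L /sgwE !Eup !Elo; ring.
  rewrite h1 mul1r (_ : eps / 2 = 2 * (e + 2 * K * e)); first by rewrite ler_pM2l.
  by rewrite /e; field; apply/eqP; lra.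
have av_le (phi psi : bool -> Z -> R) m : (forall b y, N y -> phi b y <= psi b y) ->
    orbsum phi z m / m%:R <= orbsum psi z m / m%:R.
  move=> H; rewrite ler_wpM2r ?invr_ge0 //; apply: ler_sum => j _; apply: H; exact: N_shiftn.
have eps4 : 0 < eps / 4 by lra.
have /cvgrPdist_lt /(_ _ eps4) aU := @word_average n up z ty.
have /cvgrPdist_lt /(_ _ eps4) aL := @word_average n lo z ty.
near=> m.
have uU : `|U - orbsum (fun b z => up b (mkseq z n)) z m / m%:R| < eps / 4 by near: m.
have uL : `|L - orbsum (fun b z => lo b (mkseq z n)) z m / m%:R| < eps / 4 by near: m.
have h1 : orbsum h z m / m%:R <= orbsum (fun b z => up b (mkseq z n)) z m / m%:R.
  by apply: av_le => b y Ny; have := sand b y Ny; rewrite ler_distl /up => /andP[].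
have h2 : orbsum (fun b z => lo b (mkseq z n)) z m / m%:R <= orbsum h z m / m%:R.
  by apply: av_le => b y Ny; have := sand b y Ny; rewrite ler_distl /lo => /andP[].
move: uU uL; rewrite !ltr_distl => /andP[u1 u2] /andP[u3 u4].
apply/andP; split; lra.
Unshelve. all: by end_near. Qed.

(** * Time averages of bounded nonnegative observables along one orbit *)

Section Generation.
Hypothesis C_ge0 : 0 <= C.
Variables (f : PMT R -> R) (B : R).
Hypothesis wf : weak_continuous f.
Hypothesis f_ge0 : forall m, Pm11 m -> 0 <= f m.
Hypothesis f_le : forall m, Pm11 m -> f m <= B.

Let B_ge0 : 0 <= B.
Proof. exact: le_trans (f_ge0 (F_Pm11 true (fun=> t0) 0)) (f_le _). Qed.

Definition tint b (a c : R) z : \bar R :=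
  (\int[lebesgue_measure]_(s in `[a, c[) (f (F b z s))%:E)%E.

Lemma measurable_fF b : measurable_fun [set: Z * R] (fun x : Z * R => f (F b x.1 x.2)).
Proof.
have mf : measurable_fun (Pm11 : set (PM R)) (f : PM R -> R) := weak_continuous_measurable wf.
apply: (measurable_comp (F := (Pm11 : set (PM R))) (f := f : PM R -> R)
  (g := fun x : Z * R => F b x.1 x.2 : PM R)) => //.
- exact: measurable_Pm11.
- by move=> _ [x _ <-]; exact: F_Pm11.
- exact: measurable_F.
Qed.

Lemma measurable_fs b z : measurable_fun [set: R] (fun s : R => f (F b z s)).
Proof. exact: (measurableT_comp (measurable_fF b) (pair1_measurable z)). Qed.

Let mfE b z (D : set R) : measurable_fun D (fun s : R => (f (F b z s))%:E).
Proof. by apply: measurable_funTS; apply/measurable_EFinP; exact: measurable_fs. Qed.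

Let f0E b z s : (0 <= (f (F b z s))%:E)%E.
Proof. by rewrite lee_fin; apply: f_ge0; exact: F_Pm11. Qed.

Let len_itv (a c : R) : a <= c -> lebesgue_measure (`[a, c[%classic : set R) = (c - a)%:E.
Proof.
rewrite lebesgue_measure_itv /= lte_fin le_eqVlt => /predU1P[->|->] //.
by rewrite ltxx subrr.
Qed.

Lemma tint_ge0 b a c z : (0 <= tint b a c z)%E.
Proof. exact: integral_ge0. Qed.

Lemma tint_close b a c z z' e : a <= c -> 0 <= e ->
  (forall s, a <= s < c -> f (F b z' s) <= f (F b z s) + e) ->
  (tint b a c z' <= tint b a c z + (e * (c - a))%:E)%E.
Proof.
move=> ac e0 H.
have -> : (e * (c - a))%:E = (\int[lebesgue_measure]_(s in `[a, c[) (cst e%:E s))%E.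
  by rewrite integral_cst // [X in (_ * X)%E]len_itv.
rewrite /tint -ge0_integralD //; last exact: mfE.
apply: ge0_le_integral => //.
- exact: mfE.
- by apply: emeasurable_funD => //; exact: mfE.
Qed.

Lemma tint_le b a c z : a <= c -> (tint b a c z <= (B * (c - a))%:E)%E.
Proof.
move=> ac.
have -> : (B * (c - a))%:E = (\int[lebesgue_measure]_(s in `[a, c[) (cst B%:E s))%E.
  by rewrite integral_cst // [X in (_ * X)%E]len_itv.
by apply: ge0_le_integral => //; [exact: mfE|move=> s _ /=; rewrite lee_fin f_le].
Qed.

Lemma tint_fin b a c z : a <= c -> tint b a c z \is a fin_num.
Proof.
by move=> ac; rewrite ge0_fin_numE ?tint_ge0 // (le_lt_trans (tint_le b z ac)) // ltry.
Qed.

Lemma tint_split b a e c z : a <= e -> e <= c ->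
  tint b a c z = (tint b a e z + tint b e c z)%E.
Proof.
move=> ae ec; rewrite /tint -ge0_integral_setU //.
- congr (integral _ _ _); apply/seteqP; split => s /=; rewrite !in_itv /=.
    by case/andP => s1 s2; case: (ltP s e) => se; [left|right]; apply/andP; split.
  by case=> /andP[s1 s2]; apply/andP; split; lra.
- exact: mfE.
- by apply/disj_setPS => s /= []; rewrite !in_itv /= => /andP[_ s1] /andP[s2 _]; lra.
Qed.

Lemma integral_translate (u a c : R) (g : R -> \bar R) : measurable_fun setT g ->
  (forall s, 0 <= g s)%E ->
  (\int[lebesgue_measure]_(s in `[(a + u)%R, (c + u)%R[) g s =
   \int[lebesgue_measure]_(s in `[a, c[) g (s + u)%R)%E.
Proof.
move=> mg g0.
have mf : measurable_fun [set: measurableTypeR R]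
    ((fun s => s + u) : measurableTypeR R -> measurableTypeR R) := measurable_translate u.
transitivity (\int[push (@lebesgue_measure R) mf]_(s in `[(a + u)%R, (c + u)%R[) g s)%E.
  by apply: eq_measure_integral => A mA _; exact/esym/lebesgue_translate.
have := @ge0_integral_pushforward _ _ _ _ _ _ mf (@lebesgue_measure R) `[(a + u)%R, (c + u)%R[%classic g.
move=> ->; last first.
- by move=> y _.
- exact: measurable_funTS.
- exact: measurable_itv.
congr (integral _ _ _); apply/seteqP; split => s /=; by rewrite !in_itv /= lerD2r ltrD2r.
Qed.

Lemma tint_step b a c z : C <= a ->
  tint b (a + ell (z 0%N)) (c + ell (z 0%N)) z = tint (b (+) neg (z 0%N)) a c (shift z).
Proof.
move=> Ca; rewrite /tint.
rewrite integral_translate; last 2 first.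
- exact: mfE.
- by move=> s; exact: f0E.
apply: eq_integral => s; rewrite inE /= in_itv /= => /andP[as_ _]; congr (_%:E).
by apply: (meq_weak_continuous wf (F_Pm11 _ _ _)); apply: F_step; exact: le_trans Ca as_.
Qed.

Lemma parity_mkseq (z : nat -> T) j :
  parity neg (mkseq z j.+1) = neg (z 0%N) (+) parity neg (mkseq (shift z) j).
Proof. by rewrite /mkseq /= -[1%N]addn0 iotaDl -map_comp. Qed.

(** Cutting the time axis at the roof crossings turns a time integral into an orbit sum of the skew
    product, each term being an integral over one roof. *)
Lemma tint_orbit b z n : tint b C (C + \sum_(j < n) ell (z j)) z =
  (\sum_(j < n) tint (b (+) parity neg (mkseq z j)) C (C + ell (z j))
     ((fun i => z (j + i)%N) : Z))%E.
Proof.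
elim: n b z => [|n IH] b z.
  by rewrite !big_ord0 addr0 /tint set_itvco0 integral_set0.
rewrite big_ord_recl [RHS]big_ord_recl [parity neg (mkseq z (@ord0 n))](_ : _ = false) // addbF.
rewrite (tint_split b z (_ : C <= C + ell (z 0%N))); last 2 first.
- by rewrite lerDl ltW.
- by rewrite addrA lerDl sumr_ge0 // => j _; rewrite ltW.
congr (_ + _)%E.
rewrite [C + (_ + _)]addrCA [ell _ + _]addrC tint_step //.
have := IH (b (+) neg (z 0%N)) (shift z).
rewrite (_ : \sum_(j < n) ell (shift z j) = \sum_(i < n) ell (z (lift ord0 i))) // => ->.
by apply: eq_bigr => j _; rewrite lift0 parity_mkseq addbA.
Qed.

Definition hf b z : R := fine (tint b C (C + ell (z 0%N)) z).

Let C_len z : C <= C + ell (z 0%N). Proof. by rewrite lerDl ltW. Qed.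

Let lmax_ge0 : 0 <= lmax. Proof. exact: le_trans (ltW (ell_gt0 t0)) (le_lmax t0). Qed.

Lemma hf_bound b z : `|hf b z| <= B * lmax.
Proof.
rewrite ger0_norm ?fine_ge0 ?tint_ge0 // -lee_fin fineK; last exact: tint_fin.
apply: (le_trans (tint_le b z (C_len z))).
by rewrite lee_fin ler_wpM2l // addrAC subrr add0r.
Qed.

Let D0 := strip (cst C) (fun z => C + ell (z 0%N)).

(** The integrand extended by zero outside the region under the roof, the form in which Tonelli's
    theorem handles a roof that depends on the code. *)
Let cut b (x : Z * R) : R := f (F b x.1 x.2) * \1_D0 x.

Let measurable_cut b : measurable_fun setT (fun x => (cut b x)%:E).
Proof.
apply/measurable_EFinP; apply: measurable_funM; first exact: measurable_fF.
exact: measurable_indic.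
Qed.

Let cut_ge0 b x : (0 <= (cut b x)%:E)%E.
Proof. by rewrite lee_fin mulr_ge0 // f_ge0. Qed.

Let tint_cut b z : tint b C (C + ell (z 0%N)) z = (\int[lebesgue_measure]_s (cut b (z, s))%:E)%E.
Proof.
rewrite /tint integral_mkcond; apply: eq_integral => s _; rewrite /patch /cut indicE /D0 /strip.
have -> : ((z, s) \in [set x : Z * R | cst C x.1 <= x.2 < C + ell (x.1 0%N)]) =
   (s \in (`[C, C + ell (z 0%N)[%classic : set R)).
  by apply/idP/idP; rewrite !inE /= ?in_itv.
by case: (s \in _); rewrite ?mulr1 ?mulr0.
Qed.

Lemma measurable_tint b : measurable_fun setT (fun z => tint b C (C + ell (z 0%N)) z).
Proof.
have := @measurable_fun_fubini_tonelli_F _ _ Z (measurableTypeR R) R (@lebesgue_measure R)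
  (fun x => (cut b x)%:E) (measurable_cut b) (cut_ge0 b).
by congr (measurable_fun _ _); apply/funext => z; rewrite tint_cut.
Qed.

Lemma measurable_hf b : measurable_fun setT (hf b).
Proof.
by apply: (measurableT_comp (f := fine)) => //; exact: measurable_tint.
Qed.

Let mPm : measurable (Pm11 : set (PM R)). Proof. exact: measurable_Pm11. Qed.

Lemma Qside_integral b : (\int[Qside b]_m (((f : PM R -> R) \_ (Pm11 : set (PM R))) m)%:E)%E =
  (Rintegral nu setT (hf b))%:E.
Proof.
pose phi := (f : PM R -> R) \_ (Pm11 : set (PM R)).
have mphi : measurable_fun setT phi.
  exact: ((measurable_restrictT (f : PM R -> R) mPm).1 (@weak_continuous_measurable R f wf)).
have phiF b' z s : phi (F b' z s) = f (F b' z s).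
  by rewrite /phi /patch mem_set //; exact: F_Pm11.
have phib m : `|phi m| <= B.
  rewrite /phi /patch; case: ifPn => [/set_mem Pm|_]; last by rewrite normr0.
  by rewrite ger0_norm ?f_ge0 // f_le.
have integ : (mrestr (nu \x (@lebesgue_measure R))%E mD0).-integrable setT
    (EFin \o (fun x : Z * R => phi (F b x.1 x.2 : PM R))).
  apply: (le_bounded_integrable (B := B)) => //.
    suff : (Qside b setT < +oo)%E by [].
    by rewrite Qside_full // ltry.
  exact: (measurableT_comp mphi (measurable_F b)).
have mphiE : measurable_fun setT (EFin \o phi) by exact/measurable_EFinP.
have gen : forall m : {measure set (Z * measurableTypeR R)%type -> \bar R},
    m.-integrable setT (EFin \o (fun x : Z * R => phi (F b x.1 x.2 : PM R))) ->
    (\int[push m (measurable_F b)]_y (EFin \o phi) y =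
     \int[m]_x (phi (F b x.1 x.2 : PM R))%:E)%E.
  by move=> m im; rewrite (@integral_push _ _ _ _ _ m _ (measurable_F b) _ mphiE im).
have pushE := gen (mrestr (nu \x (@lebesgue_measure R))%E mD0) integ.
transitivity (\int[mrestr (nu \x (@lebesgue_measure R))%E mD0]_x (phi (F b x.1 x.2 : PM R))%:E)%E.
  exact: pushE.
rewrite integral_mrestr; last exact: integ.
transitivity (\int[(nu \x (@lebesgue_measure R))%E]_x (cut b x)%:E)%E.
  rewrite integral_mkcond; apply: eq_integral => x _.
  rewrite [in LHS]/patch /cut indicE; case: ifPn => xD.
    by rewrite mulr1 phiF.
  by rewrite mulr0.
rewrite (@fubini_tonelli1 _ _ Z (measurableTypeR R) R nu (@lebesgue_measure R)
  (fun x => (cut b x)%:E) (measurable_cut b) (cut_ge0 b)).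
rewrite /Rintegral fineK; last first.
  apply: integrable_fin_num => //.
  by apply: (bern_integrable nu (c := B * lmax)) => //; [exact: measurable_hf|move=> z; exact: hf_bound].
apply: eq_integral => z _; rewrite /fubini_F -tint_cut /hf fineK //; exact: tint_fin.
Qed.

Lemma Qlim_integral : Rintegral Qlim (Pm11 : set (PM R)) f = mean_len^-1 * sgwE hf.
Proof.
pose phi := (f : PM R -> R) \_ (Pm11 : set (PM R)).
have mphi : measurable_fun setT (EFin \o phi).
  apply/measurable_EFinP.
  exact: ((measurable_restrictT (f : PM R -> R) mPm).1 (@weak_continuous_measurable R f wf)).
have phi0 m : (0 <= (EFin \o phi) m)%E.
  rewrite /= lee_fin /phi /patch; case: ifPn => [/set_mem Pm|//]; exact: f_ge0.
rewrite /Rintegral integral_mkcond.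
rewrite (eq_integral (EFin \o phi)); last by move=> m _; rewrite /= /phi /patch; case: (m \in _).
rewrite [X in fine X](_ : _ = ((mean_len^-1)%:E * ((sgw false)%:E * (Rintegral nu setT (hf false))%:E
    + (sgw true)%:E * (Rintegral nu setT (hf true))%:E))%E); first by rewrite -!EFinM.
rewrite -!Qside_integral.
transitivity ((mean_len^-1)%:E * \int[measure_add (mscale (NngNum (sgw_ge0 false)) (Qside false))
     (mscale (NngNum (sgw_ge0 true)) (Qside true))]_m (EFin \o phi) m)%E.
  transitivity (\int[mscale (NngNum mean_len_inv_ge0) (measure_add (mscale (NngNum (sgw_ge0 false)) (Qside false))
     (mscale (NngNum (sgw_ge0 true)) (Qside true)))]_m (EFin \o phi) m)%E; first by [].
  by rewrite ge0_integral_mscale.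
congr (_ * _)%E; rewrite ge0_integral_measure_add // !ge0_integral_mscale //.
Qed.

Lemma weak_open_near (m : PMT R) e : Pm11 m -> 0 < e ->
  weak_open [set m' | Pm11 m' /\ `|f m' - f m| < e].
Proof.
move=> Pm e0; split=> [m' []//|m' /= [Pm' m'e]].
have d0 : 0 < e - `|f m' - f m| by rewrite subr_gt0.
have [n [g [del [del0 [cg H]]]]] := wf Pm' d0.
exists n, g, del; split => //; split => // m'' wm; split; first by case: wm.
rewrite (_ : f m'' - f m = (f m'' - f m') + (f m' - f m)); last by ring.
by rewrite (le_lt_trans (ler_normD _ _)) // -ltrBrDr; exact: H.
Qed.

(** Continuity of [f] along [F] at each height is made uniform over the compact interval of heights,
    which gives one prefix length valid for all of them. *)
Lemma hf_continuous b z eps : N z -> 0 < eps -> exists m, forall z' : Z, N z' ->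
  (forall i, (i < m)%N -> z i = z' i) -> `|hf b z' - hf b z| < eps.
Proof.
move=> Nz eps0; pose e := eps / (2 * (lmax + 1)).
have lm1 : 0 < lmax + 1 by rewrite ltr_wpDl.
have e0 : 0 < e by rewrite divr_gt0 // mulr_gt0.
have cov := (compact_near_coveringP (`[C, C + ell (z 0%N)]%classic : set R)).1 (@segment_compact R _ _).
have := cov nat (\oo : set_system nat) (fun n s => forall z' : Z, N z' ->
  (forall i, (i < n)%N -> z i = z' i) -> `|f (F b z' s) - f (F b z s)| < e) _.
case.
  move=> s _; have e20 : 0 < e / 2 by lra.
  have Us : [set m' | Pm11 m' /\ `|f m' - f (F b z s)| < e / 2] (F b z s).
    by split; [exact: F_Pm11|rewrite subrr normr0].
  have := F_near (weak_open_near (F_Pm11 b z s) e20) Nz Us.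
  apply: filterS => -[s' n] /= H z' Nz' ag.
  have [_ h1] := H z' Nz' ag; have [_ h2] := H z Nz (fun i _ => erefl).
  rewrite (_ : _ - _ = (f (F b z' s') - f (F b z s)) - (f (F b z s') - f (F b z s))); last by ring.
  by rewrite (le_lt_trans (ler_normB _ _)) //; lra.
(* At least one letter must agree, so that both codes have the same roof. *)
move=> n _ Hn; exists (maxn n 1) => z' Nz' ag.
have ez : z' 0%N = z 0%N by rewrite ag // leq_max orbT.
have cl s : C <= s < C + ell (z 0%N) -> `|f (F b z' s) - f (F b z s)| < e.
  move=> /andP[s1 s2]; apply: (Hn n (leqnn n) s) => //=; first by rewrite in_itv /= s1 ltW.
  by move=> i i_n; apply: ag; rewrite (leq_trans i_n) // leq_maxl.
have h1 : (tint b C (C + ell (z 0%N)) z' <= tint b C (C + ell (z 0%N)) z + (e * (C + ell (z 0%N) - C))%:E)%E.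
  apply: tint_close => //; first exact: ltW.
  by move=> s /cl; rewrite ltr_distl => /andP[_]; lra.
have h2 : (tint b C (C + ell (z 0%N)) z <= tint b C (C + ell (z 0%N)) z' + (e * (C + ell (z 0%N) - C))%:E)%E.
  apply: tint_close => //; first exact: ltW.
  by move=> s /cl; rewrite ltr_distl => /andP[+ _]; lra.
have f1 := tint_fin b z (C_len z); have f2 := tint_fin b z' (C_len z).
move: h1 h2; rewrite -(fineK f1) -(fineK f2) -!EFinD !lee_fin => h1 h2.
rewrite /hf ez ltr_distl.
have : e * (C + ell (z 0%N) - C) < eps.
  have -> : C + ell (z 0%N) - C = ell (z 0%N) by ring.
  apply: (@le_lt_trans _ _ (e * (lmax + 1))).
    by apply: ler_wpM2l; [exact: ltW|have := le_lmax (z 0%N); lra].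
  have -> : e * (lmax + 1) = eps / 2 by rewrite /e; field; lra.
  lra.
by move=> h3; apply/andP; split; lra.
Qed.

Lemma floor_time z (S : R) : 0 <= S -> exists n,
  \sum_(j < n) ell (z j) <= S < \sum_(j < n.+1) ell (z j).
Proof.
move=> S0; pose L n := \sum_(j < n) ell (z j).
have Llow n : n%:R * lmin <= L n.
  rewrite -[n in n%:R]card_ord -sum1_card natr_sum mulr_suml; apply: ler_sum => j _.
  by rewrite mul1r.
have ex0 : exists n, L n <= S by exists 0%N; rewrite /L big_ord0.
have ub n : L n <= S -> (n <= Num.bound (S / lmin))%N.
  move=> LS; rewrite -(ler_nat R) ltW //; apply: le_lt_trans (archi_boundP _).
    by rewrite ler_pdivlMr // (le_trans (Llow n)).
  by rewrite divr_ge0 // ltW.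
case: (ex_maxnP ex0 ub) => n Ln Hn; exists n; rewrite Ln ltNge; apply/negP => /Hn.
by rewrite ltnn.
Qed.

Let avg_div (a b s e : R) : 0 < s -> `|a * s - b| < e * s -> `|a - s^-1 * b| < e.
Proof.
move=> s0 h; rewrite (_ : a - _ = (a * s - b) / s); last by field; rewrite gt_eqF.
by rewrite normrM normfV (gtr0_norm s0) ltr_pdivrMr.
Qed.

Let fine3 (a b c : \bar R) : a \is a fin_num -> b \is a fin_num -> c \is a fin_num ->
  fine (a + b + c)%E = fine a + fine b + fine c.
Proof. by move=> /fineK <- /fineK <- /fineK <-. Qed.

(** Subtracting [q] times the roof length makes the integral over one roof have mean zero in the
    base. The orbit sum of the difference is then small against the number of crossings, which is at
    most [S / lmin], and the subtracted part is [q] times the elapsed time. *)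
Lemma time_average z : typical z -> N z ->
  (fun S : R => S^-1 * Rintegral lebesgue_measure `[0, S]%classic (fun s => f (F false z s)))
    @ +oo --> mean_len^-1 * sgwE hf.
Proof.
move=> ty Nz; set q := mean_len^-1 * _.
pose H b z := hf b z - q * ell (z 0%N).
have mlen : measurable_fun setT (fun z => q * ell (z 0%N)).
  by apply: measurable_funM => //; exact: measurable_len.
have KH b y : `|H b y| <= B * lmax + `|q| * lmax.
  rewrite (le_trans (ler_normB _ _)) // lerD ?hf_bound // normrM ler_wpM2l //.
  by rewrite gtr0_norm.
have H0 : sgwE H = 0.
  have EH b : Rintegral nu setT (H b) = Rintegral nu setT (hf b) - q * mean_len.
    rewrite /H RintegralB //; last 2 first.
    - by apply: (bern_integrable nu (c := B * lmax)) => //; [exact: measurable_hf|exact: hf_bound].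
    - apply: (bern_integrable nu (c := `|q| * lmax)) => // y.
      by rewrite normrM ler_wpM2l // gtr0_norm.
    by rewrite RintegralZl.
  transitivity (sgwE hf - (sgw false + sgw true) * (q * mean_len)).
    by rewrite /sgwE !EH; ring.
  rewrite sgw_sum mul1r /q mulrAC mulVf ?mul1r ?subrr // gt_eqF // mean_len_gt0 //.
have aH : (fun n => orbsum H z n / n%:R) @ \oo --> (0 : R).
  rewrite -H0; apply: (orbit_average (K := B * lmax + `|q| * lmax)) => //.
    by move=> b; apply: measurable_funB => //; exact: measurable_hf.
  move=> b y eps Ny eps0; have [m Hm] := hf_continuous b Ny eps0.
  exists (maxn m 1) => z' Nz' ag; rewrite /H (ag 0%N) ?leq_max ?orbT //.
  by rewrite (_ : _ - _ = hf b z' - hf b y) ?Hm //; [move=> i im; apply: ag; rewrite (leq_trans im) // leq_maxl|ring].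
(* The finitely many initial sums go into [M], which makes the estimate valid for every number of
   crossings. *)
have sub (eps : R) : 0 < eps -> exists M, 0 <= M /\ forall n, `|orbsum H z n| <= eps * n%:R + M.
  move=> eps0; move/cvgrPdist_lt : aH => /(_ _ eps0) [n0 _ Hn0].
  exists (\sum_(n < n0) `|orbsum H z n|); split; first exact: sumr_ge0.
  move=> n; have [n0n|nn0] := leqP n0 n.
    have := Hn0 n n0n; rewrite /= sub0r normrN normrM normfV (ger0_norm (ler0n _ n)) => h.
    have s0 : 0 <= \sum_(n < n0) `|orbsum H z n| by exact: sumr_ge0.
    case: n n0n h => [|n] n0n h; first by rewrite /orbsum big_ord0 normr0 mulr0 add0r.
    by move: h; rewrite ltr_pdivrMr ?ltr0n // => h; lra.
  rewrite (bigD1 (Ordinal nn0)) //= [X in _ <= X]addrCA lerDl addr_ge0 ?sumr_ge0 //.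
  by rewrite mulr_ge0 // ltW.
apply/cvgrPdist_lt => e e0.
have eps0 : 0 < e * lmin / 2 by rewrite divr_gt0 // mulr_gt0.
have [M [M0 HM]] := sub _ eps0.
(* The contributions are, in order, the initial stretch [[0, C]], the unfinished last roof, [q]
   times the difference of [S] and [L], and the constant [M]. *)
pose K := B * C + B * lmax + `|q| * (C + lmax) + M.
near=> S.
have SC : C < S by near: S; apply: nbhs_pinfty_gt; exact: num_real.
have SK : 2 * K / e < S by near: S; apply: nbhs_pinfty_gt; exact: num_real.
have S0 : 0 < S by exact: le_lt_trans SC.
have [n /andP[n1 n2]] : exists n, \sum_(j < n) ell (z j) <= S - C < \sum_(j < n.+1) ell (z j).
  by apply: floor_time; lra.
set L := \sum_(j < n) ell (z j) in n1.
have n2' : S - C < L + lmax.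
  by apply: (lt_le_trans n2); rewrite big_ord_recr lerD2l.
have L0 : 0 <= L by rewrite sumr_ge0 // => j _; rewrite ltW.
have nL : n%:R * lmin <= L.
  rewrite -[n in n%:R]card_ord -sum1_card natr_sum mulr_suml; apply: ler_sum => j _.
  by rewrite mul1r.
have -> : Rintegral lebesgue_measure `[0, S]%classic (fun s => f (F false z s)) = fine (tint false 0 S z).
  rewrite /Rintegral /tint; congr fine.
  by rewrite -integral_itv_bndo_bndc.
have CL : C <= C + L by lra.
have LS : C + L <= S by lra.
have -> : fine (tint false 0 S z) = fine (tint false 0 C z) + (orbsum H z n + q * L) + fine (tint false (C + L) S z).
  rewrite (tint_split false z C_ge0 (ltW SC)) (tint_split false z CL LS) addeA.
  transitivity (fine (tint false 0 C z) + fine (tint false C (C + L) z) + fine (tint false (C + L) S z)).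
    by apply: fine3; apply: tint_fin.
  congr (_ + _ + _).
  rewrite tint_orbit (_ : (\sum_(j < n) _)%E = (\sum_(j < n) hf (parity neg (mkseq z j)) ((fun i => z (j + i)%N) : Z))%:E).
    rewrite /= /orbsum /L mulr_sumr -big_split; apply: eq_bigr => j _.
    by rewrite /H /= addn0 subrK.
  rewrite -sumEFin; apply: eq_bigr => j _; rewrite /hf addn0 fineK //.
  by apply: tint_fin; rewrite lerDl ltW.
have t1 := tint_le false z C_ge0; have t2 := tint_le false z LS.
have t1' := tint_ge0 false 0 C z; have t2' := tint_ge0 false (C + L) S z.
move: t1 t2 t1' t2'; rewrite -(fineK (tint_fin false z C_ge0)) -(fineK (tint_fin false z LS)) !lee_fin.
set x1 := fine _; set x2 := fine _ => t1 t2 t1' t2'.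
have t3 : x2 <= B * lmax by apply: (le_trans t2); apply: ler_wpM2l => //; lra.
have := HM n; set y := orbsum H z n => Hy.
have c0 := C_ge0; have l0 := lmax_ge0.
have qL : `|q * (L - S)| <= `|q| * (C + lmax).
  by rewrite normrM ler_wpM2l // ler_norml; apply/andP; split; lra.
have main : `|q * S - (x1 + (y + q * L) + x2)| <= K + e / 2 * S.
  rewrite (_ : _ - _ = - (x1 + x2) - y - q * (L - S)); last by ring.
  rewrite (le_trans (ler_normB _ _)) // (le_trans (lerD (ler_normB _ _) (lexx _))) // normrN.
  have -> : `|x1 + x2| = x1 + x2 by rewrite ger0_norm // addr_ge0.
  have : e * lmin / 2 * n%:R <= e / 2 * S.
    rewrite (_ : e * lmin / 2 * n%:R = e / 2 * (n%:R * lmin)); last by ring.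
    by apply: ler_wpM2l; lra.
  rewrite /K; move: t1; rewrite subr0 => t1 h; lra.
apply: avg_div => //; apply: (le_lt_trans main).
move: SK; rewrite ltr_pdivrMr // => SK; lra.
Unshelve. all: by end_near. Qed.

End Generation.

Theorem suspension_limit : 0 <= C -> exists Q : probability (PM R) R,
  S_ergodic Q /\ ~ trivial_distr Q /\
  forall z, typical z -> N z -> forall f : PM R -> R, weak_continuous f ->
  (fun S : R => S^-1 * Rintegral lebesgue_measure `[0, S]%classic (fun s => f (F false z s)))
    @ +oo --> Rintegral Q (Pm11 : set (PM R)) f.
Proof.
move=> C_ge0; exists (Qlim : probability (PM R) R); split.
  split; first exact: Qlim_Msq.
  by split; [move=> tt tt0 E mE; exact: Qlim_invariant|exact: Qlim_ergodic].
split; first exact: Qlim_nontrivial.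
move=> z ty Nz f wf; have [B HB] := weak_continuous_bounded wf.
(* Boundedness permits adding a constant to make the observable nonnegative, as the Tonelli
   arguments require; it is removed from the average and from the integral at the end. *)
pose g (m : PMT R) : R := f m + B.
have wg : weak_continuous g.
  move=> m Pm eps e0; have [n [gg [del [del0 [cg H]]]]] := wf m Pm eps e0.
  exists n, gg, del; split => //; split => // m' /H.
  by rewrite /g opprD addrACA subrr addr0.
have g0 m : Pm11 m -> 0 <= g m by move=> /HB; rewrite ler_norml /g => /andP[]; lra.
have gB m : Pm11 m -> g m <= 2 * B by move=> /HB; rewrite ler_norml /g => /andP[]; lra.
have tav := time_average C_ge0 wg g0 gB ty Nz.
rewrite -(Qlim_integral wg g0 gB) in tav.
have mPm : measurable (Pm11 : set (PM R)) by exact: measurable_Pm11.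
have QP : Qlim (Pm11 : set (PM R)) = 1%E by apply: Qlim_full => b y s; exact: F_Pm11.
have Qfin : (Qlim (Pm11 : set (PM R)) < +oo)%E by rewrite QP ltry.
have Eg : Rintegral Qlim (Pm11 : set (PM R)) g = Rintegral Qlim (Pm11 : set (PM R)) f + B.
  rewrite /g RintegralD //.
  - by rewrite (Rintegral_cst Qlim mPm B) [X in fine X]QP mulr1.
  - by apply: (le_bounded_integrable (B := B)) => //; exact: (@weak_continuous_measurable R f wf).
  - by apply: (le_bounded_integrable (B := `|B|)).
have Et (S : R) : 0 < S ->
    S^-1 * Rintegral lebesgue_measure `[0, S]%classic (fun s => g (F false z s)) =
    S^-1 * Rintegral lebesgue_measure `[0, S]%classic (fun s => f (F false z s)) + B.
  move=> S0.
  have lS : lebesgue_measure (`[0, S]%classic : set R) = S%:E.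
    by rewrite lebesgue_measure_itv /= lte_fin S0 sube0.
  have lfin : (lebesgue_measure (`[0%R, S]%classic : set R) < +oo)%E by rewrite lS ltry.
  rewrite /g RintegralD //.
  - rewrite (Rintegral_cst lebesgue_measure (measurable_itv _) B) [X in fine X]lS /= mulrDr.
    by rewrite [B * S]mulrC mulKf // gt_eqF.
  - apply: (le_bounded_integrable (B := B)) => //.
      by apply: measurable_funTS; exact: measurable_fs.
    by move=> s _; apply: HB; exact: F_Pm11.
  - by apply: (le_bounded_integrable (B := `|B|)).
rewrite -(addrK B (Rintegral Qlim (Pm11 : set (PM R)) f)) -Eg.
apply: cvg_trans (cvgB tav (cvg_cst B)); apply: near_eq_cvg; near=> S.
have S0 : 0 < S by near: S; apply: nbhs_pinfty_gt; exact: num_real.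
by rewrite fctE /= Et // addrK.
Unshelve. all: by end_near. Qed.

End Suspension.

(** * Generation on almost every fibre *)

Section Concrete.
Context {R : realType} {I : finType} {i0 : I}.
Variables (k : I -> nat) (r : I -> R) (t : I -> nat -> R).
Variables (p : I -> nat -> R) (q : I -> R).
Variable P : probability (SeqSp i0) R.
Variable mu : SeqSp i0 -> probability (SeqSp 0%N) R.
Variable eta : SeqSp i0 -> probability R R.
Hypothesis k_gt0 : forall i, (0 < k i)%N.
Hypothesis r_cond : forall i, r i != 0 /\ `|r i| < 1.
Hypothesis p_gt0 : forall i a, (a < k i)%N -> 0 < p i a.
Hypothesis P_cyl : forall w : seq I,
  P (@cyl I i0 w) = (\prod_(n < size w) q (nth i0 w n))%:E.
Hypothesis mu_cyl : forall (om : SeqSp i0) (w : seq nat),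
  mu om (@cyl nat 0%N w) = (\prod_(n < size w)
    (if (nth 0%N w n < k (om n))%N then p (om n) (nth 0%N w n) else 0))%:E.
Hypothesis eta_push : forall (om : SeqSp i0) (A : set R), measurable A ->
  eta om A = mu om (Pi r t om @^-1` A).

Local Notation lt0 := (l0 (i0 := i0) k_gt0).
Local Notation Z := (SeqSp lt0).
Local Notation X := (@point_of R I i0 k r t k_gt0 : Z -> R).
Local Notation omz := (@omz I i0 k k_gt0).

Local Notation lam := (lam mu k_gt0).
Local Notation nuZ := (nuZ P mu (k_gt0 := k_gt0)).
Local Notation nz := (nuP P k_gt0 mu_cyl).
Local Notation J := (`[(-1)%R, 1%R]%classic : set R).
Implicit Types (om : SeqSp i0) (z : Z) (g : R -> R).

Let mX : measurable_fun setT X. Proof. exact: measurable_point. Qed.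
Let lam_fin := @lam_fin R I i0 k mu k_gt0.
Let lamT := @lamT R I i0 k mu k_gt0.
Let eta_lam := eta_lam k_gt0 r_cond mu_cyl eta_push.
Local Notation scn := (scn r t eta (k_gt0 := k_gt0)).

Lemma ae_setC0 (d : measure_display) (T : measurableType d)
  (m : {measure set T -> \bar R}) (A : set T) : measurable A ->
  {ae m, forall x, A x} -> m (~` A) = 0%E.
Proof. by move=> mA aeA; apply: measure_negligible => //; exact: measurableC. Qed.

Lemma ae_impl (d : measure_display) (T : measurableType d)
  (m : {measure set T -> \bar R}) (A B : T -> Prop) : (forall x, A x -> B x) ->
  {ae m, forall x, A x} -> {ae m, forall x, B x}.
Proof. by move=> AB; exact: filterS. Qed.

Lemma ae_conj (d : measure_display) (T : measurableType d)
  (m : {measure set T -> \bar R}) (A B : T -> Prop) :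
  {ae m, forall x, A x} -> {ae m, forall x, B x} -> {ae m, forall x, A x /\ B x}.
Proof. by move=> aeA aeB; apply: filterS2 aeA aeB. Qed.

Lemma delta0E (A : set R) : (delta0 : PMT R) A = (((0 : R) \in A)%:R)%:E.
Proof. exact: diracE. Qed.

Lemma delta0_Msq : Msq (delta0 : PM R).
Proof.
split; first split.
- by rewrite delta0E in_setT.
- by rewrite delta0E memNset //= => H; apply: H; rewrite in_itv /= lerN10 ler01.
- by move=> e e0; rewrite delta0E mem_set ?lte_fin //= in_itv /= oppr_lt0 e0.
Qed.

Lemma delta0_flow tt : meq (Sflow tt (delta0 : PMT R)) (delta0 : PMT R).
Proof.
move=> A mA; rewrite /Sflow /zoom /mscale /= /mrestr /= /pf /pushforward.
have e0 := expR_ge0 (- tt).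
rewrite !delta0E mem_set /=; last by rewrite in_itv /= sub0r add0r oppr_le0 e0.
rewrite /mscale /= normr1 invr1 mul1e /dirac /= ?indicE; congr ((nat_of_bool _)%:R%:E).
apply/idP/idP; rewrite !inE /= /aff subrr mul0r; first by case.
by move=> A0; split => //=; rewrite in_itv /= lerN10 ler01.
Qed.

Lemma measurable_omz : measurable_fun setT (omz : Z -> SeqSp i0).
Proof.
apply: measurable_fun_seqsp => w.
have := measurable_prefix (t0 := lt0) (size w) [set v | map tag v = w].
congr (measurable _); apply/seteqP; split => z /=; rewrite cylE.
  by rewrite /mkseq -map_comp.
by rewrite /mkseq -map_comp.
Qed.

Lemma nuZ_omz (B : set (SeqSp i0)) : measurable B -> P B = 0%E ->
  nuZ [set z | B (omz z)] = 0%E.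
Proof.
move=> mB B0.
have mBz : measurable [set z : Z | B (omz z)].
  by have := measurable_omz measurableT mB; rewrite setTI.
transitivity (\int[P]_om (\1_B om)%:E)%E; last by rewrite integral_indic // setIT.
apply: eq_integral => om _.
have [Bo|Bo] := pselect (B om).
  rewrite indicE mem_set //= -[RHS](lamT om); apply: lam_fiber => // z zo; split => // _.
  by rewrite /= zo.
rewrite indicE memNset //= -[RHS](measure0 (lam om)); apply: lam_fiber => // z zo.
by split => //=; rewrite zo.
Qed.

Lemma atomless_shiftn n om : (forall x, eta ((fun i => om (n + i)%N) : SeqSp i0) [set x] = 0%E) ->
  forall x, eta om [set x] = 0%E.
Proof.
elim: n om => [|n IH] om H; first exact: H.
by apply: (atomless_shift k_gt0 r_cond p_gt0 mu_cyl eta_push); apply: IH => x; exact: H.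
Qed.

(** Strong separation makes the coding of a fibre injective with quantitative gaps: balls of radius
    [d * rmin r ^+ n] around the points of a cylinder of length [n] miss all other points of the
    fibre. An exceptional set of codes thus becomes an exceptional Borel set of points. *)
Lemma fiber_event d om (E : set Z) : 0 < d ->
  (forall z z' : Z, omz z = omz z' -> z 0%N <> z' 0%N -> d <= `|X z - X z'|) ->
  measurable E ->
  exists2 A : set R, measurable A & forall z, omz z = om -> (A (X z) <-> E z).
Proof.
move=> d0 gap; apply: (seqsp_induction (P := fun E : set Z =>
  exists2 A : set R, measurable A & forall z, omz z = om -> (A (X z) <-> E z))).
- move=> w; exists (\bigcup_(z in [set z : Z | omz z = om /\ cyl (t0 := lt0) w z])
    ball (X z) (d * rmin r ^+ size w)).
    by apply: open_measurable; apply: bigcup_open => z _; exact: ball_open.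
  move=> z' oz'; split=> [[z [oz cz] bz]|cz'].
    have ag : agree (size w) z z'.
      apply: contrapT => nag; have := point_sep r_cond d0 gap (etrans oz (esym oz')) nag.
      by rewrite leNgt => /negP; apply.
    by apply/cylP => n nw; rewrite -ag //; move/cylP : cz; exact.
  exists z' => //; apply: ballxx; by rewrite mulr_gt0 // exprn_gt0 // rmin_gt0.
- move=> S mS [A mA AS]; exists (~` A); first exact: measurableC.
  by move=> z oz; split; apply: contra_not => /(AS z oz).
- move=> S mS _ H.
  have /choice [A HA] : forall n, exists A : set R, measurable A /\
      forall z, omz z = om -> (A (X z) <-> S n z).
    by move=> n; have [A mA AS] := H n; exists A.
  exists (\bigcup_n A n); first by apply: bigcupT_measurable => n; exact: (HA n).1.
  by move=> z oz; split=> -[n _ h]; exists n => //; apply/(HA n).2.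
Qed.

Let inv_small (e : R) : 0 < e -> exists n0, forall n, (n0 <= n)%N -> n.+1%:R^-1 < e.
Proof.
move=> e0; exists (Num.bound e^-1) => n hn.
rewrite -[e]invrK ltf_pV2 ?posrE ?invr_gt0 //.
apply: lt_le_trans (archi_boundP _) _; first by rewrite invr_ge0 ltW.
by rewrite ler_nat leqW.
Qed.

(** By compactness of the code space the fibre is the intersection of its neighbourhoods, which are
    open; the code of a point in the intersection is a limit supplied by [konig]. *)
Lemma measurable_image om : exists Y : set R, [/\ measurable Y,
  forall z, omz z = om -> Y (X z) & forall x, Y x -> exists2 z, omz z = om & X z = x].
Proof.
pose G n := \bigcup_(z in [set z : Z | omz z = om]) ball (X z) n.+1%:R^-1.
exists (\bigcap_n G n); split.
- apply: bigcapT_measurable => n; apply: open_measurable; apply: bigcup_open => z _; exact: ball_open.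
- by move=> z oz n _; exists z => //; apply: ballxx; rewrite invr_gt0.
move=> x Yx.
have /choice [y Hy] : forall n, exists z : Z, omz z = om /\ `|X z - x| < n.+1%:R^-1.
  by move=> n; have [z oz bz] := Yx n Logic.I; exists z.
have [l Hl] := konig (fun n => (y n : nat -> letter k)).
have ol : omz (l : Z) = om.
  apply/funext => i; have [n _ ag] := Hl i.+1.
  by rewrite -(Hy n).1 /Submission.omz (ag i).
exists (l : Z) => //; have [//|ne] := eqVneq (X (l : Z)) x; exfalso.
have e0 : 0 < `|X (l : Z) - x| / 2 by rewrite divr_gt0 // normr_gt0 subr_eq0.
have [n1 h1] := @rmax_small R I i0 k r t r_cond _ e0.
have [n2 h2] := inv_small e0.
have [n nm ag] := Hl (maxn n1 n2).
have a1 : agree n1 (y n) (l : Z).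
  by move=> i i1; apply: ag; rewrite (leq_trans i1) // leq_maxl.
have := point_close t r_cond a1; have := (Hy n).2.
have := h2 n (leq_trans (leq_maxr n1 n2) nm) => h3 h4 h5.
have : `|X (l : Z) - x| <= `|X (y n) - X (l : Z)| + `|X (y n) - x|.
  rewrite (_ : X (l : Z) - x = (X (y n) - x) - (X (y n) - X (l : Z))); last by ring.
  by apply: (le_trans (ler_normB _ _)); rewrite addrC.
move=> h6; have := le_lt_trans h5 h1; have := lt_trans h4 h3; lra.
Qed.

Let sg (b : bool) : R := if b then -1 else 1.

Let sg_norm b : `|sg b| = 1. Proof. by case: b; rewrite /sg ?normrN normr1. Qed.

Let sc_neq0 b s : sg b * expR (- s) != 0.
Proof.
apply: mulf_neq0; last by rewrite gt_eqF ?expR_gt0.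
by case: b; rewrite /sg ?oppr_eq0 oner_eq0.
Qed.

(** The abstract suspension is fed with the actual sceneries. The null set of bad codes is then
    passed to almost every fibre by [ae_nuZ], and inside such a fibre to a null set of points by
    [fiber_event]. *)
Theorem fiberwise_generation : SSC k r t ->
  {ae P, forall om : SeqSp i0, forall x : R, eta om [set x] = 0%E} ->
  exists Q : probability (PM R) R,
    S_ergodic Q /\ ~ trivial_distr Q /\
    {ae P, forall om : SeqSp i0, generates (eta om) Q}.
Proof.
move=> ssc [B [mB B0 subB]].
have [d d0 gap] := @ssc_gap R I i0 k r t k_gt0 r_cond ssc.
pose sh n (z : Z) : Z := fun i => z (n + i)%N.
have msh n : measurable_fun setT (sh n) by exact: measurable_shiftn.
(* [B] is a measurable null set containing the fibres with atoms. Asking for infinitely many good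
   shifts makes [N] invariant under the shift in both directions, while a single good shift already
   excludes atoms by [atomless_shiftn]. *)
pose N : set Z := [set z | forall j, exists2 n, (j <= n)%N & ~ B (omz (sh n z))].
have mBz n : measurable [set z : Z | B (omz (sh n z))].
  by have := measurableT_comp measurable_omz (msh n) measurableT mB; rewrite setTI.
have mN : measurable N.
  rewrite (_ : N = \bigcap_j \bigcup_n (if (j <= n)%N then ~` [set z | B (omz (sh n z))] else set0)).
    apply: bigcapT_measurable => j; apply: bigcupT_measurable => n.
    by case: ifP => // _; apply: measurableC.
  apply/seteqP; split => z H j; first by have [n jn nB] := H j => _; exists n => //; rewrite jn.
  by have [n _] := H j Logic.I; case: ifP => // jn nB; exists n.
have mBo : measurable [set z : Z | B (omz z)].
  by have := measurable_omz measurableT mB; rewrite setTI.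
have nuc : forall w : seq (letter k), nz (cyl (t0 := lt0) w) = (\prod_(a <- w) pz p q a)%:E.
  exact: (nuZ_cyl k_gt0 p_gt0 P_cyl mu_cyl).
have aeN : {ae nz, forall z, N z}.
  have : {ae nz, forall z, forall n, ~ B (omz (sh n z))}.
    apply: (ae_foralln (P := fun (n : nat) (z : Z) => ~ B (omz (sh n z)))) => n.
    have e : nz [set z | B (omz (sh n z))] = 0%E.
      rewrite -[RHS](nuZ_omz mB B0); exact: (measurable_shift_iter nuc n mBo).
    exists [set z | B (omz (sh n z))]; split; [exact: mBz|exact: e|].
    by move=> z /= /contrapT.
  by apply: ae_impl => z H j; exists j.
have N0 : nz (~` N) = 0%E.
  exact: (ae_setC0 mN aeN).
have NS z : N z <-> N (shift z : Z).
  split=> H j; last by have [n jn nB] := H j; exists n.+1 => //; rewrite leqW.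
  by have [[|n] // jn nB] := H j.+1; exists n.
have Natom z : N z -> forall x, eta (omz z) [set x] = 0%E.
  move=> Nz; have [n _ nB] := Nz 0%N; apply: (@atomless_shiftn n).
  have [//|bad] := pselect (forall x, eta (omz (sh n z)) [set x] = 0%E).
  by case: nB; exact: subB.
pose neg (a : letter k) := r (tag a) < 0.
pose ell (a : letter k) := - ln `|r (tag a)|.
(* From this height on [expR (- s)] is below the gap [d], since [- ln d <= |ln d| < C]. *)
pose C := `|ln d| + 1.
have C0 : 0 <= C by rewrite addr_ge0.
have small s : C <= s -> expR (- s) < d.
  move=> Cs; rewrite -[d in _ < d]lnK ?posrE // ltr_expR.
  have : - ln d <= `|ln d| by rewrite -normrN ler_norm.
  by move: Cs; rewrite /C; lra.
have rpos i : 0 < `|r i| := r_gt0 r_cond i.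
have rmax0 : 0 < rmax r by exact: lt_le_trans (rpos i0) (le_rmax r i0).
have lmin0 : 0 < - ln (rmax r) by rewrite oppr_gt0 ln_lt0 // rmax0 rmax_lt1.
have lminle a : - ln (rmax r) <= ell a.
  by rewrite lerN2 ler_ln ?posrE // le_rmax.
have lmaxge a : ell a <= - ln (rmin r).
  by rewrite lerN2 ler_ln ?posrE // ?rmin_gt0 // rmin_le.
pose F b z s : PMT R := if `[< N z >] then scn z (sg b * expR (- s)) else (delta0 : PM R).
have FN b z s : N z -> F b z s = scn z (sg b * expR (- s)) by move=> Nz; rewrite /F asboolT.
have FO b z s : ~ N z -> F b z s = (delta0 : PM R) by move=> Nz; rewrite /F asboolF.
have FM b z s : Msq (F b z s : PM R).
  have [Nz|Nz] := pselect (N z); last by rewrite FO //; exact: delta0_Msq.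
  by rewrite FN //; apply: (Msq_scn r_cond p_gt0 mu_cyl eta_push).
have Fflow b z s tt : 0 <= tt -> meq (Sflow tt (F b z s)) (F b z (s + tt)).
  move=> tt0; have [Nz|Nz] := pselect (N z); last by rewrite !FO //; exact: delta0_flow.
  rewrite !FN // opprD expRD mulrA.
  exact: (Sflow_scn r_cond p_gt0 mu_cyl eta_push).
have Fstep b z s : C <= s ->
    meq (F b z (s + ell (z 0%N))) (F (b (+) neg (z 0%N)) (shift z) s).
  move=> Cs; have [Nz|Nz] := pselect (N z); last first.
    have Ns : ~ N (shift z : Z) by move=> /(NS z).2.
    by rewrite (FO _ _ _ Nz) (FO _ _ _ Ns).
  rewrite (FN _ _ _ Nz) (FN _ _ _ ((NS z).1 Nz)).
  (* Crossing a roof multiplies the signed scale by the contraction ratio: its modulus is absorbed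
     by [ell], its sign by [neg]. *)
  have -> : sg b * expR (- (s + ell (z 0%N))) =
      sg (b (+) neg (z 0%N)) * expR (- s) * r (omz z 0%N).
    have e1 : expR (- (s + ell (z 0%N))) = expR (- s) * `|r (omz z 0%N)|.
      by rewrite opprD expRD /ell opprK lnK // posrE; exact: rpos.
    have e2 : sg b * `|r (omz z 0%N)| = sg (b (+) neg (z 0%N)) * r (omz z 0%N).
      rewrite /neg -/(omz z 0%N); case: ltrP => rn; [rewrite ltr0_norm //|rewrite ger0_norm //];
      by case: b; rewrite /sg /=; ring.
    by rewrite e1 mulrCA e2 mulrCA mulrA.
  apply: (scn_selfsim r_cond p_gt0 mu_cyl eta_push gap) => //.
  by rewrite normrM sg_norm mul1r gtr0_norm ?expR_gt0 // small.
have Fcont b z s g eps : N z -> cont11 g -> 0 < eps ->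
    exists (m : nat) (del : R), 0 < del /\ forall (z' : Z) s', N z' ->
    (forall i, (i < m)%N -> z i = z' i) -> `|s' - s| < del ->
    `|wint g (F b z' s') - wint g (F b z s)| < eps.
  move=> Nz cg eps0.
  have [m [del [del0 H]]] := scn_continuous r_cond p_gt0 mu_cyl eta_push (sc_neq0 b s) cg eps0 (Natom z Nz).
  have ce : {for s, continuous (fun u : R => expR (- u))}.
    by apply: continuous_comp; [exact: opp_continuous|exact: continuous_expR].
  have /cvgrPdist_lt /(_ _ del0) := ce; move=> /nbhs_ballP [e /= e0 He].
  exists m, e; split => // z' s' Nz' ag s'e; rewrite !FN //.
  apply: (H _ _ ag _).2; rewrite -mulrBr normrM sg_norm mul1r distrC; apply: He.
  by rewrite /ball /= distrC.
have Fatom b z s : N z -> F b z s [set 0] = 0%E.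
  move=> Nz; rewrite FN // /Submission.scn zmE.
  have m0 : measurable (aff (X z) (sg b * expR (- s)) @^-1` ([set 0] `&` J)).
    rewrite -[X in measurable X]setTI; apply: measurable_aff => //.
    by apply: measurableI => //; exact: measurable_itv.
  rewrite [X in (_ * X)%E](_ : _ = 0%E); first by rewrite mule0.
  apply: (subset_measure0 (B := [set X z])) => //; last exact: Natom.
  move=> y [/= + _]; rewrite /aff => /eqP; rewrite mulf_eq0 invr_eq0 (negbTE (sc_neq0 b s)) orbF.
  by rewrite subr_eq0 => /eqP.
have [Q [erg [nt gen]]] := suspension_limit nuc lmin0 lminle lmaxge mN N0
  (fun z => (NS z).1) FM Fflow Fstep Fcont Fatom FO C0.
exists Q; split => //; split => //.
have aeZ : {ae nz, forall z, typical nz neg z /\ N z}.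
  exact: (ae_conj (all_word_frequencies nuc neg) aeN).
apply: filterS (ae_nuZ mu_cyl aeZ) => om [E [mE E0 sE]].
have [A mA AE] := fiber_event om d0 gap mE.
have [Y [mY YX Ysurj]] := measurable_image om.
have mXA (D : set R) : measurable D -> measurable (X @^-1` D : set Z).
  by move=> mD; rewrite -[X in measurable X]setTI; exact: mX.
have etaA : eta om A = 0%E.
  by rewrite eta_lam // -[RHS]E0; apply: lam_fiber => //; exact: mXA.
have etaY : eta om (~` Y) = 0%E.
  rewrite eta_lam; last exact: measurableC.
  rewrite -[RHS](measure0 (lam om)); apply: lam_fiber => //; first by apply: mXA; exact: measurableC.
  by move=> z oz; split => // nY; apply: nY; exact: YX.
(* [A] collects the points with exceptional code; the complement of [Y] covers the reals that have
   no code on this fibre. *)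
exists (A `|` ~` Y); split.
- by apply: measurableU => //; exact: measurableC.
- by rewrite measureU0 //; exact: measurableC.
move=> x bad; apply: contrapT => nAY; apply: bad.
have [Yx|nY] := pselect (Y x); last by case: nAY; right.
have [z oz Xz] := Ysurj x Yx.
have [ty Nz] : typical nz neg z /\ N z.
  apply: contrapT => nz; apply: nAY; left; rewrite -Xz; apply/(AE z oz); exact: sE.
move=> f wf; have := gen z ty Nz f wf; apply: cvg_trans; apply: near_eq_cvg.
apply: nearW => S; congr (_ * _); apply: eq_Rintegral => s.
rewrite inE /= in_itv /= => /andP[s0 _]; rewrite FN // /sg mul1r -oz -Xz.
apply: meq_weak_continuous => //.
  by apply: (Pm11_scn r_cond p_gt0 mu_cyl eta_push); rewrite gt_eqF // expR_gt0.
by apply: meq_sym; exact: (Sflow_loc r_cond p_gt0 mu_cyl eta_push z s0).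
Qed.

End Concrete.

Theorem theorem1p3 (R : realType) (I : finType) (i0 : I)
  (k : I -> nat) (r : I -> R) (t : I -> nat -> R)
  (p : I -> nat -> R) (q : I -> R)
  (P : probability (SeqSp i0) R)
  (mu : SeqSp i0 -> probability (SeqSp 0%N) R)
  (eta : SeqSp i0 -> probability R R) :
  (* the IFSs Phi^(i): k_i >= 1 maps with common ratio r_i in (-1,0) u (0,1) *)
  (forall i, (0 < k i)%N) ->
  (forall i, r i != 0 /\ `|r i| < 1) ->
  (* strictly positive probability vectors p_i on {0, .., k_i - 1} *)
  (forall i a, (a < k i)%N -> 0 < p i a) ->
  (forall i, \sum_(a < k i) p i a = 1) ->
  (* P is the Bernoulli measure with probability vector q on I *)
  (forall i, 0 <= q i) -> \sum_(i : I) q i = 1 ->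
  (forall w : seq I, P (@cyl I i0 w) = (\prod_(n < size w) q (nth i0 w n))%:E) ->
  (* mu om is the product measure prod_n p_{om_n} on sequences of digits *)
  (forall (om : SeqSp i0) (w : seq nat),
      mu om (@cyl nat 0%N w) =
      (\prod_(n < size w)
         (if (nth 0%N w n < k (om n))%N then p (om n) (nth 0%N w n) else 0))%:E) ->
  (* eta om = Pi_om mu om *)
  (forall (om : SeqSp i0) (A : set R), measurable A ->
      eta om A = mu om (Pi r t om @^-1` A)) ->
  (* strong separation condition *)
  SSC k r t ->
  (* non-trivial model *)
  {ae P, forall om : SeqSp i0, forall x : R, eta om [set x] = 0%E} ->
  exists Q : probability (PM R) R,
    S_ergodic Q /\ ~ trivial_distr Q /\
    {ae P, forall om : SeqSp i0, generates (eta om) Q}.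
Proof.
move=> *.
by apply: (@fiberwise_generation R I i0 k r t p q P mu eta); assumption.
Qed.
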